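(* Let $m=\lambda=0$, $\beta>0$, and let $K$ satisfy (I), either (II) or (III), and Assumption 2. Let $\nu$ be a nonnegative Borel measure with $\int\nu(d\omega)/(1+\omega^2)^k<\infty$ for some integer $k\ge0$ and $V$ the associated operator. Then $V$ is a weak solution of the GLE (with parameters $m=\lambda=0$, $\beta$, kernel $K$) if and only if $\nu(d\omega)=\widehat r(\omega)d\omega$ with $\widehat r(\omega)=\dfrac{\widehat K(\omega)}{2\pi\beta|\widehat{K^+}(\omega)|^2}$.
   Context: Notation: for $f:\mathbb{R}\to\mathbb{C}$, $\widehat f(\omega)=\int f(t)e^{-it\omega}dt$; $\mathcal S$ Schwartz space, $\mathcal S'$ tempered distributions, $\mathcal F[g]$ the Fourier transform of $g\in\mathcal S'$. $\widetilde f(x)=f(-x)$, $K^+(t)=K(t)1_{\{t\ge0\}}$. For $\omega\ne0$: $\mathcal K_{\cos}(\omega)=\int_0^\infty K(t)\cos(t\omega)dt$, $\mathcal K_{\sin}(\omega)=\int_0^\infty K(t)\sin(t\omega)dt$ (improper integrals), $\widehat K(\omega):=2\mathcal K_{\cos}(\omega)$, $\widehat{K^+}(\omega):=\mathcal K_{\cos}(\omega)-i\mathcal K_{\sin}(\omega)$. Conditions on $K:\mathbb{R}\to[0,\infty]$ ($K(0)$ possibly infinite): (I) (a) $K$ symmetric, $K(t)>0$ for $t\ne0$; (b) $K(t)\to0$ as $t\to\infty$ and $K$ eventually decreasing; (c) $K\in L^1_{loc}(\mathbb{R})$; (d) $\mathcal K_{\cos}(\omega)>0$ for all $\omega\ne0$.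 (II) $K\in L^1(\mathbb{R})$. (III) $K\notin L^1$ and $\lim_{t\to\infty}t^\alpha K(t)\in(0,\infty)$ for some $\alpha\in(0,1)$. Assumption 2: (IV) $K\in C^2(0,\infty)$ is convex on $(0,\infty)$ and $K''$ is monotone on some $(0,\epsilon)$; and either (V) $K(0)<\infty$ and $\lim_{t\to0^+}t^{\sigma_1}K'(t)=0$ for some $\sigma_1\in(0,1)$, or (VI) $K(0)=\infty$ and $\lim_{t\to0^+}t^{\sigma_2}K(t)\in(0,\infty)$ for some $\sigma_2\in(0,1)$. Operator associated with $\nu$: with $\xi$ a Gaussian random measure w.r.t. $\nu$ ($\mathbb{E}[\xi(E_1)\overline{\xi(E_2)}]=\nu(E_1\cap E_2)$), $\langle V,g\rangle=\int\overline{\mathcal F[g](\omega)}\xi(d\omega)$ for $g\in\mathrm{Dom}(V)=\{g\in\mathcal S':\mathcal F[g]$ is a function in $L^2(\nu)\}$. Noises $\dot W,F$: stationary random distributions on a common probability space with $\mathbb{E}[\langle\dot W,\varphi_1\rangle\langle\dot W,\varphi_2\rangle]=\int\varphi_1\varphi_2$, $\mathbb{E}[\langle F,\varphi_1\rangle\overline{\langle F,\varphi_2\rangle}]=\int K(t)(\varphi_1*\widetilde{\varphi_2})(t)dt$. Weak solution (parameters $m,\lambda\ge0,\beta>0$): such an operator $V$ with (a) $K^+*\varphi\in\mathrm{Dom}(V)$ for all $\varphi\in\mathcal S$ and (b) $\mathbb{E}[\langle V,L\varphi\rangle\overline{\langle V,L\psi\rangle}]=\mathbb{E}[\langle\sqrt{2\lambda}\dot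 W+\sqrt\beta F,\varphi\rangle\overline{\langle\sqrt{2\lambda}\dot W+\sqrt\beta F,\psi\rangle}]$ for all $\varphi,\psi\in\mathcal S$, where $L\varphi=-m\varphi'+\lambda\varphi+\beta\widetilde{K^+*\widetilde\varphi}$. *)

(* Defs.v *)
From HB Require Import structures.
From mathcomp Require Import all_boot all_order all_algebra.
From mathcomp Require Import all_classical all_reals all_analysis.

Set Implicit Arguments.
Unset Strict Implicit.
Unset Printing Implicit Defensive.

Import Order.TTheory GRing.Theory Num.Theory.
Import numFieldNormedType.Exports.

Local Open Scope classical_set_scope.
Local Open Scope ring_scope.

Section GLE.
Variable R : realType.

Local Notation leb := (@lebesgue_measure R).

(* real part of the kernel (K(0) may be +oo; this point is Lebesgue-null) *)
Definition Kr (K : R -> \bar R) (t : R) : R := fine (K t).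

Definition schwartz (f : R -> R) : Prop :=
  (forall (n : nat) (x : R), derivable (derive1n n f) x 1) /\
  (forall a b : nat, exists C : R, forall x : R,
      `| x ^+ a * derive1n b f x | <= C).

Definition ft_re (psi : R -> R) (w : R) : R :=
  Rintegral leb setT (fun t => psi t * cos (t * w)).
Definition ft_im (psi : R -> R) (w : R) : R :=
  - Rintegral leb setT (fun t => psi t * sin (t * w)).

(* The tempered distribution induced by the function g has Fourier
   transform equal to the function h = hr + i hi :
   <F[g], psi> = <g, \hat psi> = int h psi, for every Schwartz psi.   *)
Definition fourier_is (g hr hi : R -> R) : Prop :=
  forall psi : R -> R, schwartz psi ->
  [/\ leb.-integrable setT (fun w => (g w * ft_re psi w)%:E),
      leb.-integrable setT (fun w => (g w * ft_im psi w)%:E),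
      leb.-integrable setT (fun w => (hr w * psi w)%:E) &
      leb.-integrable setT (fun w => (hi w * psi w)%:E)] /\
  (Rintegral leb setT (fun w => g w * ft_re psi w)
        = Rintegral leb setT (fun w => hr w * psi w) /\
      Rintegral leb setT (fun w => g w * ft_im psi w)
        = Rintegral leb setT (fun w => hi w * psi w)).

(* Canonical pointwise representative of F[g]: Gauss-regularised values
   lim_{e -> 0+} int g(t) e^{-itw} e^{-e t^2} dt. *)
Definition gauss_ft_re (g : R -> R) (w : R) : (R -> R) :=
  fun e => Rintegral leb setT (fun t => g t * cos (t * w) * expR (- (e * t ^+ 2))).
Definition gauss_ft_im (g : R -> R) (w : R) : (R -> R) :=
  fun e => - Rintegral leb setT (fun t => g t * sin (t * w) * expR (- (e * t ^+ 2))).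
Definition Fre (g : R -> R) (w : R) : R := lim (gauss_ft_re g w @ at_right 0).
Definition Fim (g : R -> R) (w : R) : R := lim (gauss_ft_im g w @ at_right 0).

Definition inDom (nu : {measure set R -> \bar R}) (g : R -> R) : Prop :=
  [/\ {ae nu, forall w, cvg (gauss_ft_re g w @ at_right 0)
                    /\ cvg (gauss_ft_im g w @ at_right 0)},
      fourier_is g (Fre g) (Fim g),
      measurable_fun setT (Fre g), measurable_fun setT (Fim g) &
      (\int[nu]_w ((Fre g w) ^+ 2 + (Fim g w) ^+ 2)%:E < +oo)%E].

Definition finset_nu (nu : {measure set R -> \bar R}) (E : set R) : Prop :=
  measurable E /\ (nu E < +oo)%E.

Definition expect d (T : measurableType d) (P : probability T R) (X : T -> R) : R :=
  Rintegral P setT X.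

Definition L2P d (T : measurableType d) (P : probability T R) (X : T -> R) : Prop :=
  measurable_fun setT X /\ P.-integrable setT (fun w => (X w ^+ 2)%:E).

(* xi(E) = xr E + i xim E is a centered complex Gaussian random measure
   with E[xi(E1) conj(xi(E2))] = nu(E1 /\ E2). *)
Definition gauss_rand_meas (nu : {measure set R -> \bar R})
    d (T : measurableType d) (P : probability T R)
    (xr xim : set R -> T -> R) : Prop :=
  [/\ (forall E, finset_nu nu E -> L2P P (xr E) /\ L2P P (xim E)),
      (forall E1 E2, finset_nu nu E1 -> finset_nu nu E2 ->
         expect P (fun w => xr E1 w * xr E2 w + xim E1 w * xim E2 w)
           = fine (nu (E1 `&` E2)) /\
         expect P (fun w => xim E1 w * xr E2 w - xr E1 w * xim E2 w) = 0) &
      (* joint (centered) Gaussianity: every real linear combination of the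
         real and imaginary parts of finitely many xi(E) is centered Gaussian *)
      (forall s : seq (set R * R * R),
         (forall x, x \in s -> finset_nu nu x.1.1) ->
         let Y := fun w => \sum_(x <- s) (x.1.2 * xr x.1.1 w + x.2 * xim x.1.1 w) in
         forall u : R,
           expect P (fun w => cos (u * Y w))
             = expR (- (u ^+ 2 * expect P (fun w => Y w ^+ 2)) / 2) /\
           expect P (fun w => sin (u * Y w)) = 0)].

(* simple functions sum_j (cr_j + i ci_j) 1_{E_j} *)
Definition simple_re (s : seq (set R * R * R)) (w : R) : R :=
  \sum_(x <- s) x.1.2 * (\1_(x.1.1) w : R).
Definition simple_im (s : seq (set R * R * R)) (w : R) : R :=
  \sum_(x <- s) x.2 * (\1_(x.1.1) w : R).
(* their stochastic integrals sum_j c_j xi(E_j) *)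
Definition sint_re d (T : measurableType d) (xr xim : set R -> T -> R)
    (s : seq (set R * R * R)) (w : T) : R :=
  \sum_(x <- s) (x.1.2 * xr x.1.1 w - x.2 * xim x.1.1 w).
Definition sint_im d (T : measurableType d) (xr xim : set R -> T -> R)
    (s : seq (set R * R * R)) (w : T) : R :=
  \sum_(x <- s) (x.1.2 * xim x.1.1 w + x.2 * xr x.1.1 w).

Definition stoch_int (nu : {measure set R -> \bar R})
    d (T : measurableType d) (P : probability T R)
    (xr xim : set R -> T -> R) (hr hi : R -> R) (Ir Ii : T -> R) : Prop :=
  measurable_fun setT Ir /\ measurable_fun setT Ii /\
  forall s : nat -> seq (set R * R * R),
    (forall n x, x \in s n -> finset_nu nu x.1.1) ->
    (fun n => \int[nu]_w (((simple_re (s n) w - hr w) ^+ 2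
                          + (simple_im (s n) w - hi w) ^+ 2)%:E))%E
      @ \oo --> 0%E ->
    (fun n => \int[P]_w (((sint_re xr xim (s n) w - Ir w) ^+ 2
                         + (sint_im xr xim (s n) w - Ii w) ^+ 2)%:E))%E
      @ \oo --> 0%E.

(* V = Vr + i Vi is the operator associated with nu (through xi):
   <V, g> = int conj(F[g](w)) xi(dw) for g in Dom(V). *)
Definition assoc_operator (nu : {measure set R -> \bar R})
    d (T : measurableType d) (P : probability T R)
    (xr xim : set R -> T -> R) (Vr Vi : (R -> R) -> T -> R) : Prop :=
  forall g, inDom nu g ->
    stoch_int nu P xr xim (Fre g) (fun w => - Fim g w) (Vr g) (Vi g).

Definition Kplus_conv (K : R -> \bar R) (phi : R -> R) (t : R) : R :=
  Rintegral leb [set s | 0 <= s] (fun s => Kr K s * phi (t - s)).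

(* L phi = - m phi' + lambda phi + beta (K^+ * phi~)~  with m = lambda = 0,
   i.e. (L phi)(t) = beta int_0^oo K(s) phi(t + s) ds *)
Definition Lop00 (beta : R) (K : R -> \bar R) (phi : R -> R) (t : R) : R :=
  beta * Kplus_conv K (fun x => phi (- x)) (- t).

Definition conv_refl (phi psi : R -> R) (t : R) : R :=
  Rintegral leb setT (fun s => phi s * psi (s - t)).

(* weak solution with parameters m = lambda = 0, beta.  The right-hand side
   of (b) is E[<sqrt(2*0) W + sqrt(beta) F, phi> conj <..., psi>]
   = beta int K(t) (phi * psi~)(t) dt, by the covariance of F. *)
Definition weak_solution00 (beta : R) (K : R -> \bar R)
    (nu : {measure set R -> \bar R})
    d (T : measurableType d) (P : probability T R)
    (Vr Vi : (R -> R) -> T -> R) : Prop :=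
  (forall phi, schwartz phi -> inDom nu (Kplus_conv K phi)) /\
  (forall phi psi, schwartz phi -> schwartz psi ->
     [/\ inDom nu (Lop00 beta K phi), inDom nu (Lop00 beta K psi),
         (* real part of E[<V,L phi> conj <V,L psi>] *)
         expect P (fun w => Vr (Lop00 beta K phi) w * Vr (Lop00 beta K psi) w
                          + Vi (Lop00 beta K phi) w * Vi (Lop00 beta K psi) w)
           = beta * Rintegral leb setT (fun t => Kr K t * conv_refl phi psi t) &
         (* imaginary part *)
         expect P (fun w => Vi (Lop00 beta K phi) w * Vr (Lop00 beta K psi) w
                          - Vr (Lop00 beta K phi) w * Vi (Lop00 beta K psi) w)
           = 0]).

Definition Kcos_partial (K : R -> \bar R) (w : R) : R -> R :=
  fun T => Rintegral leb [set t | 0 <= t <= T] (fun t => Kr K t * cos (t * w)).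
Definition Ksin_partial (K : R -> \bar R) (w : R) : R -> R :=
  fun T => Rintegral leb [set t | 0 <= t <= T] (fun t => Kr K t * sin (t * w)).
Definition Kcos (K : R -> \bar R) (w : R) : R := lim (Kcos_partial K w @ +oo).
Definition Ksin (K : R -> \bar R) (w : R) : R := lim (Ksin_partial K w @ +oo).

(* \hat K(w) = 2 Kcos(w);  \hat{K^+}(w) = Kcos(w) - i Ksin(w) *)
Definition Khat (K : R -> \bar R) (w : R) : R := 2 * Kcos K w.
Definition Kplus_hat_abs2 (K : R -> \bar R) (w : R) : R :=
  Kcos K w ^+ 2 + Ksin K w ^+ 2.

Definition condI (K : R -> \bar R) : Prop :=
  [/\ (* (a) *) (forall t, K (- t) = K t) /\ (0 <= K 0%R)%E /\
                (forall t, t != 0 -> (0 < K t)%E /\ (K t < +oo)%E),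
      (* (b) *) (Kr K @ +oo --> 0) /\
                (exists M : R, forall x y, M <= x -> x <= y -> Kr K y <= Kr K x),
      (* (c) *) (forall a b : R, leb.-integrable [set x | a <= x <= b] K) &
      (* (d) *) (forall w : R, w != 0 ->
                  cvg (Kcos_partial K w @ +oo) /\ 0 < Kcos K w)].

Definition condII (K : R -> \bar R) : Prop := leb.-integrable setT K.

Definition condIII (K : R -> \bar R) : Prop :=
  ~ leb.-integrable setT K /\
  exists alpha c : R, [/\ 0 < alpha, alpha < 1, 0 < c &
    (fun t => t `^ alpha * Kr K t) @ +oo --> c].

Definition condIV (K : R -> \bar R) : Prop :=
  [/\ (forall x : R, 0 < x ->
         [/\ derivable (Kr K) x 1, derivable (derive1 (Kr K)) x 1 &
             {for x, continuous (derive1n 2 (Kr K))}]),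
      (forall x y t : R, 0 < x -> 0 < y -> 0 <= t -> t <= 1 ->
         Kr K (t * x + (1 - t) * y) <= t * Kr K x + (1 - t) * Kr K y) &
      (exists eps : R, 0 < eps /\
         ((forall x y, 0 < x -> x <= y -> y < eps ->
             derive1n 2 (Kr K) x <= derive1n 2 (Kr K) y) \/
          (forall x y, 0 < x -> x <= y -> y < eps ->
             derive1n 2 (Kr K) y <= derive1n 2 (Kr K) x)))].

Definition condV (K : R -> \bar R) : Prop :=
  (K 0%R < +oo)%E /\
  exists s1 : R, [/\ 0 < s1, s1 < 1 &
    (fun t => t `^ s1 * derive1 (Kr K) t) @ at_right 0 --> 0].

Definition condVI (K : R -> \bar R) : Prop :=
  K 0 = +oo%E /\
  exists s2 c : R, [/\ 0 < s2, s2 < 1, 0 < c &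
    (fun t => t `^ s2 * Kr K t) @ at_right 0 --> c].

Definition assumption2 (K : R -> \bar R) : Prop :=
  condIV K /\ (condV K \/ condVI K).

Definition rhat (beta : R) (K : R -> \bar R) (w : R) : R :=
  Khat K w / (2 * pi * beta * Kplus_hat_abs2 K w).

End GLE.

(* Main.v *)
Require Import Defs.
From HB Require Import structures.
From mathcomp Require Import all_boot all_order all_algebra.
From mathcomp Require Import all_classical all_reals all_analysis.
From mathcomp Require Import measurable_realfun ring lra.
Set Implicit Arguments.
Unset Strict Implicit.
Unset Printing Implicit Defensive.
Import Order.TTheory GRing.Theory Num.Theory.
Import numFieldNormedType.Exports.
Local Open Scope classical_set_scope.
Local Open Scope ring_scope.

(* Write kappa for K^+, and Kc - i Ks for its Fourier transform. By convexity kappa is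
   nonincreasing on (0, oo), so the second mean value theorem bounds all its oscillatory
   integrals at a frequency w <> 0; hence the Gauss-regularised transform of L phi exists
   there and equals beta (Kc - i Ks) phi^, and by the isometry of the stochastic integral
     E[<V, L phi> conj <V, L psi>] = int beta^2 (Kc^2 + Ks^2) phi^ conj(psi^) dnu.
   Parseval's formula turns the covariance of the noise into
     int (beta / pi) Kc phi^ conj(psi^) dw.
   These agree for all phi, psi when dnu = r^ dw. Conversely, take for phi the translates
   of a Gaussian psi: the two finite measures beta^2 (Kc^2 + Ks^2) |psi^|^2 dnu and
   (beta / pi) Kc |psi^|^2 dw have the same characteristic function, so they coincide, and
   one divides by the positive factor beta^2 (Kc^2 + Ks^2) |psi^|^2.
   The frequency 0 needs care: if nu charges it, then the requirement K^+ * phi in Dom(V)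
   forces K to be integrable, and then Kc 0 > 0. *)

(** The obstacle is that [kappa] may be unbounded at 0 and non-integrable at infinity, so neither
    the regularised transform nor the exchange of integrals in Parseval's formula converges
    absolutely, and each limit needs a majorant uniform in its parameter. For the Gauss means, the
    tails are bounded uniformly in the damping [e] and in the shift [u]: a Gaussian is unimodal and
    [kappa] is monotone, so the superlevel sets of both are intervals, and the bound for the
    integrals of a cosine over intervals survives both multiplications. For Parseval's formula, the
    truncated transforms at [w] are at most three times the mass of [kappa] on [0, 1/|w|]; by
    Tonelli this majorant is integrable against 1/(1+w^2) because kappa(s)/(1+s) is integrable,
    which is where (II) or (III) enters. Complex numbers are replaced by a phase [th] inside the
    cosine: the phases 0 and pi/2 or -pi/2 give real and imaginary parts, so each estimate is proved
    once. The transform of a Gaussian is only shown to be positive for w^2 < 4c, so the final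
    division is made on growing windows, with c = n+1. *)

(** * Real-valued integrals, dominated convergence, Fubini and measurability *)

Definition intg {d} {T : measurableType d} {R : realType}
  (mu : {measure set T -> \bar R}) (f : T -> R) : Prop :=
  mu.-integrable setT (EFin \o f).

Section RealIntegrals.
Context d (T : measurableType d) (R : realType) (mu : {measure set T -> \bar R}).
Implicit Types f g : T -> R.

Lemma intg_measurable f : intg mu f -> measurable_fun setT f.
Proof. by move=> /measurable_int /measurable_EFinP. Qed.

Lemma intg_dom f g : measurable_fun setT f -> (forall x, `|f x| <= g x) ->
  intg mu g -> intg mu f.
Proof.
move=> mf fg ig; apply: le_integrable ig => //; first exact/measurable_EFinP.
by move=> x _ /=; rewrite lee_fin (le_trans (fg x))// ler_norm.
Qed.

Lemma intg_ext f g : f =1 g -> intg mu f -> intg mu g.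
Proof. by move=> /funext ->. Qed.

Lemma intgD f g : intg mu f -> intg mu g -> intg mu (fun x => f x + g x).
Proof. by move=> hf hg; apply: (integrableD _ hf hg). Qed.

Lemma intgB f g : intg mu f -> intg mu g -> intg mu (fun x => f x - g x).
Proof. by move=> hf hg; apply: (integrableB _ hf hg). Qed.

Lemma intgZ (c : R) f : intg mu f -> intg mu (fun x => c * f x).
Proof. by move=> hf; apply: (integrableZl _ c hf). Qed.

Lemma intgZr (c : R) f : intg mu f -> intg mu (fun x => f x * c).
Proof. by move=> /(intgZ c); apply: intg_ext => x; rewrite mulrC. Qed.

Lemma intgN f : intg mu f -> intg mu (fun x => - f x).
Proof. by move=> /(intgZ (-1)); apply: intg_ext => x; rewrite mulN1r. Qed.

Lemma intg_abs f : intg mu f -> intg mu (fun x => `|f x|).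
Proof. by move=> hf; exact: (integrable_norm hf). Qed.

Lemma intg0 : intg mu (fun=> 0).
Proof. exact: integrable0. Qed.

Lemma RintgD f g : intg mu f -> intg mu g ->
  Rintegral mu setT (fun x => f x + g x) = Rintegral mu setT f + Rintegral mu setT g.
Proof. by move=> hf hg; rewrite RintegralD. Qed.

Lemma RintgB f g : intg mu f -> intg mu g ->
  Rintegral mu setT (fun x => f x - g x) = Rintegral mu setT f - Rintegral mu setT g.
Proof. by move=> hf hg; rewrite RintegralB. Qed.

Lemma RintgZ (c : R) f :
  intg mu f -> Rintegral mu setT (fun x => c * f x) = c * Rintegral mu setT f.
Proof. by move=> hf; rewrite RintegralZl. Qed.

Lemma RintgZr (c : R) f :
  intg mu f -> Rintegral mu setT (fun x => f x * c) = Rintegral mu setT f * c.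
Proof. by move=> hf; rewrite RintegralZr. Qed.

Lemma Rintg_ext f g : f =1 g -> Rintegral mu setT f = Rintegral mu setT g.
Proof. by move=> /funext ->. Qed.

Lemma Rintg0 : Rintegral mu setT (fun=> 0) = 0.
Proof. by rewrite /Rintegral integral0. Qed.

Lemma Rintg_eq0 f : (forall x, f x = 0) -> Rintegral mu setT f = 0.
Proof. by move=> f0; rewrite -[RHS]Rintg0; apply: Rintg_ext. Qed.

Lemma RintgN f : intg mu f -> Rintegral mu setT (fun x => - f x) = - Rintegral mu setT f.
Proof.
move=> hf; rewrite -[RHS]mulN1r -RintgZ//.
by apply: Rintg_ext => x; rewrite mulN1r.
Qed.

Lemma Rintg_le f g : intg mu f -> intg mu g -> (forall x, f x <= g x) ->
  Rintegral mu setT f <= Rintegral mu setT g.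
Proof. by move=> hf hg fg; apply: le_Rintegral. Qed.

Lemma Rintg_norm_le f g : measurable_fun setT f -> intg mu g -> (forall x, `|f x| <= g x) ->
  `|Rintegral mu setT f| <= Rintegral mu setT g.
Proof.
move=> mf ig fg; have hf := intg_dom mf fg ig.
apply: (le_trans (le_normr_Rintegral measurableT hf)).
by apply: Rintg_le => //; exact: intg_abs.
Qed.

Lemma intg_patch (D : set T) f : measurable D ->
  mu.-integrable D (EFin \o f) <-> intg mu (f \_ D).
Proof. by move=> mD; rewrite /intg -restrict_EFin; apply: integrable_mkcond. Qed.

(** Domains of integration are traded for Boolean factors [(p x)%:R]. A domain that depends on a
    parameter then becomes a jointly measurable factor, to which Fubini applies directly. *)
Lemma intg_mkcond (D : set T) (p : T -> bool) f : measurable D ->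
  (forall x, D x <-> p x) ->
  mu.-integrable D (EFin \o f) <-> intg mu (fun x => f x * (p x)%:R).
Proof.
move=> mD Dp; rewrite (_ : (fun x => _) = f \_ D); first exact: intg_patch.
apply/funext => x; rewrite patchE; case: (boolP (p x)) => px.
  by rewrite mem_set ?mulr1//; apply/Dp.
by rewrite memNset ?mulr0// => /Dp; rewrite (negbTE px).
Qed.

Lemma Rintg_EFin f : intg mu f -> ((Rintegral mu setT f)%:E = \int[mu]_x (f x)%:E)%E.
Proof.
by move=> hf; rewrite /Rintegral fineK//; apply: integrable_fin_num.
Qed.

Lemma ge0_intgP f : measurable_fun setT f -> (forall x, 0 <= f x) ->
  intg mu f <-> (\int[mu]_x (f x)%:E < +oo)%E.
Proof.
move=> mf f0; split=> [/integrableP[_]|hf].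
  by under eq_integral do rewrite /= ger0_norm//.
apply/integrableP; split; first exact/measurable_EFinP.
by under eq_integral do rewrite /= ger0_norm//.
Qed.

Lemma RDCT_ae (F : nat -> T -> R) f g :
  (forall n, measurable_fun setT (F n)) -> measurable_fun setT f ->
  {ae mu, forall x, F ^~ x @ \oo --> f x} ->
  {ae mu, forall x n, `|F n x| <= g x} ->
  intg mu g ->
  intg mu f /\ (fun n => Rintegral mu setT (F n)) @ \oo --> Rintegral mu setT f.
Proof.
move=> mF mf Ff Fg ig.
have [|||||i1 _ i3] := @dominated_convergence _ T R mu setT measurableT
  (fun n => EFin \o F n) (EFin \o f) (EFin \o g).
- by move=> n; exact/measurable_EFinP.
- exact/measurable_EFinP.
- by apply: filterS Ff => x h _; apply/cvg_EFin; [exact: nearW|exact: h].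
- exact: ig.
- by apply: filterS Fg => x h n _; rewrite /= lee_fin.
split => //.
have iF n : intg mu (F n).
  apply/integrableP; split; first exact/measurable_EFinP.
  move/integrableP : ig => [mg]; apply: le_lt_trans.
  apply: ae_ge0_le_integral => //=.
  + by apply/measurable_EFinP; apply: measurableT_comp.
  + by apply/measurable_EFinP; apply: measurableT_comp => //; exact/measurable_EFinP.
  + apply: filterS Fg => x h _; rewrite lee_fin.
    by apply: (le_trans (h n)); exact: ler_norm.
move: i3; rewrite -(Rintg_EFin i1).
rewrite (_ : [sequence _]_n = (fun n => (Rintegral mu setT (F n))%:E)); last first.
  by apply/funext => n /=; rewrite Rintg_EFin.
by move/fine_cvgP => [].
Qed.

Lemma RDCT (F : nat -> T -> R) f g :
  (forall n, measurable_fun setT (F n)) ->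
  (forall x, F ^~ x @ \oo --> f x) ->
  (forall n x, `|F n x| <= g x) ->
  intg mu g ->
  intg mu f /\ (fun n => Rintegral mu setT (F n)) @ \oo --> Rintegral mu setT f.
Proof.
move=> mF Ff Fg ig; apply: (RDCT_ae (g := g)) => //.
- by apply: (measurable_fun_cvg (h := F)) => // x _; exact: Ff.
- exact: aeW.
- exact: aeW.
Qed.

End RealIntegrals.

Section RealFubini.
Context d1 d2 (T1 : measurableType d1) (T2 : measurableType d2) (R : realType).
Variable m1 : {sigma_finite_measure set T1 -> \bar R}.
Variable m2 : {sigma_finite_measure set T2 -> \bar R}.

(** Tonelli gives measurability for the positive and the negative part separately; the difference
    and [fine] preserve it, also at the points where the inner integral diverges. *)
Lemma measurable_Rintg (f : T1 * T2 -> R) : measurable_fun setT f ->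
  measurable_fun setT (fun x => Rintegral m2 setT (fun y => f (x, y))).
Proof.
move=> mf; apply: measurableT_comp => //=.
have mEf : measurable_fun setT (EFin \o f) by exact/measurable_EFinP.
rewrite (_ : (fun x => _) = (fun x => \int[m2]_y ((EFin \o f)^\+ (x, y))
    - \int[m2]_y ((EFin \o f)^\- (x, y)))%E).
  apply: emeasurable_funB; apply: measurable_fun_fubini_tonelli_F => //.
  - exact: measurable_funepos.
  - exact: measurable_funeneg.
apply/funext => x; rewrite [LHS]integralE; congr (_ - _)%E; apply: eq_integral => y _.
  by rewrite 2!funeposE.
by rewrite 2!funenegE.
Qed.

(** A product majorant makes every section integrable, not only almost every one, so the real-valued
    inner integrals never take a default value. *)
Lemma RFubini (f : T1 * T2 -> R) (g : T1 -> R) (k : T2 -> R) :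
  measurable_fun setT f -> (forall x y, `|f (x, y)| <= g x * k y) ->
  intg m1 g -> intg m2 k ->
  [/\ intg m1 (fun x => Rintegral m2 setT (fun y => f (x, y))),
      intg m2 (fun y => Rintegral m1 setT (fun x => f (x, y))) &
      Rintegral m1 setT (fun x => Rintegral m2 setT (fun y => f (x, y))) =
      Rintegral m2 setT (fun y => Rintegral m1 setT (fun x => f (x, y)))].
Proof.
move=> mf fgk ig ik.
have i2 x : intg m2 (fun y => f (x, y)).
  apply: (intg_dom (g := fun y => g x * k y)) => //.
    by apply: measurableT_comp.
  exact: intgZ.
have i1 y : intg m1 (fun x => f (x, y)).
  apply: (intg_dom (g := fun x => g x * k y)) => //.
    by apply: measurableT_comp.
  exact: intgZr.
have ifm : ((m1 \x m2)%E).-integrable setT (EFin \o f).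
  apply/integrable12ltyP; first exact/measurable_EFinP.
  have : intg m1 (fun x => `|g x| * Rintegral m2 setT (fun y => `|k y|)).
    by apply: intgZr; exact: intg_abs.
  move=> /integrableP[_]; apply: le_lt_trans.
  apply: ge0_le_integral => //=.
  - by move=> x _; apply: integral_ge0.
  - apply: (measurable_fun_fubini_tonelli_F (abse \o (EFin \o f))) => //=.
    by apply: measurableT_comp => //; exact/measurable_EFinP.
  - apply/measurable_EFinP; apply: measurableT_comp => //.
    by apply: measurable_funM => //; apply: measurableT_comp => //; exact: intg_measurable ig.
  - move=> x _; rewrite ger0_norm; last first.
      by apply: mulr_ge0 => //; apply: Rintegral_ge0.
    rewrite -RintgZ; last exact: intg_abs.
    rewrite Rintg_EFin; last by apply: intgZ; exact: intg_abs.
    apply: ge0_le_integral => //=.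
    + by apply/measurable_EFinP; apply: measurableT_comp => //; exact: intg_measurable (i2 x).
    + by apply/measurable_EFinP; apply: measurable_funM => //; apply: measurableT_comp => //; exact: intg_measurable ik.
    + by move=> y _; rewrite lee_fin (le_trans (fgk _ _))// -normrM ler_norm.
have E1 : (fun x => (\int[m2]_y (f (x, y))%:E)%E) =
    EFin \o (fun x => Rintegral m2 setT (fun y => f (x, y))).
  by apply/funext => x /=; rewrite Rintg_EFin.
have E2 : (fun y => (\int[m1]_x (f (x, y))%:E)%E) =
    EFin \o (fun y => Rintegral m1 setT (fun x => f (x, y))).
  by apply/funext => x /=; rewrite Rintg_EFin.
split.
- by have := integrable_fubini_F ifm; rewrite /fubini_F /= E1.
- apply: (@intg_dom _ _ _ _ _ (fun y => Rintegral m1 setT (fun x => `|g x|) * `|k y|)).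
  + have := measurable_fubini_G ifm; rewrite /fubini_G /= E2.
    by move/measurable_EFinP.
  + move=> y; rewrite -RintgZr; last exact: intg_abs.
    apply: Rintg_norm_le; first exact: intg_measurable (i1 y).
    * by apply: intgZr; exact: intg_abs.
    * by move=> x; rewrite (le_trans (fgk _ _))// -normrM ler_norm.
  + by apply: intgZ; exact: intg_abs.
- have := Fubini ifm; rewrite /= E1 E2 => h.
  by rewrite /Rintegral h.
Qed.

Lemma RFubini_curry (f : T1 -> T2 -> R) (g : T1 -> R) (k : T2 -> R) :
  measurable_fun setT (fun z : T1 * T2 => f z.1 z.2) ->
  (forall x y, `|f x y| <= g x * k y) ->
  intg m1 g -> intg m2 k ->
  [/\ intg m1 (fun x => Rintegral m2 setT (f x)),
      intg m2 (fun y => Rintegral m1 setT (f^~ y)) &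
      Rintegral m1 setT (fun x => Rintegral m2 setT (f x)) =
      Rintegral m2 setT (fun y => Rintegral m1 setT (f^~ y))].
Proof. by move=> mf fgk ig ik; exact: (RFubini mf fgk ig ik). Qed.

Lemma measurable_Rintg_curry (f : T1 -> T2 -> R) :
  measurable_fun setT (fun z : T1 * T2 => f z.1 z.2) ->
  measurable_fun setT (fun x => Rintegral m2 setT (f x)).
Proof. by move=> mf; exact: (measurable_Rintg mf). Qed.

End RealFubini.

Section Measurability.
Context d (T : measurableType d) (R : realType).
Implicit Types f g : T -> R.

Lemma measurable_ltR f g : measurable_fun setT f -> measurable_fun setT g ->
  measurable_fun setT (fun x => (f x < g x)%R%:R : R).
Proof.
move=> mf mg; have m : measurable [set x | f x < g x].
  have := measurable_fun_ltr mf mg measurableT (Y := [set true]).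
  by rewrite setTI; apply.
move/(measurable_indic (R := R) (D := setT)) : m.
by apply: eq_measurable_fun => x _; rewrite indicE mem_setE.
Qed.

Lemma measurable_leR f g : measurable_fun setT f -> measurable_fun setT g ->
  measurable_fun setT (fun x => (f x <= g x)%R%:R : R).
Proof.
move=> mf mg.
rewrite (_ : (fun x => _) = (fun x => 1 - (g x < f x)%R%:R)); last first.
  by apply/funext => x; rewrite ltNge; case: (_ <= _); rewrite ?subr0 ?subrr.
by apply: measurable_funB => //; exact: measurable_ltR.
Qed.

Lemma measurable_andR (p q : T -> bool) :
  measurable_fun setT (fun x => (p x)%:R : R) -> measurable_fun setT (fun x => (q x)%:R : R) ->
  measurable_fun setT (fun x => (p x && q x)%:R : R).
Proof.
move=> mp mq; rewrite (_ : (fun x => _) = (fun x => (p x)%:R * (q x)%:R)).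
  exact: measurable_funM.
by apply/funext => x; rewrite -natrM mulnb.
Qed.

End Measurability.

Lemma measurable_addl (R : realType) (u : R) : measurable_fun setT (+%R u).
Proof. by apply: (measurable_funD (f := fun=> u) (g := id)) => //; exact: measurable_id. Qed.

Lemma measurable_mull (R : realType) (u : R) : measurable_fun setT ( *%R u).
Proof. by apply: (measurable_funM (f := fun=> u) (g := id)) => //; exact: measurable_id. Qed.

(** Measurability by recursion on the syntax of the function. Functions that are not built in are
    resolved by hypotheses [measurable_fun setT f] of the context, which is why proofs introduce
    such facts before calling it. *)
Ltac mfun :=
  repeat first
  [ assumption
  | exact: measurable_cst
  | exact: measurable_id
  | exact: measurable_fst
  | exact: measurable_snd
  | exact: measurable_addl
  | exact: measurable_mull
  | match goal with
    | |- measurable_fun setT (fun z => @GRing.natmul _ _ _) =>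
        first [apply: measurable_andR | apply: measurable_leR | apply: measurable_ltR]
    | |- measurable_fun setT (fun z => @GRing.add _ _ (@GRing.opp _ _)) => apply: measurable_funB
    | |- measurable_fun setT (fun z => @GRing.add _ _ _) => apply: measurable_funD
    | |- measurable_fun setT (fun z => @GRing.mul _ _ _) => apply: measurable_funM
    | |- measurable_fun setT (fun z => @GRing.opp _ _) => apply: measurable_funN
    | |- measurable_fun setT (fun z => @GRing.exp _ _ _) => apply: measurable_funX
    | |- measurable_fun setT (fun z => `|_|) => apply: (measurableT_comp (@normr_measurable _ _))
    | |- measurable_fun setT (fun z => cos _) =>
        apply: (measurableT_comp (continuous_measurable_fun (@continuous_cos _)))
    | |- measurable_fun setT (fun z => sin _) =>
        apply: (measurableT_comp (continuous_measurable_fun (@continuous_sin _)))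
    | |- measurable_fun setT (fun z => expR _) => apply: (measurableT_comp (@measurable_expR _))
    | |- measurable_fun setT (fun z => atan _) =>
        apply: (measurableT_comp (continuous_measurable_fun (@continuous_atan _)))
    | h : measurable_fun setT ?f |- measurable_fun setT (fun z => ?f (@?e z)) =>
        apply: (measurableT_comp h)
    end ].

(** * Translations and reflections of Lebesgue measure *)

Section Lebesgue.
Variable R : realType.
Local Notation leb := (@lebesgue_measure R).
Implicit Types f g : R -> R.

(** By uniqueness of Lebesgue measure it suffices to compare both measures on half-open
    intervals. *)
Lemma lebesgue_measure_shift (a : R) (A : set R) : measurable A ->
  pushforward leb ((fun x => x + a) : _ -> measurableTypeR R) A = leb A.
Proof.
have ms : measurable_fun setT ((fun x => x + a) : measurableTypeR R -> measurableTypeR R) by mfun.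
move=> mA; apply/esym/lebesgue_measure_unique => //= _ [[x y]] _ <-.
rewrite /pushforward (_ : _ @^-1` _ = [set` `]x - a, y - a]]); last first.
  by apply/seteqP; split => z /=; rewrite !in_itv /= ltrBlDr lerBrDr.
rewrite !lebesgue_measure_itv/=.
by rewrite !lte_fin ltrD2r -!EFinD; case: ifP => // _; congr EFin; ring.
Qed.

Lemma intg_shift f (a : R) : intg leb f -> intg leb (fun x => f (x + a)).
Proof.
move=> /integrableP[mf fy]; apply/integrableP; split.
  by apply/measurable_EFinP; move/measurable_EFinP : mf => mf; mfun.
have ms : measurable_fun setT ((fun x => x + a) : measurableTypeR R -> measurableTypeR R) by mfun.
apply: le_lt_trans fy.
have -> : (\int[leb]_x `|(EFin \o f) x| = \int[pushforward leb ((fun x => x + a)%R : _ -> measurableTypeR R)]_x `|(EFin \o f) x|)%E.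
  apply: eq_measure_integral => A mA _; exact/esym/lebesgue_measure_shift.
  rewrite ge0_integral_pushforward//=.
  by apply/measurable_EFinP; move/measurable_EFinP : mf => mf; mfun.
Qed.

Lemma Rintg_shift f (a : R) : intg leb f ->
  Rintegral leb setT (fun x => f (x + a)) = Rintegral leb setT f.
Proof.
move=> fi; rewrite /Rintegral; congr fine.
have ms : measurable_fun setT ((fun x => x + a) : measurableTypeR R -> measurableTypeR R) by mfun.
have -> : (\int[leb]_x (f x)%:E = \int[pushforward leb ((fun x => x + a)%R : _ -> measurableTypeR R)]_x (f x)%:E)%E.
  apply: eq_measure_integral => A mA _; exact/esym/lebesgue_measure_shift.
  have h := integral_pushforward ms (measurable_int _ fi) (intg_shift a fi) measurableT.
  by rewrite h preimage_setT.
Qed.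

Lemma intg_reflect f : intg leb f -> intg leb (fun x => f (- x)).
Proof.
move=> /integrableP[mf fy]; apply/integrableP; split.
  by apply/measurable_EFinP; move/measurable_EFinP : mf => mf; mfun.
have ms : measurable_fun setT (-%R : measurableTypeR R -> measurableTypeR R) by mfun.
apply: le_lt_trans fy.
have -> : (\int[leb]_x `|(EFin \o f) x| = \int[pushforward leb (-%R%R : _ -> measurableTypeR R)]_x `|(EFin \o f) x|)%E.
  apply: eq_measure_integral => A mA _; exact/esym/lebesgue_measureN.
  rewrite ge0_integral_pushforward//=.
  by apply/measurable_EFinP; move/measurable_EFinP : mf => mf; mfun.
Qed.

Lemma Rintg_reflect f : intg leb f ->
  Rintegral leb setT (fun x => f (- x)) = Rintegral leb setT f.
Proof.
move=> fi; rewrite /Rintegral; congr fine.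
have ms : measurable_fun setT (-%R : measurableTypeR R -> measurableTypeR R) by mfun.
have -> : (\int[leb]_x (f x)%:E = \int[pushforward leb (-%R%R : _ -> measurableTypeR R)]_x (f x)%:E)%E.
  apply: eq_measure_integral => A mA _; exact/esym/lebesgue_measureN.
  have h := integral_pushforward ms (measurable_int _ fi) (intg_reflect fi) measurableT.
  by rewrite h preimage_setT.
Qed.

Lemma Rintg_mkcond f (A : set R) (p : R -> bool) : (forall x, A x <-> p x) ->
  Rintegral leb A f = Rintegral leb setT (fun x => f x * (p x)%:R).
Proof.
move=> Ap; rewrite Rintegral_mkcond; apply: Rintg_ext => x.
rewrite patchE; case: (boolP (p x)) => px.
  by rewrite mem_set ?mulr1//; apply/Ap.
by rewrite memNset ?mulr0// => /Ap; rewrite (negbTE px).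
Qed.

Lemma lebFubini (f : R -> R -> R) (g k : R -> R) :
  measurable_fun setT (fun z : R * R => f z.1 z.2) ->
  (forall x y, `|f x y| <= g x * k y) ->
  intg leb g -> intg leb k ->
  [/\ intg leb (fun x => Rintegral leb setT (f x)),
      intg leb (fun y => Rintegral leb setT (f^~ y)) &
      Rintegral leb setT (fun x => Rintegral leb setT (f x)) =
      Rintegral leb setT (fun y => Rintegral leb setT (f^~ y))].
Proof.
move=> mf fgk ig ik.
have h := @RFubini_curry _ _ (measurableTypeR R) (measurableTypeR R) R leb leb f g k.
exact: h.
Qed.

Lemma measurable_lebRintg (f : R -> R -> R) :
  measurable_fun setT (fun z : R * R => f z.1 z.2) ->
  measurable_fun setT (fun x => Rintegral leb setT (f x)).
Proof.
move=> mf.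
have h := @measurable_Rintg_curry _ _ (measurableTypeR R) (measurableTypeR R) R leb f.
exact: h.
Qed.

End Lebesgue.

(** * Oscillatory integrals *)

Section Calculus.
Variable R : realType.
Local Notation leb := (@lebesgue_measure R).
Implicit Types f g F : R -> R.

Lemma continuous_intg_itv f (a b : R) : continuous f ->
  intg leb (fun x => f x * ((a <= x) && (x <= b))%:R).
Proof.
move=> cf.
have h : leb.-integrable `[a, b] (EFin \o f).
  apply: continuous_compact_integrable; first exact: segment_compact.
  exact: continuous_subspaceT.
by apply: (intg_mkcond leb f (measurable_itv `[a, b]) _).1 h => x; rewrite /= in_itv.
Qed.

Lemma Rintg_FTC f F (a b : R) : a <= b -> continuous f ->
  (forall x : R, is_derive x 1 F (f x)) ->
  Rintegral leb setT (fun x => f x * ((a <= x) && (x <= b))%:R) = F b - F a.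
Proof.
move=> ab cf dF.
rewrite -(@Rintg_mkcond _ _ `[a, b]%classic); last by move=> x; rewrite /= in_itv.
move: ab; rewrite le_eqVlt => /predU1P[->|ab].
  by rewrite set_itv1 Rintegral_set1 subrr.
have dF1 x : derivable F x 1 by case: (dF x).
have cF : continuous F.
  by move=> x; apply: differentiable_continuous; apply/derivable1_diffP.
rewrite /Rintegral (@continuous_FTC2 _ f F a b) //=.
- exact: continuous_subspaceT.
- split => [x _| |]; first exact: dF1.
  + by apply: cvg_at_right_filter; apply: cF.
  + by apply: cvg_at_left_filter; apply: cF.
- by move=> x _; rewrite derive1E; case: (dF x).
Qed.

Lemma intg_itv (a b : R) : intg leb (fun x : R => ((a <= x) && (x <= b))%:R).
Proof.
have c1 : continuous (fun _ : R => 1 : R) by move=> ?; exact: cvg_cst.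
by apply: (intg_ext _ (continuous_intg_itv a b c1)) => x; rewrite mul1r.
Qed.

Lemma Rintg_itv (a b : R) : a <= b ->
  Rintegral leb setT (fun x : R => ((a <= x) && (x <= b))%:R) = b - a.
Proof.
move=> ab; have c1 : continuous (fun _ : R => 1 : R) by move=> ?; exact: cvg_cst.
rewrite -(Rintg_FTC (F := id) ab c1).
by apply: Rintg_ext => x; rewrite mul1r.
Qed.

(** Superlevel sets come as intervals of unknown type, open or closed at either end. The endpoints
    [inf I] and [sup I] are null, so the closed interval between them gives the same integral. *)
Lemma is_interval_Rintg g (I : set R) (a b : R) : continuous g -> is_interval I ->
  I `<=` `[a, b] ->
  exists c d : R, c <= d /\
  Rintegral leb setT (fun x => g x * \1_I x) =
  Rintegral leb setT (fun x => g x * ((c <= x) && (x <= d))%:R).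
Proof.
move=> cg iI Iab.
have [->|I0] := eqVneq I set0.
  exists 0, 0; split => //.
  rewrite -(@Rintg_mkcond _ _ `[0, 0]%classic); last by move=> x; rewrite /= in_itv.
  rewrite set_itv1 Rintegral_set1 -[RHS](Rintg0 leb).
  by apply: Rintg_ext => x; rewrite indic0 mulr0.
have hl : has_lbound I by exists a => x /Iab; rewrite /= in_itv /= => /andP[].
have hu : has_ubound I by exists b => x /Iab; rewrite /= in_itv /= => /andP[].
have [z Iz] : I !=set0 by apply/set0P.
have ig (i : interval R) : leb.-integrable [set` i] (EFin \o (fun x => g x * ((a <= x) && (x <= b))%:R)).
  apply: integrableS (continuous_intg_itv a b cg) => //.
have infsup : inf I <= sup I.
  by apply: (@le_trans _ _ z); [apply: ge_inf|apply: ub_le_sup].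
exists (inf I), (sup I); split=> //.
have ainf : a <= inf I.
  by apply: lb_le_inf; [exists z|move=> x /Iab; rewrite /= in_itv /= => /andP[]].
have supb : sup I <= b.
  by apply: ge_sup; [exists z|move=> x /Iab; rewrite /= in_itv /= => /andP[]].
pose h x := g x * ((a <= x) && (x <= b))%:R.
have E1 : Rintegral leb setT (fun x => g x * \1_I x) = Rintegral leb I h.
  rewrite [RHS]Rintegral_mkcond; apply: Rintg_ext => x; rewrite patchE indicE /h.
  case: ifPn => xI; last by rewrite mulr0.
  by move: xI; rewrite inE => /Iab; rewrite /= in_itv /= => ->.
have E2 : Rintegral leb setT (fun x => g x * ((inf I <= x) && (x <= sup I))%:R)
    = Rintegral leb `[inf I, sup I] h.
  rewrite [RHS](@Rintg_mkcond _ _ _ (fun x => (inf I <= x) && (x <= sup I))); last first.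
    by move=> x; rewrite /= in_itv.
  apply: Rintg_ext => x; rewrite /h; case: (boolP (inf I <= x)) => h1; last by rewrite !mulr0.
  case: (boolP (x <= sup I)) => h2; last by rewrite !mulr0.
  by rewrite (le_trans ainf h1) (le_trans h2 supb) !mulr1.
(* [I] equals its hull, whose type depends on whether [inf I] and [sup I] belong to [I]; the four
   cases differ by null sets. *)
rewrite E1 E2 {1}((is_intervalP I).1 iI) /Rhull (asboolT hl) (asboolT hu).
case: (`[< _ >]); case: (`[< _ >]);
  by rewrite /= ?Rintegral_itv_bndo_bndc ?Rintegral_itv_obnd_cbnd//.
Qed.

Lemma is_derive_sin_affine (w th x : R) : w != 0 ->
  is_derive x 1 (fun x => sin (x * w + th) / w) (cos (x * w + th)).
Proof.
move=> w0; apply: is_derive_eq.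
rewrite /GRing.scale /=; field; exact: w0.
Qed.

Lemma continuous_cos_affine (w th : R) : continuous (fun x : R => cos (x * w + th)).
Proof.
move=> x; apply: continuous_comp; last exact: continuous_cos.
by apply: continuousD; [apply: continuousM; [exact: cvg_id|exact: cvg_cst]|exact: cvg_cst].
Qed.

End Calculus.

Section Oscillation.
Variable R : realType.
Local Notation leb := (@lebesgue_measure R).

(** The bound is required on all subintervals, because in this form it is stable under
    multiplication by functions whose superlevel sets are intervals and can be used repeatedly. *)
Definition osc_bounded (a b : R) (g : R -> R) (C : R) : Prop :=
  intg leb (fun x => g x * ((a <= x) && (x <= b))%:R) /\
  forall I : set R, is_interval I -> I `<=` `[a, b] ->
    `|Rintegral leb setT (fun x => g x * \1_I x)| <= C.

Lemma osc_bounded_cos (a b w th : R) : w != 0 ->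
  osc_bounded a b (fun x => cos (x * w + th)) (2 / `|w|).
Proof.
move=> w0; split; first exact/continuous_intg_itv/continuous_cos_affine.
move=> I iI Iab.
have [c [d [cd ->]]] := is_interval_Rintg (continuous_cos_affine (w := w) (th := th)) iI Iab.
rewrite (Rintg_FTC cd (continuous_cos_affine (w:=w) (th:=th))
  (fun x => is_derive_sin_affine th x w0)).
rewrite -mulrBl normrM normfV ler_pM2r ?invr_gt0 ?normr_gt0//.
have h (y : R) : -1 <= sin y <= 1 by rewrite sin_geN1 sin_le1.
have /andP[? ?] := h (d * w + th); have /andP[? ?] := h (c * w + th).
by rewrite ler_norml; lra.
Qed.

(* Layer cake: writing [f x] as the length of [0, f x], the integral of [f * g]
   is an average of integrals of [g] over the superlevel intervals of [f]. *)
Lemma osc_boundedM (a b : R) (f g : R -> R) (M C : R) :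
  measurable_fun setT f -> measurable_fun setT g ->
  (forall x, a <= x <= b -> 0 <= f x <= M) ->
  (forall y, 0 <= y -> is_interval (`[a, b] `&` [set x | y <= f x])) ->
  0 <= M ->
  osc_bounded a b g C -> osc_bounded a b (fun x => f x * g x) (M * C).
Proof.
move=> mf mg fM qf M0 [ig oC]; split.
  apply: (@intg_dom _ _ _ leb _ (fun x => M * `|g x * ((a <= x) && (x <= b))%:R|)); last first.
  - by apply: intgZ; exact: intg_abs.
  - move=> x; case: (boolP (a <= x <= b)) => /= [xab|_]; last by rewrite !mulr0 normr0 mulr0.
    rewrite !mulr1 normrM ler_wpM2r//; have /andP[f0 fM'] := fM x xab.
    by rewrite ger0_norm.
  - rewrite (_ : (fun x => _) = (fun x => f x * (g x * ((a <= x) && (x <= b))%:R))).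
      by apply: measurable_funM => //; exact: intg_measurable ig.
    by apply/funext => x; rewrite mulrA.
move=> I iI Iab.
pose A y : set R := I `&` [set x | y <= f x].
have iA y : 0 <= y -> is_interval (A y).
  move=> y0 u v [Iu fu] [Iv fv] z uzv; split; first exact: iI uzv.
  have [] := qf y y0 u v _ _ z uzv => //.
  - by split => //; exact: Iab.
  - by split => //; exact: Iab.
have mI : measurable_fun setT (\1_I : R -> R).
  by apply: measurable_indic; apply: is_interval_measurable.
(* Integrating [H x y] in [y] gives [f x * g x * \1_I x], since [0 <= f x <= M] on [I]; the cut at
   [M] changes no value there and yields a product majorant for Fubini. *)
pose H (x y : R) : R := g x * \1_I x *
    ((y <= f x)%R%:R * ((0 <= y)%R%:R * (y <= M)%R%:R)).
have mH : measurable_fun setT (fun z : R * R => H z.1 z.2) by rewrite /H; mfun.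
have kI : intg leb (fun y : R => ((0 <= y) && (y <= M))%:R).
  exact: intg_itv.
have [|_ i2 E] := lebFubini mH (g := fun x => `|g x * ((a <= x) && (x <= b))%:R|) (k := fun y => ((0 <= y) && (y <= M))%:R) _ (intg_abs ig) kI.
  move=> x y; rewrite /H /= !normrM ler_pM => //.
  - rewrite ler_wpM2l//; rewrite indicE; case: (boolP (x \in I)); rewrite ?normr0 //.
    by rewrite inE => /Iab; rewrite /= in_itv /= => ->.
  - by rewrite -!normrM -!natrM !mulnb normr_nat ler_nat; case: (y <= f x).
have -> : Rintegral leb setT (fun x => f x * g x * \1_I x) =
  Rintegral leb setT (fun x => Rintegral leb setT (H x)).
  apply: Rintg_ext => x; rewrite /H /=.
  case: (boolP (x \in I)) => xI; last first.
    rewrite indicE (negbTE xI) mulr0 -[LHS](Rintg0 leb).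
    by apply: Rintg_ext => y; rewrite mulr0 mul0r.
  have xab : a <= x <= b by move: xI; rewrite inE => /Iab; rewrite /= in_itv.
  have /andP[f0 fM'] := fM x xab.
  rewrite RintgZ; last first.
    apply: intg_dom kI; first by mfun.
    by move=> y; rewrite -!natrM !mulnb normr_nat ler_nat; case: (y <= f x).
  rewrite -mulrA mulrC; congr (_ * _).
  rewrite (@Rintg_ext _ _ _ leb _ (fun y => ((0 <= y) && (y <= f x))%:R)); last first.
    move=> y; rewrite -!natrM !mulnb; case: (boolP (y <= f x)) => yf; last by rewrite !andbF.
    by rewrite (le_trans yf fM').
  by rewrite Rintg_itv ?subr0.
rewrite E.
have -> : M * C = Rintegral leb setT (fun y : R => C * ((0 <= y) && (y <= M))%:R).
  by rewrite RintgZ; [rewrite Rintg_itv ?subr0 1?mulrC|exact: kI].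
apply: Rintg_norm_le; first exact: intg_measurable i2.
  exact: intgZ.
move=> y; rewrite /H /=.
case: (boolP (0 <= y)) => y0 /=; last first.
  rewrite Rintg_eq0; last by move=> x; rewrite mul0r !mulr0.
  by rewrite normr0 mulr0.
case: (boolP (y <= M)) => yM /=; last first.
  rewrite Rintg_eq0; last by move=> x; rewrite !mulr0.
  by rewrite normr0 mulr0.
rewrite (@Rintg_ext _ _ _ leb _ (fun x => g x * \1_(A y) x)); last first.
  move=> x; rewrite /A indicI /= !mulr1 -mulrA.
  by congr (_ * (_ * _)); rewrite indicE mem_setE.
rewrite [leRHS]mulr1; apply: oC; first exact: iA.
by move=> x [] /Iab.
Qed.

End Oscillation.

(** * Integrals over the line and Schwartz functions *)

Section Line.
Variable R : realType.
Local Notation leb := (@lebesgue_measure R).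
Implicit Types f g F : R -> R.

Definition window (n : nat) (x : R) : R := ((- n%:R <= x) && (x <= n%:R))%:R.

Lemma window_cvg (x : R) : window ^~ x @ \oo --> (1 : R).
Proof.
apply: cvg_near_cst; near=> n; rewrite /window.
have : `|x| <= n%:R by near: n; exact: nbhs_infty_ger.
by rewrite ler_norml => /andP[-> ->].
Unshelve. all: by end_near. Qed.

Lemma window_ge0 n x : 0 <= window n x. Proof. exact: ler0n. Qed.

Lemma window_le1 n x : window n x <= 1.
Proof. by rewrite /window; case: (_ && _). Qed.

Lemma measurable_window n : measurable_fun setT (window n).
Proof.
rewrite /window (_ : (fun x : R => _) = (fun x => (- n%:R <= x)%R%:R * (x <= n%:R)%R%:R)).
  by mfun.
by apply/funext => x; rewrite -natrM mulnb.
Qed.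

Lemma window_homo x : {homo (fun n => window n x) : m n / (m <= n)%N >-> m <= n}.
Proof.
move=> m n mn; rewrite /window ler_nat.
have : (m%:R : R) <= n%:R by rewrite ler_nat.
case: (boolP (- m%:R <= x)) => // h1; case: (boolP (x <= m%:R)) => // h2 mn'.
rewrite (le_trans h2 mn') (_ : - n%:R <= x = true) //.
by apply/idP; apply: le_trans h1; rewrite lerN2.
Qed.

Lemma ge0_intg_exhaust f (M : R) : measurable_fun setT f -> (forall x, 0 <= f x) ->
  (forall n, intg leb (fun x => f x * window n x)) ->
  (forall n, Rintegral leb setT (fun x => f x * window n x) <= M) ->
  intg leb f.
Proof.
move=> mf f0 fi fM; apply/ge0_intgP => //.
have mw := measurable_window.
rewrite (_ : (\int[leb]_x (f x)%:E)%E = limn (fun n => (\int[leb]_x (f x * window n x)%:E)%E)).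
  apply: (@le_lt_trans _ _ M%:E); last exact: ltry.
  apply: lime_le.
    apply: ereal_nondecreasing_is_cvgn => m n mn; apply: ge0_le_integral => //=.
    - by move=> x _; rewrite lee_fin mulr_ge0// window_ge0.
    - by apply/measurable_EFinP; apply: measurable_funM => //; exact: mw.
    - by apply/measurable_EFinP; apply: measurable_funM => //; exact: mw.
    - by move=> x _; rewrite lee_fin ler_wpM2l// window_homo.
  by apply: nearW => n; rewrite -Rintg_EFin// lee_fin.
rewrite -monotone_convergence//=.
- apply: eq_integral => x _; apply/esym/cvg_lim => //.
  apply: cvg_EFin; first exact: nearW.
  rewrite -[X in _ --> X]mulr1; apply: cvgM; [exact: cvg_cst|exact: window_cvg].
- by move=> n; apply/measurable_EFinP; apply: measurable_funM => //; exact: mw.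
- by move=> n x _; rewrite lee_fin mulr_ge0// window_ge0.
- by move=> x _ m n mn; rewrite lee_fin ler_wpM2l// window_homo.
Qed.

Lemma Rintg_window_cvg f : intg leb f ->
  (fun n => Rintegral leb setT (fun x => f x * window n x)) @ \oo --> Rintegral leb setT f.
Proof.
move=> fi; have mf := intg_measurable fi; have mw := measurable_window.
have [||||_] := @RDCT _ _ _ leb (fun n x => f x * window n x) f (fun x => `|f x|); last by [].
- by move=> n; apply: measurable_funM => //; exact: mw.
- by move=> x; rewrite -[X in _ --> X]mulr1; apply: cvgM; [exact: cvg_cst|exact: window_cvg].
- move=> n x; rewrite normrM ler_piMr//.
  by rewrite ger0_norm ?window_ge0// window_le1.
- exact: intg_abs.
Qed.

Lemma Rintg_FTC_line f F (l m : R) : continuous f -> intg leb f ->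
  (forall x : R, is_derive x 1 F (f x)) ->
  F x @[x --> +oo] --> l -> F x @[x --> -oo] --> m ->
  Rintegral leb setT f = l - m.
Proof.
move=> cf fi dF Fl Fm.
have := Rintg_window_cvg fi; move/cvg_unique; apply => //.
rewrite (_ : (fun n => _) = (fun n : nat => F n%:R - F (- n%:R))); last first.
  by apply/funext => n; rewrite /window (Rintg_FTC _ cf dF)// ge0_cp.
apply: cvgB.
  by apply: (cvg_comp _ F _ Fl); exact: cvgr_idn.
by apply: (cvg_comp (fun n : nat => - n%:R) F _ Fm); apply/cvgNrNy; exact: cvgr_idn.
Qed.

Lemma ge0_intg_FTC_line f F (l m : R) : continuous f -> (forall x, 0 <= f x) ->
  (forall x : R, is_derive x 1 F (f x)) ->
  (forall x, m <= F x <= l) -> intg leb f.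
Proof.
move=> cf f0 dF Fb; apply: (@ge0_intg_exhaust _ (l - m)) => //.
- exact: continuous_measurable_fun.
- by move=> n; exact: continuous_intg_itv.
- move=> n; rewrite /window (Rintg_FTC _ cf dF) ?ge0_cp//.
  have /andP[_ ?] := Fb n%:R; have /andP[? _] := Fb (- n%:R); lra.
Qed.

(** The common unit of decay: it is integrable, at most 1, and by Peetre's inequality a translation
    costs only a polynomial factor, so all majorants can be written with powers of [wt]. *)
Definition wt (x : R) : R := (1 + x ^+ 2)^-1.

Lemma wt_denom_gt0 (x : R) : 0 < 1 + x ^+ 2.
Proof. by have := sqr_ge0 x; lra. Qed.

Lemma wt_gt0 x : 0 < wt x.
Proof. by rewrite /wt invr_gt0 wt_denom_gt0. Qed.

Lemma wt_ge0 x : 0 <= wt x. Proof. exact/ltW/wt_gt0. Qed.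

Lemma wt_le1 x : wt x <= 1.
Proof. by rewrite /wt invf_le1 ?wt_denom_gt0// lerDl sqr_ge0. Qed.

Lemma wtN x : wt (- x) = wt x. Proof. by rewrite /wt sqrrN. Qed.

(* Peetre's inequality. *)
Lemma wtD x y : wt (x + y) <= 2 * (1 + x ^+ 2) * wt y.
Proof.
rewrite /wt ler_pdivlMr ?wt_denom_gt0//.
rewrite mulrC ler_pdivrMr ?wt_denom_gt0//.
have hx := sqr_ge0 x; have hxy := sqr_ge0 (x + y).
have h2 := sqr_ge0 (2 * x + y).
have h3 : 0 <= x ^+ 2 * (x + y) ^+ 2 by rewrite mulr_ge0.
have e1 : (x + y) ^+ 2 = x ^+ 2 + 2 * (x * y) + y ^+ 2 by ring.
have e2 : (2 * x + y) ^+ 2 = 4 * x ^+ 2 + 4 * (x * y) + y ^+ 2 by ring.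
have -> : 2 * (1 + x ^+ 2) * (1 + (x + y) ^+ 2) =
   2 + 2 * x ^+ 2 + 2 * (x + y) ^+ 2 + 2 * (x ^+ 2 * (x + y) ^+ 2) by ring.
rewrite e1 in h3 hxy *; rewrite e2 in h2; lra.
Qed.

Lemma continuous_wt : continuous wt.
Proof.
move=> x; apply: cvgV; first by rewrite lt0r_neq0// wt_denom_gt0.
by apply: cvgD; [exact: cvg_cst|exact: exprn_continuous].
Qed.

Lemma measurable_wt : measurable_fun setT wt.
Proof. apply: continuous_measurable_fun; exact: continuous_wt. Qed.

Lemma intg_wt : intg leb wt.
Proof.
apply: (@ge0_intg_FTC_line _ atan (pi / 2) (- (pi / 2))).
- exact: continuous_wt.
- exact: wt_ge0.
- by move=> x; rewrite ltW ?atan_gtNpi2// ltW ?atan_ltpi2.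
Qed.

End Line.

Section Schwartz.
Variable R : realType.
Local Notation leb := (@lebesgue_measure R).
Implicit Types phi : R -> R.

Lemma schwartz_derive phi : schwartz phi -> schwartz (derive1 phi).
Proof.
move=> [d b]; split; first by move=> n x; rewrite -derive1Sn; exact: d.
by move=> p q; have [C hC] := b p q.+1; exists C => x; rewrite -derive1Sn.
Qed.

Lemma schwartz_is_derive phi (x : R) : schwartz phi -> is_derive x 1 phi (derive1 phi x).
Proof. by move=> [d _]; rewrite derive1E; apply/derivableP; exact: (d 0%N). Qed.

Lemma schwartz_continuous phi : schwartz phi -> continuous phi.
Proof.
move=> [d _] x; apply: differentiable_continuous; apply/derivable1_diffP.
exact: (d 0%N).
Qed.

Lemma schwartz_measurable phi : schwartz phi -> measurable_fun setT phi.
Proof. by move/schwartz_continuous; exact: continuous_measurable_fun. Qed.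

(** The bounds for [phi] and [x ^+ (2 * k) * phi] suffice, because [(1 + x ^+ 2) ^+ k <= 2 ^+ k * (1
    + x ^+ (2 * k))], as one sees by comparing [x ^+ 2] with 1. *)
Lemma schwartz_decay phi (k : nat) : schwartz phi ->
  exists2 C, 0 <= C & forall x, `|phi x| <= C * wt x ^+ k.
Proof.
move=> [_ b]; have [C0 h0] := b 0%N 0%N; have [C1 h1] := b (2 * k)%N 0%N.
have C00 : 0 <= C0 by apply: le_trans (h0 0).
have C10 : 0 <= C1 by apply: le_trans (h1 0).
exists (2 ^+ k * (C0 + C1)); first by rewrite mulr_ge0 ?exprn_ge0 ?addr_ge0.
move=> x; have d0 := wt_denom_gt0 x.
rewrite /wt exprVn ler_pdivlMr ?exprn_gt0//.
have := h0 x; have := h1 x; rewrite /= expr0 mul1r normrM => {}h1 {}h0.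
have x2 : 0 <= x ^+ 2 by exact: sqr_ge0.
have key : (1 + x ^+ 2) ^+ k <= 2 ^+ k * (1 + `|x ^+ (2 * k)|).
  rewrite exprM (ger0_norm (exprn_ge0 _ x2)).
  case: (lerP (x ^+ 2) 1) => hx.
    apply: (@le_trans _ _ (2 ^+ k)); first by rewrite lerXn2r ?nnegrE; lra.
    by rewrite ler_peMr ?exprn_ge0// lerDl exprn_ge0.
  apply: (@le_trans _ _ (2 ^+ k * (x ^+ 2) ^+ k)).
    by rewrite -exprMn lerXn2r ?nnegrE; lra.
  by rewrite ler_wpM2l ?exprn_ge0// lerDr.
apply: (le_trans (ler_wpM2l (normr_ge0 (phi x)) key)).
rewrite mulrCA ler_wpM2l ?exprn_ge0// mulrDr mulr1 lerD//.
by rewrite mulrC.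
Qed.

Lemma schwartz_intg phi : schwartz phi -> intg leb phi.
Proof.
move=> sp; have [C C0 hC] := schwartz_decay 1 sp.
apply: (@intg_dom _ _ _ leb _ (fun x => C * wt x)).
- exact: schwartz_measurable.
- by move=> x; have := hC x; rewrite expr1.
- by apply: intgZ; exact: intg_wt.
Qed.

Lemma wt_cvg0 : (@wt R) x @[x --> +oo] --> 0 /\ (@wt R) x @[x --> -oo] --> 0.
Proof.
have h : (@wt R) x @[x --> +oo] --> 0.
  apply/cvgrPdist_le => e e0; near=> x.
  rewrite sub0r normrN ger0_norm ?wt_ge0// /wt -[e]invrK lef_pV2 ?posrE ?invr_gt0 ?wt_denom_gt0//.
  have x1 : 1 <= x by near: x; apply: nbhs_pinfty_ge; rewrite num_real.
  have xe : e^-1 <= x by near: x; apply: nbhs_pinfty_ge; rewrite num_real.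
  apply: (le_trans xe); rewrite expr2.
  have : 1 * x <= x * x by rewrite ler_wpM2r//; lra.
  lra.
split => //; apply/cvgNy_compNP; rewrite (_ : _ \o -%R = (@wt R))//.
by apply/funext => x; rewrite /= wtN.
Unshelve. all: by end_near. Qed.

Lemma schwartz_cvg0 phi : schwartz phi ->
  phi x @[x --> +oo] --> 0 /\ phi x @[x --> -oo] --> 0.
Proof.
move=> sp; have [C C0 hC] := schwartz_decay 1 sp; have [w1 w2] := wt_cvg0.
split.
- apply/norm_cvg0P; apply: (@squeeze_cvgr _ _ _ _ (cst 0) (fun x => C * wt x)).
  + by apply: nearW => x; rewrite normr_ge0 /= (le_trans (hC x))// expr1.
  + exact: cvg_cst.
  + by rewrite -(mulr0 C); apply: cvgM => //; exact: cvg_cst.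
- apply/norm_cvg0P; apply: (@squeeze_cvgr _ _ _ _ (cst 0) (fun x => C * wt x)).
  + by apply: nearW => x; rewrite normr_ge0 /= (le_trans (hC x))// expr1.
  + exact: cvg_cst.
  + by rewrite -(mulr0 C); apply: cvgM => //; exact: cvg_cst.
Qed.

End Schwartz.

(** * Fourier transform *)

Section AlmostEverywhere.
Variable R : realType.
Local Notation leb := (@lebesgue_measure R).
Implicit Types f g : R -> R.

(** The point 0 is exceptional twice: as a time, where [K] may be infinite, and as a frequency,
    where the cosine transform may diverge. *)
Lemma ae_off0 (P : R -> Prop) : (forall x, x != 0 -> P x) -> {ae leb, forall x, P x}.
Proof.
move=> hP; exists [set 0]; split => //; first exact: lebesgue_measure_set1.
by move=> x /= nP; apply: contrapT => x0; apply: nP; apply: hP; apply/eqP.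
Qed.

Lemma Rintg_off0 f g : measurable_fun setT f -> measurable_fun setT g ->
  (forall x, x != 0 -> f x = g x) -> Rintegral leb setT f = Rintegral leb setT g.
Proof.
move=> mf mg fg; rewrite /Rintegral; congr fine; apply: ae_eq_integral => //.
- exact/measurable_EFinP.
- exact/measurable_EFinP.
- by apply: ae_off0 => x x0 _; rewrite fg.
Qed.

Lemma measurable_off0 f g : measurable_fun setT g -> (forall x, x != 0 -> f x = g x) ->
  measurable_fun setT f.
Proof.
move=> mg fg.
(* The indicator of {0} is written as a product of two inequalities, a form that [mfun] handles. *)
rewrite (_ : f = (fun x => g x * (1 - (x <= 0)%R%:R * (0 <= x)%R%:R)
   + f 0 * ((x <= 0)%R%:R * (0 <= x)%R%:R))); first by mfun.
apply/funext => x; have [->|x0] := eqVneq x 0.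
  by rewrite lexx mulr1 subrr mulr0 add0r mulr1.
rewrite fg// -natrM mulnb; have -> : (x <= 0) && (0 <= x) = false.
  by rewrite -eq_le (negbTE x0).
by rewrite subr0 mulr0 addr0 mulr1.
Qed.

End AlmostEverywhere.

Section Fourier.
Variable R : realType.
Local Notation leb := (@lebesgue_measure R).
Implicit Types phi psi : R -> R.

(** This is the real part of exp(-i th) times the Fourier transform of [phi] at [w]: phase 0 gives
    [ft_re] and phase pi/2 gives [ft_im]. *)
Definition FT (th : R) phi (w : R) : R :=
  Rintegral leb setT (fun t => phi t * cos (t * w + th)).

Lemma intg_cos phi (w th : R) : intg leb phi -> intg leb (fun t => phi t * cos (t * w + th)).
Proof.
move=> hp; apply: (@intg_dom _ _ _ leb _ (fun t => `|phi t|)).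
- have mp := intg_measurable hp; by mfun.
- by move=> t; rewrite normrM ler_piMr// cos_max.
- exact: intg_abs.
Qed.

Lemma ft_reE phi w : ft_re phi w = FT 0 phi w.
Proof. by apply: Rintg_ext => t; rewrite addr0. Qed.

Lemma ft_imE phi w : intg leb phi -> ft_im phi w = FT (pi / 2) phi w.
Proof.
move=> hp; rewrite /ft_im -RintgN.
  by apply: Rintg_ext => t; rewrite cosDpihalf mulrN.
apply: (intg_ext _ (intgN (intg_cos w (pi / 2) hp))) => t.
by rewrite cosDpihalf mulrN opprK.
Qed.

Lemma FT_phase th phi w : intg leb phi ->
  FT th phi w = cos th * ft_re phi w + sin th * ft_im phi w.
Proof.
move=> hp; rewrite ft_reE ft_imE// /FT.
rewrite -!RintgZ; do ?exact: intg_cos.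
rewrite -RintgD; do ?by apply: intgZ; exact: intg_cos.
by apply: Rintg_ext => t; rewrite addr0 cosDpihalf cosD; ring.
Qed.

Lemma measurable_FT th phi : measurable_fun setT phi -> measurable_fun setT (FT th phi).
Proof.
move=> mp; apply: (measurable_lebRintg (f := fun w t => phi t * cos (t * w + th))).
by mfun.
Qed.

Lemma measurable_ft_re phi : measurable_fun setT phi -> measurable_fun setT (ft_re phi).
Proof. by move=> /(measurable_FT 0); apply: eq_measurable_fun => w _; rewrite ft_reE. Qed.

Lemma measurable_ft_im phi : intg leb phi -> measurable_fun setT (ft_im phi).
Proof.
move=> hp; have := measurable_FT (pi / 2) (intg_measurable hp).
by apply: eq_measurable_fun => w _; rewrite ft_imE.
Qed.

(** Two integrations by parts in one: in the derivative of [F] the terms [w * phi' * sin] cancel,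
    and [F] vanishes at both ends. Two derivatives are taken at once because they restore the
    phase. *)
Lemma FT_derive2 th phi w : schwartz phi ->
  FT th (derive1 (derive1 phi)) w = - (w ^+ 2 * FT th phi w).
Proof.
move=> sp; have sp1 := schwartz_derive sp; have sp2 := schwartz_derive sp1.
have i0 := schwartz_intg sp; have i2 := schwartz_intg sp2.
pose F (t : R) := derive1 phi t * cos (t * w + th) + w * (phi t * sin (t * w + th)).
pose f (t : R) := derive1 (derive1 phi) t * cos (t * w + th) + w ^+ 2 * (phi t * cos (t * w + th)).
have fi : intg leb f by apply: intgD; [exact: intg_cos|apply: intgZ; exact: intg_cos].
have dF (t : R) : is_derive t 1 F (f t).
  have := schwartz_is_derive t sp; have := schwartz_is_derive t sp1 => d1 d2.
  rewrite /F; apply: is_derive_eq; rewrite /GRing.scale /= /f; ring.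
have c0 := schwartz_continuous sp; have c2 := schwartz_continuous sp2.
have cc := @continuous_cos_affine R w th.
have cf : continuous f.
  move=> t; apply: cvgD; first by apply: cvgM; [exact: c2|exact: cc].
  by apply: cvgM; [exact: cvg_cst|apply: cvgM; [exact: c0|exact: cc]].
have lim0 (g : set_system R) (Fg : ProperFilter g) :
    phi x @[x --> g] --> 0 -> derive1 phi x @[x --> g] --> 0 -> F x @[x --> g] --> 0.
  move=> h0 h1; apply/norm_cvg0P.
  apply: (@squeeze_cvgr _ _ _ _ (cst 0) (fun x => `|derive1 phi x| + `|w| * `|phi x|)).
  + apply: nearW => x; rewrite normr_ge0 /= (le_trans (ler_normD _ _))// !normrM lerD//.
      by rewrite ler_piMr// cos_max.
    by rewrite ler_wpM2l// ler_piMr// sin_max.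
  + exact: cvg_cst.
  + rewrite -[X in _ --> X]addr0; apply: cvgD; first by apply/norm_cvg0P.
    by rewrite -(mulr0 `|w|); apply: cvgM; [exact: cvg_cst|apply/norm_cvg0P].
have [a1 a2] := schwartz_cvg0 sp; have [b1 b2] := schwartz_cvg0 sp1.
have := Rintg_FTC_line cf fi dF (lim0 _ proper_pinfty_nbhs a1 b1)
  (lim0 _ proper_ninfty_nbhs a2 b2).
rewrite subrr /f RintgD; [|exact: intg_cos|apply: intgZ; exact: intg_cos].
rewrite RintgZ; last exact: intg_cos.
by move=> /eqP; rewrite addr_eq0 => /eqP.
Qed.

Lemma FT_bounded phi : intg leb phi -> exists2 C, 0 <= C & forall th w, `|FT th phi w| <= C.
Proof.
move=> hp; exists (Rintegral leb setT (fun t => `|phi t|)).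
  by apply: Rintegral_ge0.
move=> th w; apply: Rintg_norm_le.
- exact: intg_measurable (intg_cos w th hp).
- exact: intg_abs.
- by move=> t; rewrite normrM ler_piMr// cos_max.
Qed.

(** Since (1 + w^2) times the transform of [phi] is the transform of [phi] minus that of its second
    derivative, every two derivatives gain one factor [wt w]. *)
Lemma FT_decay (k : nat) phi : schwartz phi ->
  exists2 C, 0 <= C & forall th w, `|FT th phi w| <= C * wt w ^+ k.
Proof.
elim: k phi => [|k IH] phi sp.
  have [C C0 hC] := FT_bounded (schwartz_intg sp).
  by exists C => // th w; rewrite expr0 mulr1.
have [C C0 hC] := IH _ sp.
have [D D0 hD] := IH _ (schwartz_derive (schwartz_derive sp)).
exists (C + D); first by rewrite addr_ge0.
move=> th w; rewrite exprSr mulrA [wt w in leRHS]/wt ler_pdivlMr ?wt_denom_gt0//.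
rewrite mulrDr mulr1 mulrDl; apply: lerD; first exact: hC.
by have := hD th w; rewrite FT_derive2// normrN normrM ger0_norm ?sqr_ge0// mulrC.
Qed.

Lemma FT_intg th phi : schwartz phi -> intg leb (FT th phi).
Proof.
move=> sp; have [C C0 hC] := FT_decay 1 sp.
apply: (@intg_dom _ _ _ leb _ (fun x => C * wt x)).
- exact: measurable_FT (schwartz_measurable sp).
- by move=> x; have := hC th x; rewrite expr1.
- by apply: intgZ; exact: intg_wt.
Qed.

End Fourier.

(** * The Poisson kernel and Fourier inversion *)

Section Poisson.
Variable R : realType.
Local Notation leb := (@lebesgue_measure R).
Implicit Types psi : R -> R.

Lemma intg_half_exp (e : R) : 0 < e -> intg leb (fun a => expR (- (e * a)) * (0 <= a)%R%:R).
Proof.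
move=> e0; apply: (@ge0_intg_exhaust _ _ e^-1).
- by mfun.
- by move=> x; rewrite mulr_ge0 ?expR_ge0.
- move=> n; apply: (@intg_dom _ _ _ leb _ (window n)).
  + have mw := @measurable_window R n; apply: measurable_funM => //; by mfun.
  + move=> x; rewrite normrM [`|window n x|]ger0_norm ?window_ge0// ler_piMl ?window_ge0//.
    case: (lerP 0 x) => x0; last by rewrite mulr0 normr0.
    rewrite mulr1 ger0_norm ?expR_ge0// -expR0 ler_expR oppr_le0 mulr_ge0//; lra.
  + exact: intg_itv.
- move=> n.
  have dF (x : R) : is_derive x 1 (fun x : R => - expR (- (e * x)) / e) (expR (- (e * x))).
    apply: is_derive_eq; rewrite /GRing.scale /=; field; lra.
  have cf : continuous (fun x : R => expR (- (e * x))).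
    move=> x; apply: continuous_comp; last exact: continuous_expR.
    by apply: cvgN; apply: cvgM; [exact: cvg_cst|exact: cvg_id].
  have -> : Rintegral leb setT (fun x => expR (- (e * x)) * (0 <= x)%R%:R * window n x) =
    Rintegral leb setT (fun x => expR (- (e * x)) * ((0 <= x) && (x <= n%:R))%:R).
    apply: Rintg_ext => x; rewrite -mulrA; congr (_ * _); rewrite /window -natrM mulnb; congr (_%:R).
    case: (lerP 0 x) => // x0; rewrite (_ : - n%:R <= x)//.
    by apply: le_trans x0; rewrite oppr_le0.
  rewrite (Rintg_FTC _ cf dF)//.
  rewrite mulr0 oppr0 expR0 mulN1r mulNr opprK.
  have : 0 <= expR (- (e * n%:R)) / e by rewrite mulr_ge0 ?expR_ge0// invr_ge0; lra.
  lra.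
Qed.

Lemma Rintg_half_exp_cos (e x : R) : 0 < e ->
  Rintegral leb setT (fun a => expR (- (e * a)) * (0 <= a)%R%:R * cos (a * x)) =
  e / (e ^+ 2 + x ^+ 2).
Proof.
move=> e0; have d0 : 0 < e ^+ 2 + x ^+ 2.
  by rewrite ltr_wpDr ?sqr_ge0 ?exprn_gt0.
have d1 : e ^+ 2 + x ^+ 2 != 0 by rewrite gt_eqF.
have hi := intg_half_exp e0.
have fi : intg leb (fun a => expR (- (e * a)) * (0 <= a)%R%:R * cos (a * x)).
  by apply: (intg_ext _ (intg_cos x 0 hi)) => a; rewrite addr0.
have /cvg_unique := Rintg_window_cvg fi; apply => //.
(* The real part of exp((-e + i x) a) / (-e + i x). *)
pose F (a : R) := expR (- (e * a)) * (x * sin (a * x) - e * cos (a * x)) / (e ^+ 2 + x ^+ 2).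
have dF (a : R) : is_derive a 1 F (expR (- (e * a)) * cos (a * x)).
  rewrite /F; apply: is_derive_eq; rewrite /GRing.scale /=; field; exact: d1.
have cf : continuous (fun a : R => expR (- (e * a)) * cos (a * x)).
  move=> a; apply: cvgM.
    apply: continuous_comp; last exact: continuous_expR.
    by apply: cvgN; apply: cvgM; [exact: cvg_cst|exact: cvg_id].
  apply: continuous_comp; last exact: continuous_cos.
  by apply: cvgM; [exact: cvg_id|exact: cvg_cst].
rewrite (_ : (fun n => _) = (fun n : nat => F n%:R - F 0)); last first.
  apply/funext => n; rewrite -(Rintg_FTC (ler0n _ n) cf dF).
  apply: Rintg_ext => a; rewrite /window.
  case: (lerP 0 a) => a0; last by rewrite !mulr0 !mul0r.
  have -> : - n%:R <= a by apply: le_trans a0; rewrite oppr_le0.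
  by rewrite mulr1.
have -> : e / (e ^+ 2 + x ^+ 2) = 0 - F 0.
  by rewrite /F mul0r sin0 cos0 mulr0 oppr0 expR0; field.
apply: cvgB; last exact: cvg_cst.
apply/norm_cvg0P.
apply: (@squeeze_cvgr _ _ _ _ (cst 0) (fun n => (`|x| + e) / (e ^+ 2 + x ^+ 2) * (expR (- e)) ^+ n)).
- apply: nearW => n; rewrite normr_ge0 /= /F normrM normfV [`|e ^+ 2 + _|]gtr0_norm//.
  rewrite mulrAC ler_pM2r ?invr_gt0// normrM ger0_norm ?expR_ge0// mulrC.
  rewrite -expRM_natr mulNr ler_wpM2r ?expR_ge0// (le_trans (ler_normB _ _))// !normrM lerD//.
    by rewrite ler_piMr// sin_max.
  by rewrite (gtr0_norm e0) ler_piMr ?(ltW e0)// cos_max.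
- exact: cvg_cst.
- rewrite -[X in _ --> X](mulr0 ((`|x| + e) / (e ^+ 2 + x ^+ 2))); apply: cvgM; first exact: cvg_cst.
  apply: cvg_expr; rewrite ger0_norm ?expR_ge0// -expR0 ltr_expR; lra.
Qed.

Lemma intg_exp_abs (e : R) : 0 < e -> intg leb (fun a => expR (- (e * `|a|))).
Proof.
move=> e0; have hi := intg_half_exp e0.
apply: (@intg_dom _ _ _ leb _ _ _ _ (intgD hi (intg_reflect hi))); first by mfun.
move=> a; rewrite ger0_norm ?expR_ge0//; case: (lerP 0 a) => a0.
  by rewrite (ger0_norm a0) mulr1 lerDl mulr_ge0 ?expR_ge0.
by rewrite (ltr0_norm a0) mulr0 add0r oppr_ge0 (ltW a0) mulr1.
Qed.

Lemma Rintg_exp_abs_cos (e x : R) : 0 < e ->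
  Rintegral leb setT (fun a => expR (- (e * `|a|)) * cos (a * x)) =
  2 * e / (e ^+ 2 + x ^+ 2).
Proof.
move=> e0; have hi := intg_half_exp e0.
have fi : intg leb (fun a => expR (- (e * a)) * (0 <= a)%R%:R * cos (a * x)).
  by apply: (intg_ext _ (intg_cos x 0 hi)) => a; rewrite addr0.
rewrite (@Rintg_off0 _ _ (fun a => (expR (- (e * a)) * (0 <= a)%R%:R * cos (a * x)) +
   (expR (- (e * - a)) * (0 <= - a)%R%:R * cos (- a * x)))).
- rewrite RintgD//; last exact: (intg_reflect fi).
  by rewrite (Rintg_reflect fi) Rintg_half_exp_cos//; field; rewrite gt_eqF// ltr_wpDr ?sqr_ge0// exprn_gt0.
- by mfun.
- by mfun.
- move=> a a0; rewrite oppr_ge0 mulNr cosN; case: (ltgtP a 0) a0 => // a0 _.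
    by rewrite !mulr0 mul0r add0r mulr1 (ltr0_norm a0).
  by rewrite mulr1 mulr0 mul0r addr0 (gtr0_norm a0).
Qed.

Lemma Rintg_Poisson (e : R) : 0 < e ->
  intg leb (fun t => 2 * e / (e ^+ 2 + t ^+ 2)) /\
  Rintegral leb setT (fun t => 2 * e / (e ^+ 2 + t ^+ 2)) = 2 * pi.
Proof.
move=> e0; have d0 (x : R) : 0 < e ^+ 2 + x ^+ 2.
  by rewrite ltr_wpDr ?sqr_ge0 ?exprn_gt0.
have d1 x : e ^+ 2 + x ^+ 2 != 0 by rewrite gt_eqF.
have cf : continuous (fun t : R => 2 * e / (e ^+ 2 + t ^+ 2)).
  move=> t; apply: cvgM; first exact: cvg_cst.
  apply: cvgV; first exact: d1.
  by apply: cvgD; [exact: cvg_cst|exact: exprn_continuous].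
have dF (t : R) : is_derive t 1 (fun t => 2 * atan (t / e)) (2 * e / (e ^+ 2 + t ^+ 2)).
  apply: is_derive_eq; rewrite /GRing.scale /=; field.
  by rewrite d1 gt_eqF.
have l1 : 2 * atan (t / e) @[t --> +oo] --> pi.
  rewrite (_ : pi = 2 * (pi / 2)); last by field.
  apply: cvgM; first exact: cvg_cst.
  apply: (cvg_comp (fun t : R => t / e) atan _ (@cvgy_atan R)).
  apply/cvgryPge => A; exists (A * e); split; first exact: num_real.
  by move=> t /ltW; rewrite ler_pdivlMr.
have l2 : 2 * atan (t / e) @[t --> -oo] --> - pi.
  apply/cvgNy_compNP; rewrite (_ : _ \o -%R = (fun t => - (2 * atan (t / e)))).
    exact: cvgN.
  by apply/funext => t /=; rewrite mulNr atanN mulrN.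
have fi : intg leb (fun t => 2 * e / (e ^+ 2 + t ^+ 2)).
  apply: (ge0_intg_FTC_line (l := pi) (m := - pi) cf _ dF).
    by move=> t; rewrite mulr_ge0 ?invr_ge0 ?(ltW (d0 _))//; lra.
  move=> t; have := atan_gtNpi2 (t / e); have := atan_ltpi2 (t / e); lra.
split => //; rewrite (Rintg_FTC_line cf fi dF l1 l2); ring.
Qed.

(** Abel summation: damping by exp(-e |w|) and exchanging the integrals turns the left side into
    [psi] integrated against the Poisson kernel [Q], of mass 2 pi and concentrating at 0. The two
    bounds control [psi t - psi 0] near 0 and far from it. *)
Lemma Fourier_inversion0 psi (L M : R) : intg leb psi -> intg leb (ft_re psi) ->
  (forall t, `|psi t - psi 0| <= L * `|t|) -> (forall t, `|psi t - psi 0| <= M) ->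
  Rintegral leb setT (ft_re psi) = 2 * pi * psi 0.
Proof.
move=> hp hA hL hM.
have mp := intg_measurable hp; have mA := intg_measurable hA.
have M0 : 0 <= M by apply: le_trans (hM 0).
have L0 : 0 <= L by have := hL 1; rewrite normr1 mulr1; apply: le_trans.
pose e (n : nat) : R := n.+1%:R^-1.
have e0 n : 0 < e n by rewrite invr_gt0.
have e1 n : e n <= 1 by rewrite invf_le1// ler1n.
have el : e n @[n --> \oo] --> 0 by exact: cvg_harmonic.
have [||||_ l1] := @RDCT _ _ _ leb (fun n w => ft_re psi w * expR (- (e n * `|w|)))
  (ft_re psi) (fun w => `|ft_re psi w|).
- by move=> n; mfun.
- move=> w; rewrite -[X in _ --> X]mulr1; apply: cvgM; first exact: cvg_cst.
  rewrite -expR0; apply: (cvg_comp _ expR); last exact: continuous_expR.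
  rewrite -oppr0; apply: cvgN; rewrite -(mul0r `|w|); apply: cvgM => //; exact: cvg_cst.
- move=> n w; rewrite normrM ler_piMr// ger0_norm ?expR_ge0//.
  by rewrite -expR0 ler_expR oppr_le0 mulr_ge0// ltW.
- exact: intg_abs.
pose Q n t := 2 * e n / (e n ^+ 2 + t ^+ 2).
have Q0 n t : 0 <= Q n t.
  rewrite /Q mulr_ge0// ?mulr_ge0 ?(ltW (e0 n))// invr_ge0.
  by rewrite addr_ge0 ?sqr_ge0.
have mQ n : measurable_fun setT (Q n).
  have [/intg_measurable //] := Rintg_Poisson (e0 n).
have EE n : Rintegral leb setT (fun w => ft_re psi w * expR (- (e n * `|w|))) =
    2 * pi * psi 0 + Rintegral leb setT (fun t => (psi t - psi 0) * Q n t).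
  have [||||_ _ E] := @lebFubini _ (fun w t => expR (- (e n * `|w|)) * (psi t * cos (t * w)))
     (fun w => expR (- (e n * `|w|))) (fun t => `|psi t|).
  + by mfun.
  + move=> w t; rewrite normrM ger0_norm ?expR_ge0// ler_wpM2l ?expR_ge0//.
    by rewrite normrM ler_piMr// cos_max.
  + exact: intg_exp_abs.
  + exact: intg_abs.
  have Ec w : intg leb (fun t => psi t * cos (t * w)).
    by apply: (intg_ext _ (intg_cos w 0 hp)) => a; rewrite addr0.
  have [iQ EQ] := Rintg_Poisson (e0 n).
  transitivity (Rintegral leb setT (fun t => psi t * Q n t)).
    transitivity (Rintegral leb setT (fun w => Rintegral leb setT
        (fun t => expR (- (e n * `|w|)) * (psi t * cos (t * w))))).
      by apply: Rintg_ext => w; rewrite RintgZ// mulrC.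
    rewrite E; apply: Rintg_ext => t; rewrite /Q -Rintg_exp_abs_cos//.
    rewrite -RintgZ.
      by apply: Rintg_ext => w; rewrite mulrCA (mulrC t).
    by apply: (intg_ext _ (intg_cos t 0 (intg_exp_abs (e0 n)))) => a; rewrite addr0.
  have i2 : intg leb (fun t => (psi t - psi 0) * Q n t).
    apply: (@intg_dom _ _ _ leb _ _ _ _ (intgZ M iQ)).
      by have := mQ n => mQn; mfun.
    by move=> t; rewrite normrM [`|Q n t|]ger0_norm// ler_wpM2r.
  rewrite -EQ mulrC -RintgZ// -RintgD//; last exact: intgZ.
  by apply: Rintg_ext => t; rewrite /Q; ring.
suff l2 : (fun n => Rintegral leb setT (fun w => ft_re psi w * expR (- (e n * `|w|))))
    @ \oo --> 2 * pi * psi 0 by exact: (cvg_unique _ l1 l2).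
rewrite (funext EE).
rewrite -[X in _ --> X]addr0; apply: cvgD; first exact: cvg_cst.
(* The majorant: for [|t| <= 1], [|t| * Q n t <= 1] by the inequality of means and [1 <= 2 * wt t];
   for [|t| > 1], [Q n t <= 4 * wt t] because [e n <= 1]. *)
have [||||_] := @RDCT _ _ _ leb (fun n t => (psi t - psi 0) * Q n t) (fun=> 0)
   (fun t => (4 * L + 4 * M) * wt t).
- by move=> n; have := mQ n => mQn; mfun.
- move=> t; have [->|t0] := eqVneq t 0.
    by under eq_fun do rewrite subrr mul0r; exact: cvg_cst.
  have t2 : 0 < t ^+ 2 by rewrite exprn_even_gt0.
  apply/norm_cvg0P.
  apply: (@squeeze_cvgr _ _ _ _ (cst 0) (fun n => 2 * M / t ^+ 2 * e n)).
  + apply: nearW => n; rewrite normr_ge0 /= normrM [`|Q n t|]ger0_norm// /Q.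
    have -> : 2 * M / t ^+ 2 * e n = M * (2 * e n / t ^+ 2) by ring.
    apply: ler_pM => //; first exact: Q0.
    rewrite ler_wpM2l ?mulr_ge0 ?(ltW (e0 n))//.
    by rewrite lef_pV2 ?posrE// ?lerDr ?sqr_ge0// ltr_wpDl ?sqr_ge0.
  + exact: cvg_cst.
  + rewrite -(mulr0 (2 * M / t ^+ 2)); apply: cvgM => //; exact: cvg_cst.
- move=> n t; rewrite normrM [`|Q n t|]ger0_norm//.
  have en := e0 n; have en1 := e1 n.
  have e2 : 0 < e n ^+ 2 by rewrite exprn_gt0.
  have t2 : 0 <= t ^+ 2 by exact: sqr_ge0.
  have d0 : 0 < e n ^+ 2 + t ^+ 2 by lra.
  have w0 := wt_gt0 t.
  rewrite mulrDl; case: (lerP `|t| 1) => t1.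
    have tt : t ^+ 2 <= 1 by rewrite -real_normK ?num_real// expr_le1.
    apply: (@le_trans _ _ (2 * L * wt t * 2)); last first.
      have -> : 2 * L * wt t * 2 = 4 * L * wt t by ring.
      by rewrite lerDl !mulr_ge0// ltW.
    have hw : 1 <= wt t * 2.
      by rewrite /wt mulrC ler_pdivlMr ?wt_denom_gt0//; lra.
    apply: (@le_trans _ _ (L * 1)); last first.
      rewrite -mulrA (mulrC 2) -!mulrA ler_wpM2l//; lra.
    apply: (@le_trans _ _ (L * `|t| * Q n t)); first by rewrite ler_wpM2r.
    rewrite -mulrA ler_wpM2l// /Q mulrA ler_pdivrMr// mul1r.
    rewrite -[t ^+ 2]real_normK ?num_real//.
    have := sqr_ge0 (`|t| - e n); rewrite sqrrB; lra.
  have tt : 1 <= t ^+ 2 by rewrite -real_normK ?num_real// expr_ge1// ltW.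
  apply: (@le_trans _ _ (M * (4 * wt t))); last first.
    have -> : M * (4 * wt t) = 4 * M * wt t by ring.
    by rewrite lerDr !mulr_ge0// ltW.
  apply: ler_pM => //.
  rewrite /Q /wt ler_pdivrMr// mulrAC ler_pdivlMr ?wt_denom_gt0//.
  have h1 : e n * t ^+ 2 <= 1 * t ^+ 2 by rewrite ler_wpM2r.
  lra.
- by apply: intgZ; exact: intg_wt.
by rewrite Rintg0.
Qed.

End Poisson.

(** * One-sided nonincreasing kernels *)

Section Kernel.
Variable R : realType.
Local Notation leb := (@lebesgue_measure R).

(* [kappa] stands for [K^+]; its value at the origin plays no role and is set to 0. *)
Record decreasing_kernel (kappa : R -> R) : Prop := DecreasingKernel {
  kernel_measurable : measurable_fun setT kappa;
  kernel_ge0 : forall s, 0 <= kappa s;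
  kernel_le0 : forall s, s <= 0 -> kappa s = 0;
  kernel_decr : forall x y, 0 < x -> x <= y -> kappa y <= kappa x;
  kernel_cvg0 : kappa x @[x --> +oo] --> 0;
  kernel_intg : intg leb (fun s => kappa s * (1 + `|s|)^-1) }.

Variable kappa : R -> R.
Hypothesis kk : decreasing_kernel kappa.

Let mk := kernel_measurable kk.
Let k0 := kernel_ge0 kk.

Lemma kernel_window_intg (T : R) :
  intg leb (fun s => kappa s * ((0 <= s) && (s <= T))%:R).
Proof.
apply: (@intg_dom _ _ _ leb _ _ _ _ (intgZ (1 + `|T|) (kernel_intg kk))); first by mfun.
move=> s; have d0 : 0 < 1 + `|s| by rewrite ltr_wpDr.
rewrite ger0_norm ?mulr_ge0// mulrCA ler_wpM2l//.
case: (boolP ((0 <= s) && (s <= T))) => [/andP[s0 sT]|_]; last by rewrite divr_ge0.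
by rewrite ler_pdivlMr// mul1r lerD2l ger0_norm// (le_trans sT)// ler_norm.
Qed.

Lemma kernel_wt_intg : intg leb (fun s => kappa s * wt s).
Proof.
have mw := @measurable_wt R.
apply: (@intg_dom _ _ _ leb _ _ _ _ (intgZ 2 (kernel_intg kk))); first by mfun.
move=> s; have d0 : 0 < 1 + `|s| by rewrite ltr_wpDr.
rewrite ger0_norm ?mulr_ge0 ?wt_ge0// mulrCA ler_wpM2l//.
rewrite /wt ler_pdivlMr// ler_pdivrMl ?wt_denom_gt0//.
rewrite -[s ^+ 2]real_normK ?num_real//.
have := sqr_ge0 (`|s| - 1); rewrite sqrrB; have := sqr_ge0 `|s|; lra.
Qed.

(** One bound for all dampings [e], all centres [-u] and all phases: the limit [e -> 0] is later
    taken under an integral in [u]. The value [e = 0] gives the tails of the undamped transform. *)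
Definition tail_bound (w : R) (B : R -> R) : Prop :=
  forall a b u e th : R, 0 < a -> 0 <= e ->
  `|Rintegral leb setT (fun s => kappa s * expR (- (e * (u + s) ^+ 2)) * cos (s * w + th)
      * ((a < s) && (s <= b))%:R)| <= B a.

(** The frequencies at which the limit arguments work: every [w != 0], by oscillation, and also 0
    when [kappa] is integrable. *)
Definition nonsingular (w : R) : Prop :=
  exists2 B : R -> R, B x @[x --> +oo] --> 0 & tail_bound w B.

Lemma gauss_le1 (e x : R) : 0 <= e -> expR (- (e * x ^+ 2)) <= 1.
Proof. by move=> e0; rewrite -expR0 ler_expR oppr_le0 mulr_ge0// sqr_ge0. Qed.

(** [osc_boundedM] is applied twice to the cosine: with the Gaussian, at most 1 and unimodal, then
    with [kappa], at most [kappa a] and nonincreasing on [a, b]. The damping therefore does not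
    enter the constant. *)
Lemma tail_bound_neq0 (w : R) : w != 0 -> tail_bound w (fun a => kappa a * (2 / `|w|)).
Proof.
move=> w0 a b u e th a0 e0.
case: (lerP a b) => ab; last first.
  rewrite Rintg_eq0 ?normr0 ?mulr_ge0 ?divr_ge0//.
  move=> s; case: (ltrP a s) => /= h; rewrite ?mulr0//.
  by rewrite (lt_geF (lt_trans ab h)) mulr0.
have o1 := @osc_bounded_cos R a b w th w0.
have o2 : osc_bounded a b (fun s => expR (- (e * (u + s) ^+ 2)) * cos (s * w + th)) (1 * (2 / `|w|)).
  apply: osc_boundedM => //; try by mfun.
  - by move=> x _; rewrite expR_ge0 gauss_le1.
  - move=> y y0 s t [sI ys] [tI yt] z /andP[sz zt]; split.
      move: sI tI; rewrite /= !in_itv /= => /andP[h1 _] /andP[_ h2].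
      by rewrite (le_trans h1 sz) (le_trans zt h2).
    rewrite /= in ys yt *.
    (* A point [z] between [s] and [t] is at least as close to the centre [-u] as one of them, so
       the Gaussian at [z] is at least its value there. *)
    have sq (p : R) : (u + z) ^+ 2 <= (u + p) ^+ 2 -> y <= expR (- (e * (u + p) ^+ 2)) ->
       y <= expR (- (e * (u + z) ^+ 2)).
      by move=> h hy; apply: (le_trans hy); rewrite ler_expR lerN2 ler_wpM2l.
    case: (lerP 0 (u + z)) => uz.
      by apply: (sq t) yt; rewrite lerXn2r ?nnegrE//; lra.
    apply: (sq s) ys; rewrite -[leLHS]sqrrN -[leRHS]sqrrN lerXn2r ?nnegrE//; lra.
have o3 : osc_bounded a b (fun s => kappa s * (expR (- (e * (u + s) ^+ 2)) * cos (s * w + th)))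
     (kappa a * (1 * (2 / `|w|))).
  apply: osc_boundedM => //; try by mfun.
  - by move=> x /andP[ax _]; rewrite k0 (kernel_decr kk).
  - move=> y y0 s t [sI ys] [tI yt] z /andP[sz zt].
    move: sI tI; rewrite /= !in_itv /= => /andP[h1 _] /andP[_ h2]; split.
      by rewrite (le_trans h1 sz) (le_trans zt h2).
    by apply: (le_trans yt); apply: (kernel_decr kk) => //; lra.
have [_ /(_ `]a, b]%classic)] := o3; rewrite mul1r.
move=> /(_ (@interval_is_interval _ _)) h.
have {h} := h _; rewrite (@Rintg_ext _ _ _ leb _ (fun s => kappa s * expR (- (e * (u + s) ^+ 2)) *
  cos (s * w + th) * ((a < s) && (s <= b))%:R)).
  by apply=> s; rewrite /= !in_itv /= => /andP[/ltW -> ->].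
by move=> s; rewrite indicE mem_setE /= in_itv /= mulrA.
Qed.

Lemma nonsingular_neq0 (w : R) : w != 0 -> nonsingular w.
Proof.
move=> w0; exists (fun a => kappa a * (2 / `|w|)); last exact: tail_bound_neq0.
rewrite -(mul0r (2 / `|w|)); apply: cvgM; [exact: (kernel_cvg0 kk)|exact: cvg_cst].
Qed.

(** Absolute convergence replaces oscillation, which matters at [w = 0]; the bound is the mass of
    [kappa] beyond [a]. *)
Lemma nonsingular_intg (w : R) : intg leb kappa -> nonsingular w.
Proof.
move=> ki; exists (fun a => Rintegral leb setT (fun s => kappa s * (a <= s)%R%:R)).
  apply/cvg_pinftyP => v vy.
  have [||||_] := @RDCT _ _ _ leb (fun n s => kappa s * (v n <= s)%R%:R) (fun=> 0) kappa; last by rewrite Rintg0.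
  - by move=> n; mfun.
  - move=> s; apply: cvg_near_cst; near=> n.
    have h : s < v n by near: n; move/cvgryPgt : vy; apply.
    by rewrite leNgt h mulr0.
  - move=> n s; rewrite ger0_norm ?mulr_ge0// ler_piMr// lern1; by case: (_ <= _).
  - by [].
move=> a b u e th a0 e0; apply: Rintg_norm_le.
- by mfun.
- apply: (@intg_dom _ _ _ leb _ _ _ _ ki); first by mfun.
  move=> s; rewrite ger0_norm ?mulr_ge0// ler_piMr// lern1; by case: (_ <= _).
- move=> s; rewrite !normrM normr_nat (ger0_norm (k0 s)) (ger0_norm (expR_ge0 _)).
  rewrite -!mulrA ler_wpM2l//.
  case: (ltrP a s) => /= [/ltW ->|_]; last by rewrite !mulr0.
  rewrite -[leRHS]mulr1 mulrA; apply: ler_pM; rewrite ?mulr_ge0 ?expR_ge0//.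
    by rewrite -[leRHS]mulr1; apply: ler_pM; rewrite ?expR_ge0 ?gauss_le1 ?cos_max.
  by case: (s <= b).
Unshelve. all: by end_near. Qed.

(** The real part of exp(i th) times the integral of kappa(s) exp(i s w) over [0, T]; the phase
    -pi/2 gives the sine integral. [Kph] below is the corresponding combination of the limits. *)
Definition Kpart (th w T : R) : R :=
  Rintegral leb setT (fun s => kappa s * ((0 <= s) && (s <= T))%:R * cos (s * w + th)).

Definition Kc (w : R) : R := lim (Kpart 0 w @ +oo).
Definition Ks (w : R) : R := lim (Kpart (- (pi / 2)) w @ +oo).
Definition Kph (th w : R) : R := cos th * Kc w - sin th * Ks w.

Lemma Kpart_phase th w T :
  Kpart th w T = cos th * Kpart 0 w T - sin th * Kpart (- (pi / 2)) w T.
Proof.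
have hi x := intg_cos w x (kernel_window_intg T).
rewrite /Kpart -!RintgZ; do ?exact: hi.
rewrite -RintgB; do ?by apply: intgZ; exact: hi.
apply: Rintg_ext => s; rewrite addr0 (cosD _ th) (_ : cos (s * w + - (pi / 2)) = sin (s * w)).
  by ring.
exact: cosBpihalf.
Qed.

Lemma Kpart_diff th w B (a b : R) : tail_bound w B -> 0 < a -> a <= b ->
  `|Kpart th w b - Kpart th w a| <= B a.
Proof.
move=> tb a0 ab; have := tb a b 0 0 th a0 (lexx 0).
rewrite /Kpart -RintgB; do ?exact: intg_cos (kernel_window_intg _).
congr (`|_| <= _); apply: Rintg_ext => s; rewrite mul0r oppr0 expR0 mulr1.
case: (lerP s 0) => s0; first by rewrite (kernel_le0 kk)// !mul0r subr0.
rewrite (ltW s0) /=; case: (lerP s a) => sa /=.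
  by rewrite (le_trans sa ab) subrr mulr0.
by rewrite mulr0 mul0r subr0 mulrAC.
Qed.

(** The tail bound is a Cauchy criterion, which gives the [lim] in [Kc] and [Ks] their meaning;
    every other phase is a linear combination of these two. *)
Lemma Kpart_cvg th w : nonsingular w -> Kpart th w x @[x --> +oo] --> Kph th w.
Proof.
move=> [B B0 tb].
have cv x : cvg (Kpart x w @ +oo).
  apply/cauchy_cvgP/cauchy_exP => e e0.
  have [a [a0 Ba]] : exists a, 0 < a /\ B a < e.
    near (pinfty_nbhs R) => a; exists a; split; near: a.
      by apply: nbhs_pinfty_gt; rewrite num_real.
    move/cvgrPdist_lt : B0 => /(_ e e0); apply: filterS => t.
    by rewrite sub0r normrN; apply: le_lt_trans; exact: ler_norm.
  exists (Kpart x w a); exists a; split; first exact: num_real.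
  by move=> b /ltW ab; rewrite /ball /= distrC; apply: le_lt_trans Ba; exact: Kpart_diff.
rewrite (funext (Kpart_phase th w)) /Kph; apply: cvgB.
  by apply: cvgM; [exact: cvg_cst|exact: cv].
by apply: cvgM; [exact: cvg_cst|exact: cv].
Unshelve. all: by end_near. Qed.

Lemma Kpart_dist th w B a : nonsingular w -> tail_bound w B -> 0 < a ->
  `|Kph th w - Kpart th w a| <= B a.
Proof.
move=> gw tb a0; have cv : Kpart th w x @[x --> +oo] --> Kph th w := Kpart_cvg gw.
have h : `|Kpart th w x - Kpart th w a| @[x --> +oo] --> `|Kph th w - Kpart th w a|.
  by apply: cvg_norm; apply: cvgB => //; exact: cvg_cst.
apply: (cvgr_to_le h); exists a; split; first exact: num_real.
by move=> x /ltW ax; exact: Kpart_diff.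
Qed.

End Kernel.

(** * Gauss-regularised transform of a convolution *)

Section GaussRegularisation.
Variable R : realType.
Local Notation leb := (@lebesgue_measure R).

(** From [1 + y <= expR y] and [1 + x ^+ 2 <= (1 + e^-1) * (1 + e * x ^+ 2)]. *)
Lemma gauss_wt (e : R) : 0 < e ->
  exists2 c, 0 <= c & forall x, expR (- (e * x ^+ 2)) <= c * wt x.
Proof.
move=> e0; exists (1 + e^-1); first by rewrite addr_ge0// invr_ge0 ltW.
move=> x; rewrite /wt ler_pdivlMr ?wt_denom_gt0//.
have x2 := sqr_ge0 x.
have h : 0 < 1 + e * x ^+ 2 by rewrite ltr_wpDr// mulr_ge0// ltW.
have h1 : expR (- (e * x ^+ 2)) * (1 + e * x ^+ 2) <= 1.
  rewrite expRN mulrC ler_pdivrMr ?expR_gt0// mul1r expR_ge1Dx//.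
apply: (@le_trans _ _ (expR (- (e * x ^+ 2)) * ((1 + e^-1) * (1 + e * x ^+ 2)))).
  rewrite ler_wpM2l ?expR_ge0//.
  have -> : (1 + e^-1) * (1 + e * x ^+ 2) = 1 + x ^+ 2 + e^-1 + e * x ^+ 2 by field; lra.
  have : 0 <= e^-1 by rewrite invr_ge0 ltW.
  have : 0 <= e * x ^+ 2 by rewrite mulr_ge0// ltW.
  lra.
rewrite mulrCA ler_piMr//; by rewrite addr_ge0// invr_ge0 ltW.
Qed.

Variable kappa : R -> R.
Hypothesis kk : decreasing_kernel kappa.
Let mk := kernel_measurable kk.
Let k0 := kernel_ge0 kk.

(** What remains of the Gauss mean of a convolution with [kappa] when [u], the argument of [phi], is
    held fixed: the centre and the phase of the damped transform then depend on [u]. *)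
Definition Jreg (e u w th : R) : R :=
  Rintegral leb setT (fun s => kappa s * expR (- (e * (u + s) ^+ 2)) * cos (s * w + th)).

Lemma Jreg_intg (e u w th : R) : 0 < e ->
  intg leb (fun s => kappa s * expR (- (e * (u + s) ^+ 2)) * cos (s * w + th)).
Proof.
move=> e0; have [c c0 hc] := gauss_wt e0.
apply: (@intg_dom _ _ _ leb _ _ _ _ (intgZ (c * (2 * (1 + u ^+ 2))) (kernel_wt_intg kk))).
  by mfun.
move=> s; rewrite !normrM (ger0_norm (k0 s)) (ger0_norm (expR_ge0 _)).
rewrite -mulrA [leRHS]mulrCA ler_wpM2l// -[leRHS]mulr1.
apply: ler_pM; rewrite ?expR_ge0 ?cos_max//.
by apply: (le_trans (hc _)); rewrite -[leRHS]mulrA ler_wpM2l// wtD.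
Qed.

Lemma Jreg_tail (e u w th a : R) B : tail_bound kappa w B -> 0 < e -> 0 < a ->
  `|Jreg e u w th - Rintegral leb setT (fun s => kappa s * ((0 <= s) && (s <= a))%:R *
     (expR (- (e * (u + s) ^+ 2)) * cos (s * w + th)))| <= B a.
Proof.
move=> tb e0 a0.
have hi := Jreg_intg u w th e0.
have h := Rintg_window_cvg hi.
set c := Rintegral _ _ _.
have h2 : (fun n => `|Rintegral leb setT (fun x => kappa x * expR (- (e * (u + x) ^+ 2)) *
    cos (x * w + th) * window n x) - c|) @ \oo --> `|Jreg e u w th - c|.
  by apply: cvg_norm; apply: cvgB => //; exact: cvg_cst.
apply: (cvgr_to_le h2); near=> n.
have an : a <= n%:R by near: n; exact: nbhs_infty_ger.
have mw := @measurable_window R n.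
have i1 : intg leb (fun s => kappa s * ((0 <= s) && (s <= a))%:R *
     (expR (- (e * (u + s) ^+ 2)) * cos (s * w + th))).
  apply: (@intg_dom _ _ _ leb _ _ _ _ (kernel_window_intg kk a)); first by mfun.
  move=> s; rewrite normrM [`|kappa s * _|]ger0_norm ?mulr_ge0// ler_piMr ?mulr_ge0//.
  rewrite normrM (ger0_norm (expR_ge0 _)) -[leRHS]mulr1.
  by apply: ler_pM; rewrite ?expR_ge0 ?cos_max ?gauss_le1// ltW.
have i2 : intg leb (fun x => kappa x * expR (- (e * (u + x) ^+ 2)) * cos (x * w + th) * window n x).
  apply: (@intg_dom _ _ _ leb _ _ _ _ (intg_abs hi)); first by mfun.
  by move=> s; rewrite normrM ler_piMr// ger0_norm ?window_ge0 ?window_le1.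
rewrite /c -RintgB//.
have := tb a n%:R u e th a0 (ltW e0); congr (`|_| <= _).
apply: Rintg_ext => s; rewrite /window.
case: (lerP s 0) => s0; first by rewrite (kernel_le0 kk)// !mul0r subr0.
have -> : - n%:R <= s by apply: le_trans (ltW s0); rewrite oppr_le0.
rewrite (ltW s0) /=; case: (lerP s a) => sa /=.
  by rewrite (le_trans sa an) !mulr1 mulr0 -mulrA subrr.
by rewrite mulr0 mul0r subr0.
Unshelve. all: by end_near. Qed.

Lemma window_reg_le (e u w th a : R) : 0 <= e ->
  `|Rintegral leb setT (fun s => kappa s * ((0 <= s) && (s <= a))%:R *
     (expR (- (e * (u + s) ^+ 2)) * cos (s * w + th)))| <=
  Rintegral leb setT (fun s => kappa s * ((0 <= s) && (s <= a))%:R).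
Proof.
move=> e0; apply: Rintg_norm_le; [by mfun|exact: kernel_window_intg|].
move=> s; rewrite normrM [`|kappa s * _|]ger0_norm ?mulr_ge0// ler_piMr ?mulr_ge0//.
rewrite normrM (ger0_norm (expR_ge0 _)) -[leRHS]mulr1.
by apply: ler_pM; rewrite ?expR_ge0 ?cos_max ?gauss_le1.
Qed.

(** Uniformity in [e] and [u] lets dominated convergence run against [phi]: the tail beyond 1 is
    bounded by [B 1], the rest by the mass of [kappa] on [0, 1]. *)
Lemma Jreg_bounded (w : R) : nonsingular kappa w ->
  exists C, forall e u th, 0 < e -> `|Jreg e u w th| <= C.
Proof.
move=> [B B0 tb].
exists (B 1 + Rintegral leb setT (fun s => kappa s * ((0 <= s) && (s <= 1))%:R)).
move=> e u th e0; have := Jreg_tail u th tb e0 ltr01.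
have := @window_reg_le e u w th 1 (ltW e0).
set c := Rintegral _ _ _; set D := Rintegral _ _ _ => h1 h2.
have -> : Jreg e u w th = (Jreg e u w th - c) + c by ring.
by apply: (le_trans (ler_normD _ _)); exact: lerD.
Qed.

(** Beyond a large [a] both the damped and the undamped tails are below [d / 3], uniformly in [n];
    on [0, a] the Gaussian factor tends to 1 with integrable majorant [kappa]. *)
Lemma Jreg_cvg (v : nat -> R) (u w th : R) : nonsingular kappa w ->
  (forall n, 0 < v n) -> v n @[n --> \oo] --> 0 ->
  Jreg (v n) u w th @[n --> \oo] --> Kph kappa th w.
Proof.
move=> gw v0 vl; have [B B0 tb] := gw.
apply/cvgrPdist_lt => d d0.
have d3 : 0 < d / 3 by rewrite divr_gt0.
have [a [a0 Ba]] : exists a, 0 < a /\ B a < d / 3.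
  near (pinfty_nbhs R) => a; exists a; split; near: a.
    by apply: nbhs_pinfty_gt; rewrite num_real.
  move/cvgrPdist_lt : B0 => /(_ _ d3); apply: filterS => t.
  by rewrite sub0r normrN; apply: le_lt_trans; exact: ler_norm.
pose W n := Rintegral leb setT (fun s => kappa s * ((0 <= s) && (s <= a))%:R *
     (expR (- (v n * (u + s) ^+ 2)) * cos (s * w + th))).
have lW : W n @[n --> \oo] --> Kpart kappa th w a.
  have [||||_] := @RDCT _ _ _ leb (fun n s => kappa s * ((0 <= s) && (s <= a))%:R *
     (expR (- (v n * (u + s) ^+ 2)) * cos (s * w + th)))
     (fun s => kappa s * ((0 <= s) && (s <= a))%:R * cos (s * w + th))
     (fun s => kappa s * ((0 <= s) && (s <= a))%:R); last by [].
  - by move=> n; mfun.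
  - move=> s; apply: cvgM; first exact: cvg_cst.
    rewrite -[X in _ --> X]mul1r; apply: cvgM; last exact: cvg_cst.
    rewrite -expR0; apply: (cvg_comp _ expR); last exact: continuous_expR.
    rewrite -oppr0; apply: cvgN; rewrite -(mul0r ((u + s) ^+ 2)); apply: cvgM => //; exact: cvg_cst.
  - move=> n s; rewrite normrM [`|kappa s * _|]ger0_norm ?mulr_ge0// ler_piMr ?mulr_ge0//.
    rewrite normrM (ger0_norm (expR_ge0 _)) -[leRHS]mulr1.
    by apply: ler_pM; rewrite ?expR_ge0 ?cos_max ?gauss_le1// ltW.
  - exact: kernel_window_intg.
have h1 : `|Kph kappa th w - Kpart kappa th w a| <= B a := Kpart_dist kk _ gw tb a0.
move/cvgrPdist_lt : lW => /(_ _ d3); apply: filterS => n h2.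
have h3 := Jreg_tail u th tb (v0 n) a0; rewrite -/(W n) in h3.
have -> : Kph kappa th w - Jreg (v n) u w th =
  (Kph kappa th w - Kpart kappa th w a) + (Kpart kappa th w a - W n) - (Jreg (v n) u w th - W n) by ring.
apply: (le_lt_trans (ler_normB _ _)); apply: (le_lt_trans (lerD (ler_normD _ _) (lexx _))).
lra.
Unshelve. all: by end_near. Qed.

(* [sg = 1] is used for [K^+ * phi] and [sg = -1] for the operator [L]. *)
Definition kconv (sg : R) (phi : R -> R) (t : R) : R :=
  Rintegral leb setT (fun s => kappa s * phi (t - sg * s)).

Variables (sg : R) (phi : R -> R).
Hypothesis hsg : sg = 1 \/ sg = -1.
Hypothesis sp : schwartz phi.

Lemma sign_sqr : sg * sg = 1. Proof. by case: hsg => ->; rewrite ?mulr1 ?mulrNN ?mulr1. Qed.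

Lemma wt_sign x : wt (sg * x) = wt x.
Proof. by case: hsg => ->; rewrite ?mul1r// mulN1r wtN. Qed.

Lemma cos_sign x : cos (sg * x) = cos x.
Proof. by case: hsg => ->; rewrite ?mul1r// mulN1r cosN. Qed.

Lemma sin_sign x : sin (sg * x) = sg * sin x.
Proof. by case: hsg => ->; rewrite ?mul1r// !mulN1r sinN. Qed.

Let mphi := schwartz_measurable sp.

(** Peetre's inequality separates [t] from [s], at the price of growth in [t]. *)
Lemma kconv_dom : exists2 C, 0 <= C &
  forall t s, `|kappa s * phi (t - sg * s)| <= C * (1 + t ^+ 2) * (kappa s * wt s).
Proof.
have [C C0 hC] := schwartz_decay 1 sp; exists (C * 2); first by rewrite mulr_ge0.
move=> t s; rewrite normrM ger0_norm// mulrCA ler_wpM2l//.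
apply: (le_trans (hC _)); rewrite expr1 -!mulrA ler_wpM2l//.
by rewrite mulrA -(wt_sign s) -(wtN (sg * s)) wtD.
Qed.

Lemma kconv_intg t : intg leb (fun s => kappa s * phi (t - sg * s)).
Proof.
have [C C0 hC] := kconv_dom.
by apply: (@intg_dom _ _ _ leb _ _ _ (hC t) (intgZ _ (kernel_wt_intg kk))); mfun.
Qed.

(** The second power of [wt] is needed because one factor absorbs the growth [1 + t ^+ 2] from
    [kconv_dom] and the other makes the majorant integrable. *)
Lemma kconv_Fubini (h : R -> R) (C : R) : measurable_fun setT h ->
  (forall t, `|h t| <= C * wt t ^+ 2) ->
  [/\ intg leb (fun t => kconv sg phi t * h t),
      intg leb (fun s => kappa s * Rintegral leb setT (fun u => phi u * h (u + sg * s))) &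
      Rintegral leb setT (fun t => kconv sg phi t * h t) =
      Rintegral leb setT (fun s => kappa s *
        Rintegral leb setT (fun u => phi u * h (u + sg * s)))].
Proof.
move=> mh hC; have [D D0 hD] := kconv_dom.
have C0 : 0 <= C.
  by have := le_trans (normr_ge0 _) (hC 0); rewrite /wt expr0n /= addr0 invr1 expr1n mulr1.
have [||||i1 i2 E] := @lebFubini _ (fun t s => kappa s * phi (t - sg * s) * h t)
  (fun t => D * C * wt t) (fun s => kappa s * wt s).
- by mfun.
- move=> t s; rewrite normrM.
  apply: (le_trans (ler_pM (normr_ge0 _) (normr_ge0 _) (hD t s) (hC t))).
  rewrite (_ : D * (1 + t ^+ 2) * (kappa s * wt s) * (C * wt t ^+ 2) =
     D * C * wt t * (kappa s * wt s) * ((1 + t ^+ 2) * wt t)); last by ring.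
  by rewrite /wt divff ?mulr1// gt_eqF// wt_denom_gt0.
- by apply: intgZ; exact: intg_wt.
- exact: kernel_wt_intg.
have E1 : (fun t => Rintegral leb setT (fun s => kappa s * phi (t - sg * s) * h t)) =
   (fun t => kconv sg phi t * h t).
  by apply/funext => t; rewrite RintgZr//; exact: kconv_intg.
have E2 s : Rintegral leb setT (fun t => kappa s * phi (t - sg * s) * h t) =
    kappa s * Rintegral leb setT (fun u => phi u * h (u + sg * s)).
  have hi : intg leb (fun t => phi (t - sg * s) * h t).
    apply: (@intg_dom _ _ _ leb _ (fun t => C * `|phi (t - sg * s)|)); first by mfun.
      move=> t; rewrite normrM mulrC ler_wpM2r//; apply: (le_trans (hC t)).
      by rewrite ler_piMr// expr_le1// ?wt_ge0 ?wt_le1.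
    by apply: intgZ; exact: (intg_shift (- (sg * s)) (intg_abs (schwartz_intg sp))).
  transitivity (kappa s * Rintegral leb setT (fun t => phi (t - sg * s) * h t)).
    by rewrite -RintgZ//; apply: Rintg_ext => t; rewrite mulrA.
  congr (_ * _); rewrite -(Rintg_shift (sg * s) hi).
  by apply: Rintg_ext => t; rewrite addrK.
rewrite E1 in i1 E; rewrite (funext E2) in i2 E.
by split; [exact: i1|exact: i2|exact: E].
Qed.

Lemma kconv_gauss (w th e : R) : 0 < e ->
  intg leb (fun t => kconv sg phi t * (cos (t * w + th) * expR (- (e * t ^+ 2)))) /\
  Rintegral leb setT (fun t => kconv sg phi t * (cos (t * w + th) * expR (- (e * t ^+ 2)))) =
  Rintegral leb setT (fun u => phi u * Jreg e (sg * u) w (sg * (u * w + th))).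
Proof.
move=> e0.
(* The test function is hidden behind an equation, so that it remains a variable until the last
   computation. *)
have [h hE] : exists h : R -> R, forall t, h t = cos (t * w + th) * expR (- (e * t ^+ 2)) by eexists.
have mh : measurable_fun setT h by rewrite (funext hE); mfun.
have h1 t : `|h t| <= expR (- (e * t ^+ 2)).
  rewrite hE normrM (ger0_norm (expR_ge0 _)) -[leRHS]mul1r.
  by apply: ler_pM; rewrite ?expR_ge0 ?cos_max.
have h2 t : `|h t| <= 1 by apply: (le_trans (h1 t)); exact/gauss_le1/ltW.
rewrite (_ : (fun t => _) = (fun t => kconv sg phi t * h t)); last first.
  by apply/funext => t; rewrite hE.
(* Half the exponent, since the required square of [wt] is obtained by squaring a bound for the
   Gaussian with parameter [e / 2]. *)
have e20 : 0 < e / 2 by rewrite divr_gt0.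
have [c c0 hc] := gauss_wt e20.
have hC t : `|h t| <= c ^+ 2 * wt t ^+ 2.
  apply: (le_trans (h1 t)); rewrite -exprMn.
  rewrite (_ : - (e * t ^+ 2) = - (e / 2 * t ^+ 2) * 2%:R); last by field.
  by rewrite expRM_natr lerXn2r ?nnegrE ?expR_ge0 ?mulr_ge0 ?wt_ge0.
have [i1 _ E0] := kconv_Fubini mh hC; split; first exact: i1.
rewrite [LHS]E0.
have [c' c'0 hc'] := gauss_wt e0.
have [||||_ _ E] := @lebFubini _ (fun s u => kappa s * (phi u * h (u + sg * s)))
  (fun s => kappa s * wt s) (fun u => 2 * c' * ((1 + u ^+ 2) * `|phi u|)).
- by mfun.
- move=> s u; rewrite (normrM (kappa s)) (normrM (phi u)) (ger0_norm (k0 s)) -mulrA ler_wpM2l//.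
  have hb : `|h (u + sg * s)| <= c' * (2 * (1 + u ^+ 2) * wt s).
    apply: (le_trans (h1 _)); apply: (le_trans (hc' _)).
    by rewrite ler_wpM2l// -(wt_sign s) wtD.
  apply: (le_trans (ler_wpM2l (normr_ge0 _) hb)).
  by rewrite le_eqVlt; apply/orP; left; apply/eqP; ring.
- exact: kernel_wt_intg.
- apply: intgZ; have [D D0 hD] := schwartz_decay 2 sp.
  apply: (@intg_dom _ _ _ leb _ (fun u => D * wt u)); first by mfun.
    move=> u; rewrite normrM normr_id ger0_norm ?(ltW (wt_denom_gt0 _))//.
    apply: (le_trans (ler_wpM2l (ltW (wt_denom_gt0 _)) (hD u))).
    rewrite (_ : (1 + u ^+ 2) * (D * wt u ^+ 2) = D * wt u * ((1 + u ^+ 2) * wt u)); last by ring.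
    by rewrite /wt divff ?mulr1// gt_eqF// wt_denom_gt0.
  by apply: intgZ; exact: intg_wt.
transitivity (Rintegral leb setT (fun s => Rintegral leb setT (fun u => kappa s * (phi u * h (u + sg * s))))).
  apply: Rintg_ext => s.
  have hs : intg leb (fun u => phi u * h (u + sg * s)).
    apply: (@intg_dom _ _ _ leb _ (fun u => `|phi u|)); first by mfun.
      by move=> u; rewrite normrM; apply: ler_piMr; [exact: normr_ge0|exact: h2].
    exact: intg_abs (schwartz_intg sp).
  by rewrite (RintgZ (kappa s) hs).
rewrite E; apply: Rintg_ext => u; rewrite /Jreg -RintgZ; last exact: Jreg_intg.
apply: Rintg_ext => s; rewrite hE.
(* As the cosine is even, its argument may be multiplied by [sg]; together with [sg * sg = 1] this
   frees [s] from the sign and moves it into the centre and the phase. *)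
rewrite (_ : (u + sg * s) ^+ 2 = (sg * u + s) ^+ 2); last by case: hsg => ->; ring.
rewrite -(cos_sign ((u + sg * s) * w + th)).
rewrite (_ : sg * ((u + sg * s) * w + th) = s * w * (sg * sg) + sg * (u * w + th)); last by ring.
by rewrite sign_sqr mulr1; ring.
Qed.

Lemma Kph_sign (w th : R) :
  Kph kappa (sg * th) w = Kc kappa w * cos th - sg * Ks kappa w * sin th.
Proof. by rewrite /Kph cos_sign sin_sign; ring. Qed.

Lemma kconv_gauss_cvg (w th : R) : nonsingular kappa w ->
  Rintegral leb setT (fun t => kconv sg phi t * (cos (t * w + th) * expR (- (e * t ^+ 2))))
    @[e --> 0^'+] --> Kc kappa w * FT th phi w + sg * Ks kappa w * FT (th + pi / 2) phi w.
Proof.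
move=> gw; apply/cvg_at_rightP => v [v0 vl].
have [C hC] := Jreg_bounded gw.
have iphi := schwartz_intg sp.
have [||||_] := @RDCT _ _ _ leb (fun n u => phi u * Jreg (v n) (sg * u) w (sg * (u * w + th)))
  (fun u => phi u * Kph kappa (sg * (u * w + th)) w) (fun u => C * `|phi u|).
- move=> n; apply: measurable_funM => //.
  apply: (@measurable_lebRintg _ (fun u s => kappa s * expR (- (v n * (sg * u + s) ^+ 2)) *
    cos (s * w + sg * (u * w + th)))).
  by mfun.
- by move=> u; apply: cvgM; [exact: cvg_cst|apply: Jreg_cvg].
- by move=> n u; rewrite normrM mulrC ler_wpM2r// hC.
- by apply: intgZ; exact: intg_abs.
have -> : Rintegral leb setT (fun u => phi u * Kph kappa (sg * (u * w + th)) w) =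
   Kc kappa w * FT th phi w + sg * Ks kappa w * FT (th + pi / 2) phi w.
  rewrite /FT -!RintgZ; do ?exact: intg_cos.
  rewrite -RintgD; do ?by apply: intgZ; exact: intg_cos.
  by apply: Rintg_ext => u; rewrite Kph_sign addrA cosDpihalf; ring.
rewrite (_ : (fun n => _) = (fun n => Rintegral leb setT (fun t => kconv sg phi t *
   (cos (t * w + th) * expR (- (v n * t ^+ 2)))))) //.
by apply/funext => n; rewrite (kconv_gauss w th (v0 n)).2.
Qed.

(** [Hre] and [Him] are the real and imaginary parts of (Kc - i sg Ks) times the transform of [phi].
    For [L], where [sg = -1], the factor is the conjugate of the transform of K^+; the covariance
    sees only its modulus. *)
Definition Hre (w : R) := Kc kappa w * ft_re phi w + sg * Ks kappa w * ft_im phi w.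
Definition Him (w : R) := Kc kappa w * ft_im phi w - sg * Ks kappa w * ft_re phi w.

Lemma gauss_ft_re_cvg (c w : R) : nonsingular kappa w ->
  gauss_ft_re (fun t => c * kconv sg phi t) w @ at_right 0 --> c * Hre w.
Proof.
move=> gw; have h := kconv_gauss_cvg (th := 0) gw.
rewrite add0r -ft_reE -ft_imE in h; last exact: schwartz_intg.
apply/cvg_at_rightP => v [v0 vl]; move/cvg_at_rightP : h => /(_ v (conj v0 vl)) h.
rewrite (_ : (fun n => _) = (fun n => c * Rintegral leb setT (fun t => kconv sg phi t *
   (cos (t * w + 0) * expR (- (v n * t ^+ 2)))))); first by apply: cvgM => //; exact: cvg_cst.
apply/funext => n; rewrite -RintgZ; last by case: (kconv_gauss w 0 (v0 n)).
by apply: Rintg_ext => t; rewrite addr0; ring.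
Qed.

Lemma gauss_ft_im_cvg (c w : R) : nonsingular kappa w ->
  gauss_ft_im (fun t => c * kconv sg phi t) w @ at_right 0 --> c * Him w.
Proof.
move=> gw; have h := kconv_gauss_cvg (th := pi / 2) gw.
have ip := schwartz_intg sp.
have hH : Kc kappa w * FT (pi / 2) phi w + sg * Ks kappa w * FT (pi / 2 + pi / 2) phi w = Him w.
  rewrite /Him -ft_imE// [FT (_ + _) _ _]FT_phase//.
  by rewrite -splitr cospi sinpi; ring.
rewrite hH in h.
apply/cvg_at_rightP => v [v0 vl]; move/cvg_at_rightP : h => /(_ v (conj v0 vl)) h.
rewrite (_ : (fun n => _) = (fun n => c * Rintegral leb setT (fun t => kconv sg phi t *
   (cos (t * w + pi / 2) * expR (- (v n * t ^+ 2)))))); first by apply: cvgM => //; exact: cvg_cst.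
apply/funext => n; have [hi _] := kconv_gauss w (pi / 2) (v0 n).
rewrite /gauss_ft_im -RintgZ// -RintgN.
  by apply: Rintg_ext => t; rewrite cosDpihalf; ring.
by apply: (intg_ext _ (intgZ (- c) hi)) => t; rewrite cosDpihalf; ring.
Qed.

End GaussRegularisation.

(** * Pairing of the kernel with Fourier transforms *)

Section Tonelli.
Variable R : realType.
Local Notation leb := (@lebesgue_measure R).

(** For nonnegative [F], Tonelli's theorem takes the place of a product majorant: it suffices to
    bound the integrals of the sections in the other variable. *)
Lemma lebTonelli_intg (F : R -> R -> R) (K : R -> R) :
  measurable_fun setT (fun z : R * R => F z.1 z.2) -> (forall x y, 0 <= F x y) ->
  (forall y, intg leb (F^~ y)) -> (forall y, Rintegral leb setT (F^~ y) <= K y) ->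
  intg leb K -> intg leb (fun x => Rintegral leb setT (F x)).
Proof.
move=> mF F0 iF FK iK.
have K0 y : 0 <= K y by apply: le_trans (FK y); apply: Rintegral_ge0.
have KK := (ge0_intgP leb (intg_measurable iK) K0).1 iK.
have mR : measurable_fun setT (fun x => Rintegral leb setT (F x)).
  have h := @measurable_Rintg_curry _ _ (measurableTypeR R) (measurableTypeR R) R leb F.
  exact: h.
have mf : measurable_fun setT (fun z : R * R => (F z.1 z.2)%:E) by apply/measurable_EFinP.
have f0 (z : R * R) : (0 <= (F z.1 z.2)%:E)%E by rewrite lee_fin.
have mF1 := @measurable_fun_fubini_tonelli_F _ _ (measurableTypeR R) (measurableTypeR R) R
  leb (fun z => (F z.1 z.2)%:E) mf f0.
have mG1 := @measurable_fun_fubini_tonelli_G _ _ (measurableTypeR R) (measurableTypeR R) R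
  leb (fun z => (F z.1 z.2)%:E) mf f0.
have T1 := @fubini_tonelli _ _ (measurableTypeR R) (measurableTypeR R) R leb leb
  (fun z => (F z.1 z.2)%:E) mf f0.
apply/ge0_intgP; [exact: mR|by move=> w; apply: Rintegral_ge0|].
apply: (@le_lt_trans _ _ (\int[leb]_w \int[leb]_s (F w s)%:E)%E).
  apply: ge0_le_integral; [exact: measurableT| | |exact: mF1|].
  - by move=> w _; rewrite lee_fin; apply: Rintegral_ge0.
  - by apply/measurable_EFinP; exact: mR.
  - move=> w _; rewrite /Rintegral.
    have : (0 <= \int[leb]_s (F w s)%:E)%E by apply: integral_ge0 => s _; rewrite lee_fin.
    (* Where the inner integral is infinite, [Rintegral] is 0, and the inequality still holds. *)
    by case: (\int[leb]_s (F w s)%:E)%E => [r| |] //= _; rewrite leey.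
rewrite [X in (X < _)%E]T1; apply: le_lt_trans KK.
apply: ge0_le_integral; [exact: measurableT| |exact: mG1| |].
- by move=> s _; apply: integral_ge0 => w _; rewrite lee_fin.
- by apply/measurable_EFinP; exact: intg_measurable iK.
- by move=> s _; rewrite -(Rintg_EFin (iF s)) lee_fin.
Qed.

End Tonelli.

Section Pairing.
Variable R : realType.
Local Notation leb := (@lebesgue_measure R).
Variable kappa : R -> R.
Hypothesis kk : decreasing_kernel kappa.
Let mk := kernel_measurable kk.
Let k0 := kernel_ge0 kk.

(** Monotonicity of [kappa] on ]0, a]. With [a = 1/|w|] it turns the oscillatory bound
    [kappa a * (2 / |w|)] into twice the mass of [kappa] on [0, a]. *)
Lemma kernel_mul_le (a : R) : 0 < a ->
  a * kappa a <= Rintegral leb setT (fun s => kappa s * ((0 <= s) && (s <= a))%:R).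
Proof.
move=> a0.
have i1 := intgZ (kappa a) (@intg_itv R 0 a).
have i2 : intg leb (fun s => kappa a * ((0 < s) && (s <= a))%:R).
  apply: (@intg_dom _ _ _ leb _ _ _ _ i1); first by mfun.
  move=> s; rewrite ger0_norm ?mulr_ge0// ler_wpM2l// ler_nat.
  by case: (ltrP 0 s) => // /ltW ->.
have -> : a * kappa a = Rintegral leb setT (fun s => kappa a * ((0 < s) && (s <= a))%:R).
  rewrite -(@Rintg_off0 _ (fun s => kappa a * ((0 <= s) && (s <= a))%:R)).
  - by rewrite RintgZ ?Rintg_itv ?(ltW a0) ?subr0 1?mulrC//; exact: intg_itv.
  - by mfun.
  - by mfun.
  - by move=> s s0; rewrite [0 < s]lt0r s0.
apply: Rintg_le => //; first exact: kernel_window_intg.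
move=> s; case: (ltrP 0 s) => s0 /=; last by rewrite mulr0 mulr_ge0.
rewrite (ltW s0) /=; case: (lerP s a) => sa; last by rewrite !mulr0.
by rewrite !mulr1; apply: (kernel_decr kk).
Qed.

(* Majorises all the partial transforms at frequency [w], up to a factor 3. *)
Definition Gmaj (w : R) : R :=
  Rintegral leb setT (fun s => kappa s * ((0 <= s) && (s * `|w| <= 1))%:R).

Lemma GmajE (w : R) : w != 0 ->
  Gmaj w = Rintegral leb setT (fun s => kappa s * ((0 <= s) && (s <= `|w|^-1))%:R).
Proof.
move=> w0; apply: Rintg_ext => s.
by rewrite -[`|w|^-1]mul1r ler_pdivlMr ?normr_gt0.
Qed.

Lemma Kpart_le th w a T : T <= a ->
  `|Kpart kappa th w T| <= Rintegral leb setT (fun s => kappa s * ((0 <= s) && (s <= a))%:R).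
Proof.
move=> Ta; apply: Rintg_norm_le; [by mfun|exact: kernel_window_intg|].
move=> s; rewrite normrM [`|kappa s * _|]ger0_norm ?mulr_ge0// -[leRHS]mulr1.
apply: ler_pM; rewrite ?mulr_ge0 ?cos_max// ler_wpM2l// ler_nat.
by case: (lerP s T) => sT; [rewrite (le_trans sT Ta)|rewrite andbF].
Qed.

(** The integral is split at [1/|w|]: up to there it is bounded by the mass [Gmaj w], and beyond by
    [kappa a * 2 * a <= 2 * Gmaj w] with [a = 1/|w|]. *)
Lemma Kpart_maj th w T : w != 0 -> `|Kpart kappa th w T| <= 3 * Gmaj w.
Proof.
move=> w0; rewrite GmajE//; set a := `|w|^-1.
have a0 : 0 < a by rewrite invr_gt0 normr_gt0.
have h1 := kernel_mul_le a0; set G := Rintegral _ _ _ in h1 *.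
have G0 : 0 <= G by apply: le_trans h1; rewrite mulr_ge0// ltW.
case: (lerP T a) => Ta.
  by apply: (le_trans (Kpart_le th w Ta)); rewrite -/G; lra.
have h2 := Kpart_diff kk th (tail_bound_neq0 kk w0) a0 (ltW Ta).
have h3 := Kpart_le th w (lexx a); rewrite -/G in h3.
rewrite -/a in h2.
have -> : Kpart kappa th w T = (Kpart kappa th w T - Kpart kappa th w a) + Kpart kappa th w a by ring.
apply: (le_trans (ler_normD _ _)).
have : kappa a * (2 * a) <= 2 * G by lra.
lra.
Qed.

Lemma Kph_maj th w : w != 0 -> `|Kph kappa th w| <= 3 * Gmaj w.
Proof.
move=> w0.
have h : `|Kpart kappa th w x| @[x --> +oo] --> `|Kph kappa th w|.
  by apply: cvg_norm; exact: (Kpart_cvg kk (nonsingular_neq0 kk w0)).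
by apply: (cvgr_to_le h); apply: nearW => T; exact: Kpart_maj.
Qed.

Lemma measurable_Gmaj : measurable_fun setT Gmaj.
Proof.
apply: (@measurable_lebRintg _ (fun w s => kappa s * ((0 <= s) && (s * `|w| <= 1))%:R)).
by mfun.
Qed.

Lemma measurable_Kph th : measurable_fun setT (Kph kappa th).
Proof.
(* The indicator of [w != 0]: at 0 the partial transforms may diverge, so the pointwise limit is
   taken after multiplication by [d]. *)
pose d (w : R) : R := 1 - (w <= 0)%R%:R * (0 <= w)%R%:R.
have d1 w : w != 0 -> d w = 1.
  move=> w0; rewrite /d -natrM mulnb; have -> : (w <= 0) && (0 <= w) = false.
    by rewrite -eq_le (negbTE w0).
  by rewrite subr0.
apply: (@measurable_off0 _ _ (fun w => Kph kappa th w * d w)); last first.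
  by move=> w w0; rewrite d1// mulr1.
apply: (@measurable_fun_cvg _ _ _ _ (fun (n : nat) w => Kpart kappa th w n%:R * d w)).
- move=> n; apply: measurable_funM; last by rewrite /d; mfun.
  apply: (@measurable_lebRintg _ (fun w s => kappa s * ((0 <= s) && (s <= n%:R))%:R * cos (s * w + th))).
  by mfun.
- move=> w _; have [->|w0] := eqVneq w 0.
    rewrite /d !lexx mulr1 subrr mulr0.
    by under eq_fun do rewrite mulr0; exact: cvg_cst.
  apply: cvgM; last exact: cvg_cst.
  apply: (cvg_comp _ _ _ (Kpart_cvg kk (nonsingular_neq0 kk w0))).
  exact: cvgr_idn.
Qed.

Lemma intg_wt_trunc (s : R) : intg leb (fun w => wt w * (s * `|w| <= 1)%R%:R).
Proof.
have mw := @measurable_wt R.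
apply: (@intg_dom _ _ _ leb _ _ _ _ (@intg_wt R)); first by mfun.
move=> w; rewrite normrM normr_nat (ger0_norm (wt_ge0 w)).
by apply: ler_piMr; [exact: wt_ge0|rewrite lern1; case: (_ <= _)].
Qed.

Lemma wt_trunc_le : exists2 C : R, 0 <= C & forall s : R, 0 <= s ->
  Rintegral leb setT (fun w => wt w * (s * `|w| <= 1)%R%:R) <= C * (1 + `|s|)^-1.
Proof.
pose W := Rintegral leb setT (@wt R).
have W0 : 0 <= W by apply: Rintegral_ge0 => s _; exact: wt_ge0.
(* For [s <= 1] the integral is at most [W] and [1 + s <= 2]; for [s > 1] it is at most the length
   [2 / s] of the window, and [2 / s * (1 + s) <= 4]. *)
exists (2 * W + 4) => [|s s0]; first lra.
rewrite (ger0_norm s0) ler_pdivlMr; last lra.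
have iq := intg_wt_trunc s.
set q := Rintegral _ _ _.
have q0 : 0 <= q by apply: Rintegral_ge0 => w _; rewrite mulr_ge0 ?wt_ge0.
case: (lerP s 1) => s1.
  have qW : q <= W.
    apply: Rintg_le; [exact: iq|exact: intg_wt|].
    by move=> w; apply: ler_piMr; [exact: wt_ge0|rewrite lern1; case: (_ <= _)].
  have : q * (1 + s) <= W * 2 by apply: ler_pM; lra.
  lra.
have si0 : 0 <= s^-1 by rewrite invr_ge0.
have qW : q <= 2 / s.
  have -> : 2 / s = Rintegral leb setT (fun w => ((- s^-1 <= w) && (w <= s^-1))%:R).
    by rewrite Rintg_itv ?ge0_cp// opprK -mulr2n mulr_natl.
  apply: Rintg_le; [exact: iq|exact: intg_itv|].
  move=> w; case: (lerP (s * `|w|) 1) => sw; last by rewrite mulr0.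
  have : `|w| <= s^-1 by rewrite -[s^-1]mul1r ler_pdivlMr 1?mulrC//; lra.
  by rewrite ler_norml => ->; rewrite mulr1 wt_le1.
have h1 : q * (1 + s) <= 2 / s * (1 + s) by rewrite ler_wpM2r//; lra.
have h2 : 2 / s * (1 + s) = 2 / s + 2.
  by rewrite mulrDr mulr1 divfK// gt_eqF// (lt_trans ltr01).
have h3 : 2 / s <= 2 by rewrite ler_pdivrMr; lra.
lra.
Qed.

(** Integrating first in [w], over [|w| <= 1/s], leaves [kappa s] times a multiple of 1/(1+s); this
    is the weight assumed integrable in [kernel_intg]. *)
Lemma Gmaj_wt_intg : intg leb (fun w => wt w * Gmaj w).
Proof.
have mw := @measurable_wt R; have [C C0 hC] := wt_trunc_le.
have eF s : (fun w => wt w * (kappa s * ((0 <= s) && (s * `|w| <= 1))%:R)) =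
    (fun w => kappa s * (0 <= s)%R%:R * (wt w * (s * `|w| <= 1)%R%:R)).
  by apply/funext => w; rewrite -mulnb natrM; ring.
have h : intg leb (fun w => Rintegral leb setT
    (fun s => wt w * (kappa s * ((0 <= s) && (s * `|w| <= 1))%:R))).
  apply: (lebTonelli_intg (K := fun s => C * (kappa s * (1 + `|s|)^-1))).
  - by mfun.
  - by move=> w s; rewrite !mulr_ge0 ?wt_ge0.
  - by move=> s; rewrite eF; apply: intgZ; exact: intg_wt_trunc.
  - move=> s; rewrite eF RintgZ; last exact: intg_wt_trunc.
    rewrite [leRHS]mulrCA -mulrA ler_wpM2l//; case: (lerP 0 s) => s0.
      by rewrite mul1r hC.
    by rewrite mul0r mulr_ge0// invr_ge0 addr_ge0.
  - by apply: intgZ; exact: (kernel_intg kk).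
apply: (intg_ext _ h) => w; have [->|w0] := eqVneq w 0.
  by rewrite /wt expr0n addr0 invr1 mul1r; apply: Rintg_ext => s; rewrite mul1r.
rewrite RintgZ//.
apply: (intg_ext _ (kernel_window_intg kk `|w|^-1)) => s.
by rewrite -[`|w|^-1]mul1r ler_pdivlMr ?normr_gt0.
Qed.

Lemma intg_Kph_dom (h : R -> R) (C th : R) : measurable_fun setT h ->
  (forall w, `|h w| <= C * wt w) -> intg leb (fun w => h w * Kph kappa th w).
Proof.
move=> mh hC; have mK := measurable_Kph th; have mG := measurable_Gmaj.
have mw := @measurable_wt R.
(* Dominated convergence for a constant sequence gives integrability from a majorant that holds only
   off 0. *)
have [|||||i _] := @RDCT_ae _ _ _ leb (fun=> fun w => h w * Kph kappa th w)
  (fun w => h w * Kph kappa th w) (fun w => C * 3 * (wt w * Gmaj w)); last exact: i.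
- by move=> _; mfun.
- by mfun.
- by apply: aeW => w; exact: cvg_cst.
- apply: ae_off0 => w w0 _; rewrite normrM.
  apply: (le_trans (ler_pM (normr_ge0 _) (normr_ge0 _) (hC w) (Kph_maj th w0))).
  by rewrite le_eqVlt; apply/orP; left; apply/eqP; ring.
- by apply: intgZ; exact: Gmaj_wt_intg.
Qed.

(** Fubini is available only after truncating [s] at [n]. The limit is then taken on both sides,
    with majorant [|Phi|] on the left and a multiple of [wt w * Gmaj w] on the right. Two phases are
    treated together because integrability is given only for their sum. *)
Lemma Kph_pairing (h1 h2 : R -> R) (C th th' : R) :
  measurable_fun setT h1 -> measurable_fun setT h2 ->
  (forall w, `|h1 w| <= C * wt w) -> (forall w, `|h2 w| <= C * wt w) ->
  intg leb (fun s => kappa s * Rintegral leb setT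
    (fun w => h1 w * cos (s * w + th) + h2 w * cos (s * w + th'))) ->
  Rintegral leb setT (fun s => kappa s * Rintegral leb setT
    (fun w => h1 w * cos (s * w + th) + h2 w * cos (s * w + th'))) =
  Rintegral leb setT (fun w => h1 w * Kph kappa th w + h2 w * Kph kappa th' w).
Proof.
move=> mh1 mh2 hC1 hC2.
have mK := measurable_Kph th; have mK' := measurable_Kph th'.
have mG := measurable_Gmaj; have mw := @measurable_wt R.
set Phi := fun s => kappa s * _ => iP.
have mP := intg_measurable iP.
have [||||_ l1] := @RDCT _ _ _ leb (fun n s => Phi s * (s <= n%:R)%R%:R) Phi (fun s => `|Phi s|).
- by move=> n; mfun.
- move=> s; apply: cvg_near_cst; near=> n.
  have -> : s <= n%:R by near: n; exact: nbhs_infty_ger.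
  by rewrite mulr1.
- by move=> n s; rewrite normrM ler_piMr// normr_nat lern1; case: (_ <= _).
- exact: intg_abs.
have EE (n : nat) : Rintegral leb setT (fun s => Phi s * (s <= n%:R)%R%:R) =
   Rintegral leb setT (fun w => h1 w * Kpart kappa th w n%:R + h2 w * Kpart kappa th' w n%:R).
  have i1 : intg leb h1.
    by apply: (@intg_dom _ _ _ leb _ _ mh1 hC1); apply: intgZ; exact: intg_wt.
  have i2 : intg leb h2.
    by apply: (@intg_dom _ _ _ leb _ _ mh2 hC2); apply: intgZ; exact: intg_wt.
  have [||||_ _ E] := @lebFubini _ (fun s w => kappa s * ((0 <= s) && (s <= n%:R))%:R *
      (h1 w * cos (s * w + th) + h2 w * cos (s * w + th')))
     (fun s => kappa s * ((0 <= s) && (s <= n%:R))%:R) (fun w => `|h1 w| + `|h2 w|).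
  - by mfun.
  - move=> s w; rewrite normrM [`|kappa s * _|]ger0_norm ?mulr_ge0// ler_wpM2l ?mulr_ge0//.
    apply: (le_trans (ler_normD _ _)); rewrite !normrM.
    by apply: lerD; apply: ler_piMr; rewrite ?normr_ge0 ?cos_max.
  - exact: kernel_window_intg.
  - by apply: intgD; exact: intg_abs.
  have ci s : intg leb (fun w => h1 w * cos (s * w + th) + h2 w * cos (s * w + th')).
    apply: intgD.
      by apply: (intg_ext _ (intg_cos s th i1)) => w; rewrite (mulrC s).
    by apply: (intg_ext _ (intg_cos s th' i2)) => w; rewrite (mulrC s).
  rewrite (@Rintg_ext _ _ _ leb _ (fun s => Rintegral leb setT (fun w =>
     kappa s * ((0 <= s) && (s <= n%:R))%:R * (h1 w * cos (s * w + th) + h2 w * cos (s * w + th'))))); last first.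
    move=> s; rewrite RintgZ; last exact: ci.
    rewrite /Phi; case: (lerP 0 s) => s0; first by rewrite mulrAC.
    by rewrite (kernel_le0 kk (ltW s0)) !mul0r.
  rewrite E; apply: Rintg_ext => w; rewrite /Kpart -!RintgZ; try exact: intg_cos (kernel_window_intg kk _).
  rewrite -RintgD; try by apply: intgZ; exact: intg_cos (kernel_window_intg kk _).
  by apply: Rintg_ext => s; ring.
rewrite (funext EE) in l1.
have [|||||_ l2] := @RDCT_ae _ _ _ leb
  (fun n w => h1 w * Kpart kappa th w n%:R + h2 w * Kpart kappa th' w n%:R)
  (fun w => h1 w * Kph kappa th w + h2 w * Kph kappa th' w)
  (fun w => C * 6 * (wt w * Gmaj w)); last exact: (cvg_unique _ l1 l2).
- move=> n.
  have mKp x : measurable_fun setT (fun w => Kpart kappa x w n%:R).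
    apply: (@measurable_lebRintg _ (fun w s => kappa s * ((0 <= s) && (s <= n%:R))%:R * cos (s * w + x))).
    by mfun.
  by have := mKp th; have := mKp th' => ? ?; mfun.
- by mfun.
- apply: ae_off0 => w w0; apply: cvgD; apply: cvgM; try exact: cvg_cst.
    by apply: (cvg_comp _ _ _ (Kpart_cvg kk (nonsingular_neq0 kk w0))); exact: cvgr_idn.
  by apply: (cvg_comp _ _ _ (Kpart_cvg kk (nonsingular_neq0 kk w0))); exact: cvgr_idn.
- apply: ae_off0 => w w0 n; apply: (le_trans (ler_normD _ _)); rewrite !normrM.
  apply: (le_trans (lerD (ler_pM (normr_ge0 _) (normr_ge0 _) (hC1 w) (Kpart_maj th n%:R w0))
    (ler_pM (normr_ge0 _) (normr_ge0 _) (hC2 w) (Kpart_maj th' n%:R w0)))).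
  by rewrite le_eqVlt; apply/orP; left; apply/eqP; ring.
- by apply: intgZ; exact: Gmaj_wt_intg.
Unshelve. all: by end_near. Qed.

End Pairing.

(** * Distributional transform and Parseval's formula *)

Section KernelFourier.
Variable R : realType.
Local Notation leb := (@lebesgue_measure R).
Variable kappa : R -> R.
Hypothesis kk : decreasing_kernel kappa.
Let mk := kernel_measurable kk.
Let k0 := kernel_ge0 kk.

Lemma Kph0 w : Kph kappa 0 w = Kc kappa w.
Proof. by rewrite /Kph cos0 sin0 mul1r mul0r subr0. Qed.

Lemma KphNpihalf w : Kph kappa (- (pi / 2)) w = Ks kappa w.
Proof. by rewrite /Kph cosN sinN cos_pihalf sin_pihalf mul0r mulN1r opprK add0r. Qed.

Lemma measurable_Kc : measurable_fun setT (Kc kappa).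
Proof. by rewrite -(funext Kph0); exact: measurable_Kph. Qed.

Lemma measurable_Ks : measurable_fun setT (Ks kappa).
Proof. by rewrite -(funext KphNpihalf); exact: measurable_Kph. Qed.

Section OneFunction.
Variables (sg : R) (phi : R -> R).
Hypothesis hsg : sg = 1 \/ sg = -1.
Hypothesis sp : schwartz phi.
Let mphi := schwartz_measurable sp.
Let iphi := schwartz_intg sp.

(** Integrating out the argument [u] of [phi] writes the factor of [kappa s] as a combination of
    cosine integrals in [w], with densities [psi] times the two parts of the transform of [phi];
    [Kph_pairing] then integrates in [s]. *)
Lemma kconv_FT_pairing psi th : schwartz psi ->
  intg leb (fun t => kconv kappa sg phi t * FT th psi t) /\
  Rintegral leb setT (fun t => kconv kappa sg phi t * FT th psi t) =
  Rintegral leb setT (fun w => psi w * ft_re phi w * Kph kappa (sg * th) w +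
     sg * (psi w * ft_im phi w) * Kph kappa (sg * th - pi / 2) w).
Proof.
move=> spsi; have mpsi := schwartz_measurable spsi; have ipsi := schwartz_intg spsi.
have mre := measurable_ft_re mphi; have mim := measurable_ft_im iphi.
have [C C0 hC] := FT_decay 2 spsi.
have [i1 i2 E] := kconv_Fubini kk hsg sp (measurable_FT th mpsi) (hC th).
split; first exact: i1.
rewrite [LHS]E => {E i1}.
have EP s : Rintegral leb setT (fun u => phi u * FT th psi (u + sg * s)) =
    Rintegral leb setT (fun w => psi w * ft_re phi w * cos (s * w + sg * th) +
       sg * (psi w * ft_im phi w) * cos (s * w + (sg * th - pi / 2))).
  have [||||_ _ E2] := @lebFubini _ (fun u w => phi u * (psi w * cos (w * (u + sg * s) + th)))
    (fun u => `|phi u|) (fun w => `|psi w|).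
  - by mfun.
  - move=> u w; rewrite !normrM; apply: ler_wpM2l; first exact: normr_ge0.
    by apply: ler_piMr; [exact: normr_ge0|exact: cos_max].
  - exact: intg_abs.
  - exact: intg_abs.
  transitivity (Rintegral leb setT (fun u => Rintegral leb setT
      (fun w => phi u * (psi w * cos (w * (u + sg * s) + th))))).
    by apply: Rintg_ext => u; rewrite RintgZ; [|exact: intg_cos].
  rewrite E2 => {E2}; apply: Rintg_ext => w.
  have -> : Rintegral leb setT (fun u => phi u * (psi w * cos (w * (u + sg * s) + th))) =
     psi w * FT (sg * (s * w + sg * th)) phi w.
    rewrite /FT -RintgZ; last exact: intg_cos.
    apply: Rintg_ext => u.
    rewrite (_ : u * w + sg * (s * w + sg * th) = w * (u + sg * s) + sg * sg * th); last by ring.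
    by rewrite (sign_sqr hsg) mul1r; ring.
  rewrite (FT_phase _ _ iphi) (cos_sign hsg) (sin_sign hsg) addrA cosBpihalf; ring.
have [D D0 hD] := schwartz_decay 1 spsi.
have [C' C'0 hC'] := FT_bounded iphi.
have EP' s := congr1 (fun y => kappa s * y) (EP s).
rewrite (funext EP') in i2 *.
have hb1 w : `|psi w * ft_re phi w| <= D * C' * wt w.
  rewrite normrM mulrAC; apply: ler_pM; rewrite ?normr_ge0//.
  by rewrite ft_reE.
have hb2 w : `|sg * (psi w * ft_im phi w)| <= D * C' * wt w.
  rewrite normrM (_ : `|sg| = 1); last by case: hsg => ->; rewrite ?normrN normr1.
  rewrite mul1r normrM mulrAC; apply: ler_pM; rewrite ?normr_ge0//.
  by rewrite ft_imE.
by apply: (Kph_pairing kk _ _ hb1 hb2 i2); mfun.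
Qed.

Lemma kconv_ft_re psi : schwartz psi ->
  intg leb (fun t => kconv kappa sg phi t * ft_re psi t) /\
  Rintegral leb setT (fun t => kconv kappa sg phi t * ft_re psi t) =
  Rintegral leb setT (fun w => Hre kappa sg phi w * psi w).
Proof.
move=> spsi; have [i E] := kconv_FT_pairing 0 spsi.
rewrite (_ : ft_re psi = FT 0 psi); last by apply/funext => w; rewrite ft_reE.
split; first exact: i.
rewrite [LHS]E; apply: Rintg_ext => w.
by rewrite mulr0 sub0r Kph0 KphNpihalf /Hre; ring.
Qed.

Lemma kconv_ft_im psi : schwartz psi ->
  intg leb (fun t => kconv kappa sg phi t * ft_im psi t) /\
  Rintegral leb setT (fun t => kconv kappa sg phi t * ft_im psi t) =
  Rintegral leb setT (fun w => Him kappa sg phi w * psi w).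
Proof.
move=> spsi; have [i E] := kconv_FT_pairing (pi / 2) spsi.
rewrite (_ : ft_im psi = FT (pi / 2) psi); last first.
  by apply/funext => w; rewrite ft_imE//; exact: schwartz_intg.
split; first exact: i.
rewrite [LHS]E; apply: Rintg_ext => w; rewrite /Him /Kph.
rewrite cosBpihalf sinBpihalf (cos_sign hsg) (sin_sign hsg) cos_pihalf sin_pihalf.
transitivity (sg * sg * (psi w * ft_im phi w * Kc kappa w) - sg * (psi w * ft_re phi w * Ks kappa w)).
  by ring.
by rewrite (sign_sqr hsg); ring.
Qed.

Lemma measurable_Hre : measurable_fun setT (Hre kappa sg phi).
Proof.
have ? := measurable_Kc; have ? := measurable_Ks.
have ? := measurable_ft_re mphi; have ? := measurable_ft_im iphi.
by rewrite /Hre; mfun.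
Qed.

Lemma measurable_Him : measurable_fun setT (Him kappa sg phi).
Proof.
have ? := measurable_Kc; have ? := measurable_Ks.
have ? := measurable_ft_re mphi; have ? := measurable_ft_im iphi.
by rewrite /Him; mfun.
Qed.

Lemma FT_Kph_intg psi th x : schwartz psi -> intg leb (fun w => FT th phi w * Kph kappa x w * psi w).
Proof.
move=> spsi; have [C C0 hC] := FT_bounded iphi; have [D D0 hD] := schwartz_decay 1 spsi.
have mpsi := schwartz_measurable spsi; have mF := measurable_FT th mphi.
have h : intg leb (fun w => (FT th phi w * psi w) * Kph kappa x w).
  apply: (intg_Kph_dom kk (C := C * D)); first by mfun.
  by move=> w; rewrite normrM -mulrA; apply: ler_pM; rewrite ?normr_ge0//.
by apply: (intg_ext _ h) => w; rewrite mulrAC.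
Qed.

Lemma Hre_intg psi : schwartz psi -> intg leb (fun w => Hre kappa sg phi w * psi w).
Proof.
move=> spsi; have h1 := FT_Kph_intg 0 0 spsi; have h2 := FT_Kph_intg (pi / 2) (- (pi / 2)) spsi.
apply: (intg_ext _ (intgD h1 (intgZ sg h2))) => w.
by rewrite Kph0 KphNpihalf -ft_reE -ft_imE// /Hre; ring.
Qed.

Lemma Him_intg psi : schwartz psi -> intg leb (fun w => Him kappa sg phi w * psi w).
Proof.
move=> spsi; have h1 := FT_Kph_intg (pi / 2) 0 spsi; have h2 := FT_Kph_intg 0 (- (pi / 2)) spsi.
apply: (intg_ext _ (intgB h1 (intgZ sg h2))) => w.
by rewrite Kph0 KphNpihalf -ft_reE -ft_imE// /Him; ring.
Qed.

Lemma Fre_kconv c w : nonsingular kappa w -> Fre (fun t => c * kconv kappa sg phi t) w = c * Hre kappa sg phi w.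
Proof. by move=> gw; apply/cvg_lim => //; exact: gauss_ft_re_cvg. Qed.

Lemma Fim_kconv c w : nonsingular kappa w -> Fim (fun t => c * kconv kappa sg phi t) w = c * Him kappa sg phi w.
Proof. by move=> gw; apply/cvg_lim => //; exact: gauss_ft_im_cvg. Qed.

Lemma measurable_Fre_kconv c : measurable_fun setT (Fre (fun t => c * kconv kappa sg phi t)).
Proof.
have mH := measurable_Hre.
apply: (@measurable_off0 _ _ (fun w => c * Hre kappa sg phi w)); first by mfun.
by move=> w w0; apply: Fre_kconv; exact: nonsingular_neq0.
Qed.

Lemma measurable_Fim_kconv c : measurable_fun setT (Fim (fun t => c * kconv kappa sg phi t)).
Proof.
have mH := measurable_Him.
apply: (@measurable_off0 _ _ (fun w => c * Him kappa sg phi w)); first by mfun.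
by move=> w w0; apply: Fim_kconv; exact: nonsingular_neq0.
Qed.

Lemma intg_off0 (f g : R -> R) : measurable_fun setT g -> intg leb f ->
  (forall w, w != 0 -> g w = f w) -> intg leb g.
Proof.
move=> mg fi fg; have mf := intg_measurable fi.
have [|||||i _] := @RDCT_ae _ _ _ leb (fun=> g) g (fun x => `|f x|); last exact: i.
- by move=> _.
- by [].
- by apply: aeW => w; exact: cvg_cst.
- by apply: ae_off0 => w w0 _; rewrite fg.
- exact: intg_abs.
Qed.

Lemma fourier_is_kconv c :
  fourier_is (fun t => c * kconv kappa sg phi t)
    (Fre (fun t => c * kconv kappa sg phi t)) (Fim (fun t => c * kconv kappa sg phi t)).
Proof.
have mFr := measurable_Fre_kconv c; have mFi := measurable_Fim_kconv c.
move=> psi spsi; have mpsi := schwartz_measurable spsi.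
have [ir Er] := kconv_ft_re spsi; have [ii Ei] := kconv_ft_im spsi.
have jr := Hre_intg spsi; have ji := Him_intg spsi.
have e1 w : w != 0 -> Fre (fun t => c * kconv kappa sg phi t) w * psi w = c * (Hre kappa sg phi w * psi w).
  by move=> w0; rewrite Fre_kconv ?mulrA//; exact: nonsingular_neq0.
have e2 w : w != 0 -> Fim (fun t => c * kconv kappa sg phi t) w * psi w = c * (Him kappa sg phi w * psi w).
  by move=> w0; rewrite Fim_kconv ?mulrA//; exact: nonsingular_neq0.
split.
  split.
  - by apply: (intg_ext _ (intgZ c ir)) => w; rewrite mulrA.
  - by apply: (intg_ext _ (intgZ c ii)) => w; rewrite mulrA.
  - by apply: (intg_off0 _ (intgZ c jr) e1); mfun.
  - by apply: (intg_off0 _ (intgZ c ji) e2); mfun.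
split.
- rewrite (@Rintg_off0 _ _ _ _ _ e1); [|by mfun|exact: intg_measurable (intgZ c jr)].
  rewrite (RintgZ c jr) -Er -(RintgZ c ir).
  by apply: Rintg_ext => w; rewrite mulrA.
- rewrite (@Rintg_off0 _ _ _ _ _ e2); [|by mfun|exact: intg_measurable (intgZ c ji)].
  rewrite (RintgZ c ji) -Ei -(RintgZ c ii).
  by apply: Rintg_ext => w; rewrite mulrA.
Qed.

Lemma Hre_Him_sqr w : Hre kappa sg phi w ^+ 2 + Him kappa sg phi w ^+ 2 =
  (Kc kappa w ^+ 2 + Ks kappa w ^+ 2) * (ft_re phi w ^+ 2 + ft_im phi w ^+ 2).
Proof.
rewrite /Hre /Him; move: (sign_sqr hsg) => s2.
transitivity (Kc kappa w ^+ 2 * (ft_re phi w ^+ 2 + ft_im phi w ^+ 2)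
  + sg * sg * Ks kappa w ^+ 2 * (ft_re phi w ^+ 2 + ft_im phi w ^+ 2)); first by ring.
by rewrite s2; ring.
Qed.

Lemma inDom_kconv (nu : {measure set R -> \bar R}) c :
  {ae nu, forall w, nonsingular kappa w} ->
  (\int[nu]_w ((c ^+ 2 * ((Kc kappa w ^+ 2 + Ks kappa w ^+ 2) *
     (ft_re phi w ^+ 2 + ft_im phi w ^+ 2)))%:E) < +oo)%E ->
  inDom nu (fun t => c * kconv kappa sg phi t).
Proof.
move=> good hfin.
have mFr := measurable_Fre_kconv c; have mFi := measurable_Fim_kconv c.
have ? := measurable_Kc; have ? := measurable_Ks.
have ? := measurable_ft_re mphi; have ? := measurable_ft_im iphi.
split.
- apply: filterS good => w gw; split; apply/cvg_ex.
    by exists (c * Hre kappa sg phi w); exact: gauss_ft_re_cvg.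
  by exists (c * Him kappa sg phi w); exact: gauss_ft_im_cvg.
- exact: fourier_is_kconv.
- exact: mFr.
- exact: mFi.
- apply: le_lt_trans hfin; rewrite le_eqVlt; apply/orP; left; apply/eqP.
  apply: ae_eq_integral => //.
  + by apply/measurable_EFinP; mfun.
  + by apply/measurable_EFinP; mfun.
  + apply: filterS good => w gw _.
    by rewrite Fre_kconv// Fim_kconv// !exprMn -mulrDr Hre_Him_sqr.
Qed.

End OneFunction.

(** * Parseval's formula for the covariance of the noise *)

Section Parseval.
Implicit Types phi psi : R -> R.

Lemma schwartz_lipschitz psi : schwartz psi ->
  exists L, forall x y, `|psi (x + y) - psi y| <= L * `|x|.
Proof.
move=> sp; have [C C0 hC] := schwartz_decay 0 (schwartz_derive sp).
exists C => x y.
have key (a b : R) : a < b -> `|psi b - psi a| <= C * (b - a).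
  move=> ab.
  have [||c _ ->] := @MVT R psi (derive1 psi) a b ab.
  - by move=> z _; exact: schwartz_is_derive.
  - exact: (continuous_subspaceT (schwartz_continuous sp)).
  rewrite normrM [`|b - a|]gtr0_norm ?subr_gt0// ler_wpM2r ?subr_ge0 ?(ltW ab)//.
  by have := hC c; rewrite expr0 mulr1.
have [x0|x0|->] := ltrgtP x 0.
- rewrite distrC (ltr0_norm x0); apply: (le_trans (key _ _ _)); first lra.
  by rewrite le_eqVlt; apply/orP; left; apply/eqP; ring.
- rewrite (gtr0_norm x0); apply: (le_trans (key _ _ _)); first lra.
  by rewrite le_eqVlt; apply/orP; left; apply/eqP; ring.
- by rewrite add0r subrr !normr0 mulr0.
Qed.

(** Inversion at 0 for the translate of [psi] by [y], whose transform has the integrand as its real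
    part. *)
Lemma Fourier_inversion psi y : schwartz psi ->
  Rintegral leb setT (fun w => cos (y * w) * ft_re psi w - sin (y * w) * ft_im psi w) =
  2 * pi * psi y.
Proof.
move=> sp; have ip := schwartz_intg sp; have mp := schwartz_measurable sp.
have E w : ft_re (fun t => psi (t + y)) w = cos (y * w) * ft_re psi w - sin (y * w) * ft_im psi w.
  have -> : cos (y * w) * ft_re psi w - sin (y * w) * ft_im psi w = FT (- (y * w)) psi w.
    by rewrite FT_phase// cosN sinN mulNr.
  rewrite /FT -(Rintg_shift y (intg_cos w (- (y * w)) ip)).
  by apply: Rintg_ext => t; congr (_ * cos _); ring.
have [L hL] := schwartz_lipschitz sp; have [C C0 hC] := schwartz_decay 0 sp.
rewrite -(funext E) (@Fourier_inversion0 R (fun t => psi (t + y)) L (C + C)).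
- by rewrite add0r.
- exact: intg_shift.
- rewrite (funext E).
  have h1 := FT_intg 0 sp; have h2 := FT_intg (pi / 2) sp.
  apply: (@intg_dom _ _ _ leb _ _ _ _ (intgD (intg_abs h1) (intg_abs h2))).
    have ? := measurable_ft_re mp; have ? := measurable_ft_im ip; by mfun.
  move=> w; rewrite -ft_reE -ft_imE//; apply: (le_trans (ler_normB _ _)); rewrite !normrM.
  by apply: lerD; apply: ler_piMl; rewrite ?normr_ge0 ?cos_max ?sin_max.
- by move=> t; rewrite add0r; exact: hL.
- move=> t; apply: (le_trans (ler_normB _ _)); apply: lerD.
    by have := hC (t + y); rewrite expr0 mulr1.
  by have := hC (0 + y); rewrite expr0 mulr1.
Qed.

Variables (phi psi : R -> R).
Hypothesis sphi : schwartz phi.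
Hypothesis spsi : schwartz psi.

(** [cross_re + i cross_im] is the conjugate of the transform of [phi] times the transform of [psi];
    the conjugate falls on the first factor, as in the definition of [V]. *)
Definition cross_re w := ft_re phi w * ft_re psi w + ft_im phi w * ft_im psi w.
Definition cross_im w := ft_re phi w * ft_im psi w - ft_im phi w * ft_re psi w.

(** Fourier inversion is inserted for [psi (u - s)], and the integral in [u] then produces the
    transform of [phi]. *)
Lemma conv_reflE s : 2 * pi * conv_refl phi psi s =
  Rintegral leb setT (fun w => cross_re w * cos (s * w) + cross_im w * sin (s * w)).
Proof.
have ip := schwartz_intg sphi; have iq := schwartz_intg spsi.
have mp := schwartz_measurable sphi; have mq := schwartz_measurable spsi.
have mqr := measurable_ft_re mq; have mqi := measurable_ft_im iq.
have [C C0 hC] := FT_decay 1 spsi.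
have [||||_ _ E] := @lebFubini _ (fun u w => phi u *
   (cos ((u - s) * w) * ft_re psi w - sin ((u - s) * w) * ft_im psi w))
  (fun u => `|phi u|) (fun w => 2 * C * wt w).
- by mfun.
- move=> u w; rewrite normrM ler_wpM2l//; apply: (le_trans (ler_normB _ _)); rewrite !normrM.
  rewrite (_ : 2 * C * wt w = C * wt w + C * wt w); last by ring.
  have h0 := hC 0 w; have h1 := hC (pi / 2) w; rewrite expr1 in h0 h1.
  rewrite -ft_reE in h0; rewrite -ft_imE// in h1.
  apply: lerD; rewrite -[leRHS]mul1r; apply: ler_pM; rewrite ?normr_ge0 ?cos_max ?sin_max//.
- exact: intg_abs.
- by apply: intgZ; exact: intg_wt.
transitivity (Rintegral leb setT (fun u => Rintegral leb setT (fun w => phi u *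
   (cos ((u - s) * w) * ft_re psi w - sin ((u - s) * w) * ft_im psi w)))).
  clear E.
  have inv u : Rintegral leb setT (fun w => phi u * (cos ((u - s) * w) * ft_re psi w -
      sin ((u - s) * w) * ft_im psi w)) = phi u * (2 * pi * psi (u - s)).
    rewrite -(Fourier_inversion (u - s) spsi) RintgZ //.
    have h1 := FT_intg 0 spsi; have h2 := FT_intg (pi / 2) spsi.
    apply: (@intg_dom _ _ _ leb _ _ _ _ (intgD (intg_abs h1) (intg_abs h2))); first by mfun.
    move=> w; rewrite -ft_reE -(ft_imE _ iq); apply: (le_trans (ler_normB _ _)); rewrite !normrM.
    by apply: lerD; apply: ler_piMl; rewrite ?normr_ge0 ?cos_max ?sin_max.
  have [D D0 hD] := schwartz_decay 0 spsi.
  have ic : intg leb (fun u => phi u * psi (u - s)).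
    apply: (@intg_dom _ _ _ leb _ _ _ _ (intgZ D (intg_abs ip))); first by mfun.
    move=> u; rewrite normrM mulrC; apply: ler_wpM2r; first exact: normr_ge0.
    by have := hD (u - s); rewrite expr0 mulr1.
  rewrite /conv_refl -(RintgZ _ ic); apply: Rintg_ext => u; rewrite inv; ring.
rewrite E => {E}; apply: Rintg_ext => w.
have hs x : intg leb (fun u => phi u * cos (u * w + x)) by exact: intg_cos.
transitivity (ft_re psi w * FT (- (s * w)) phi w + ft_im psi w * FT (pi / 2 - s * w) phi w).
  rewrite /FT -(RintgZ _ (hs _)) -(RintgZ _ (hs _)) -(RintgD (intgZ _ (hs _)) (intgZ _ (hs _))).
  apply: Rintg_ext => u.
  rewrite (_ : (u - s) * w = u * w - s * w); last by ring.
  rewrite (_ : u * w + (pi / 2 - s * w) = u * w - s * w + pi / 2); last by ring.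
  by rewrite cosDpihalf; ring.
rewrite !FT_phase// cosN sinN cosB sinB cos_pihalf sin_pihalf /cross_re /cross_im; ring.
Qed.

Lemma conv_refl_decay : exists2 C, 0 <= C & forall s, `|conv_refl phi psi s| <= C * wt s.
Proof.
have [C C0 hC] := schwartz_decay 1 spsi; have [D D0 hD] := schwartz_decay 2 sphi.
have mp := schwartz_measurable sphi; have mq := schwartz_measurable spsi.
have W0 : 0 <= Rintegral leb setT (@wt R) by apply: Rintegral_ge0 => s _; exact: wt_ge0.
exists (2 * C * D * Rintegral leb setT (@wt R)); first by rewrite !mulr_ge0.
move=> s; rewrite mulrAC -RintgZ; last exact: intg_wt.
apply: Rintg_norm_le; [by mfun|by apply: intgZ; exact: intg_wt|].
move=> u; rewrite normrM.
apply: (le_trans (ler_pM (normr_ge0 _) (normr_ge0 _) (hD u) (hC (u - s)))).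
rewrite expr1; have := wtD u (- s); rewrite wtN => h.
have h2 : C * wt (u - s) <= C * (2 * (1 + u ^+ 2) * wt s) by rewrite ler_wpM2l.
apply: (le_trans (ler_wpM2l _ h2)); first by rewrite mulr_ge0 ?exprn_ge0 ?wt_ge0.
rewrite (_ : D * wt u ^+ 2 * (C * (2 * (1 + u ^+ 2) * wt s)) =
  2 * C * D * wt s * wt u * ((1 + u ^+ 2) * wt u)); last by ring.
by rewrite [(1 + u ^+ 2) * _]divff ?mulr1// gt_eqF// wt_denom_gt0.
Qed.

Lemma measurable_conv_refl : measurable_fun setT (conv_refl phi psi).
Proof.
have mp := schwartz_measurable sphi; have mq := schwartz_measurable spsi.
by apply: (@measurable_lebRintg _ (fun s u => phi u * psi (u - s))); mfun.
Qed.

Lemma kernel_conv_intg : intg leb (fun s => kappa s * conv_refl phi psi s) /\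
  intg leb (fun s => kappa s * conv_refl phi psi (- s)).
Proof.
have mc := measurable_conv_refl; have [C C0 hC] := conv_refl_decay.
split; apply: (@intg_dom _ _ _ leb _ _ _ _ (intgZ C (kernel_wt_intg kk))); try by mfun.
  by move=> s; rewrite normrM (ger0_norm (k0 s)) mulrCA ler_wpM2l.
by move=> s; rewrite normrM (ger0_norm (k0 s)) mulrCA ler_wpM2l// -wtN.
Qed.

Lemma measurable_cross_re : measurable_fun setT cross_re.
Proof.
have ? := measurable_ft_re (schwartz_measurable sphi).
have ? := measurable_ft_im (schwartz_intg sphi).
have ? := measurable_ft_re (schwartz_measurable spsi).
have ? := measurable_ft_im (schwartz_intg spsi).
by rewrite /cross_re; mfun.
Qed.

Lemma measurable_cross_im : measurable_fun setT cross_im.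
Proof.
have ? := measurable_ft_re (schwartz_measurable sphi).
have ? := measurable_ft_im (schwartz_intg sphi).
have ? := measurable_ft_re (schwartz_measurable spsi).
have ? := measurable_ft_im (schwartz_intg spsi).
by rewrite /cross_im; mfun.
Qed.

Lemma cross_decay : exists2 C, 0 <= C & forall w, `|cross_re w| <= C * wt w /\ `|cross_im w| <= C * wt w.
Proof.
have [C C0 hC] := FT_decay 1 spsi; have [D D0 hD] := FT_bounded (schwartz_intg sphi).
exists (2 * D * C) => [|w]; first by rewrite !mulr_ge0.
have h0 := hC 0 w; have h1 := hC (pi / 2) w; rewrite expr1 in h0 h1.
rewrite -ft_reE in h0; rewrite -(ft_imE _ (schwartz_intg spsi)) in h1.
have d0 := hD 0 w; have d1 := hD (pi / 2) w.
rewrite -ft_reE in d0; rewrite -(ft_imE _ (schwartz_intg sphi)) in d1.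
rewrite (_ : 2 * D * C * wt w = D * (C * wt w) + D * (C * wt w)); last by ring.
split.
  by apply: (le_trans (ler_normD _ _)); rewrite !normrM; apply: lerD; apply: ler_pM.
by apply: (le_trans (ler_normB _ _)); rewrite !normrM; apply: lerD; apply: ler_pM.
Qed.

Lemma Kc_cross_intg : intg leb (fun w => cross_re w * Kc kappa w) /\
  intg leb (fun w => cross_im w * Kc kappa w).
Proof.
have [C C0 hC] := cross_decay; split.
  apply: (intg_ext _ (intg_Kph_dom kk 0 measurable_cross_re (fun w => (hC w).1))) => w.
  by rewrite Kph0.
apply: (intg_ext _ (intg_Kph_dom kk 0 measurable_cross_im (fun w => (hC w).2))) => w.
by rewrite Kph0.
Qed.

(** Symmetrising in [s] removes the sine terms and doubles the cosine terms; the factor [pi^-1] is 2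
    divided by the 2 pi of the inversion formula. *)
Lemma kernel_Parseval :
  Rintegral leb setT (fun s => kappa s * (conv_refl phi psi s + conv_refl phi psi (- s))) =
  Rintegral leb setT (fun w => pi^-1 * (cross_re w * Kc kappa w)).
Proof.
have pi0 : (pi : R) != 0 by rewrite gt_eqF// pi_gt0.
have [C C0 hC] := cross_decay; have mcr := measurable_cross_re; have mci := measurable_cross_im.
have icr : intg leb cross_re.
  by apply: (@intg_dom _ _ _ leb _ _ mcr (fun w => (hC w).1)); apply: intgZ; exact: intg_wt.
have ici : intg leb cross_im.
  by apply: (@intg_dom _ _ _ leb _ _ mci (fun w => (hC w).2)); apply: intgZ; exact: intg_wt.
have ics f (s : R) : intg leb f -> intg leb (fun w => f w * cos (s * w)).
  move=> fi; apply: (intg_ext _ (intg_cos s 0 fi)) => w; by rewrite addr0 (mulrC s).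
have isn f (s : R) : intg leb f -> intg leb (fun w => f w * sin (s * w)).
  move=> fi; apply: (intg_ext _ (intg_cos s (- (pi / 2)) fi)) => w.
  by rewrite cosBpihalf (mulrC s).
(* The zero summand supplies the two-phase shape of [Kph_pairing]. *)
have E s : conv_refl phi psi s + conv_refl phi psi (- s) =
  Rintegral leb setT (fun w => (pi^-1 * cross_re w) * cos (s * w + 0) + 0 * cos (s * w + 0)).
  apply: (@mulfI _ (2 * pi)); first by rewrite mulf_neq0.
  rewrite mulrDr !conv_reflE -RintgD; try by apply: intgD; [exact: ics|exact: isn].
  rewrite -RintgZ.
    apply: Rintg_ext => w; rewrite !mulNr cosN sinN addr0 mul0r addr0.
    by rewrite (_ : 2 * pi * (pi^-1 * cross_re w * cos (s * w)) = 2 * (pi * pi^-1) * (cross_re w * cos (s * w))); [rewrite divff//; ring|ring].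
  apply: (intg_ext _ (intgZ pi^-1 (ics _ s icr))) => w.
  by rewrite addr0 mul0r addr0 mulrA.
have [i1 i2] := kernel_conv_intg.
have i3 : intg leb (fun s => kappa s * (conv_refl phi psi s + conv_refl phi psi (- s))).
  by apply: (intg_ext _ (intgD i1 i2)) => s; rewrite mulrDr.
have E' s := congr1 (fun y => kappa s * y) (E s).
rewrite (funext E') in i3 *.
have hb1 w : `|pi^-1 * cross_re w| <= pi^-1 * C * wt w.
  rewrite normrM ger0_norm ?invr_ge0 ?pi_ge0// -mulrA ler_wpM2l ?invr_ge0 ?pi_ge0//.
  by case: (hC w).
rewrite (Kph_pairing kk _ _ hb1 _ i3).
- by apply: Rintg_ext => w; rewrite Kph0 mul0r addr0 mulrA.
- by mfun.
- by mfun.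
- move=> w; rewrite normr0; apply: mulr_ge0; last exact: wt_ge0.
  by apply: mulr_ge0 => //; rewrite invr_ge0 pi_ge0.
Qed.

End Parseval.

End KernelFourier.

(** * Measures with a density *)

Section Density.
Context d (T : measurableType d) (R : realType).
Import HBNNSimple.

Section DensityIntegral.
Variables (mu nu : {measure set T -> \bar R}) (r : T -> R).
Hypothesis mr : measurable_fun setT r.
Hypothesis r0 : forall x, 0 <= r x.
Hypothesis nuE : forall E, measurable E -> nu E = (\int[mu]_(x in E) (r x)%:E)%E.

Let integral_density_nnsfun (h : {nnsfun T >-> R}) :
  (\int[nu]_x (h x)%:E = \int[mu]_x (h x * r x)%:E)%E.
Proof.
have mh k : measurable (h @^-1` [set k]) by exact: measurable_sfunP.
have h0 k x : 0 <= k * \1_(h @^-1` [set k]) x.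
  rewrite indicE; case: (boolP (x \in _)); rewrite ?mulr0// mulr1 inE /= => <-.
  exact: fun_ge0.
transitivity (\sum_(k \in range h) \int[mu]_x (k * \1_(h @^-1` [set k]) x * r x)%:E)%E.
  under eq_integral do rewrite fimfunE -fsumEFin//.
  rewrite ge0_integral_fsum//; last 2 first.
  - by move=> y; apply/measurable_EFinP; apply: measurable_funM => //; exact: measurable_indic.
  - by move=> y x _; rewrite lee_fin.
  apply: eq_fsbigr => k /[!inE] -[t _ ht].
  have k0 : 0 <= k by rewrite -ht; exact: fun_ge0.
  under eq_integral do rewrite EFinM.
  rewrite ge0_integralZl//; last by apply/measurable_EFinP; exact: measurable_indic.
  rewrite integral_indic// setIT nuE//.
  under [RHS]eq_integral do rewrite -mulrA EFinM.
  rewrite ge0_integralZl//;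
    try (by apply/measurable_EFinP; apply: measurable_funM => //; exact: measurable_indic);
    try (by move=> x _; rewrite lee_fin mulr_ge0).
  congr (_ * _)%E; rewrite integral_mkcond; apply: eq_integral => x _.
  rewrite patchE indicE; case: ifPn => _; by rewrite ?mul1r ?mul0r.
rewrite -ge0_integral_fsum//; last 2 first.
- by move=> y; apply/measurable_EFinP; do ! apply: measurable_funM => //; exact: measurable_indic.
- by move=> y x _; rewrite lee_fin mulr_ge0.
apply: eq_integral => x _; rewrite [in RHS]fimfunE.
rewrite fsumEFin//; congr EFin.
by rewrite !fsbig_finite//= mulr_suml.
Qed.

Lemma ge0_integral_density (f : T -> R) : measurable_fun setT f -> (forall x, 0 <= f x) ->
  (\int[nu]_x (f x)%:E = \int[mu]_x (f x * r x)%:E)%E.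
Proof.
move=> mf f0.
have mEf : measurable_fun setT (EFin \o f) by exact/measurable_EFinP.
pose f_ := nnsfun_approx measurableT mEf.
have nd x : nondecreasing_seq (fun n => f_ n x).
  by move=> m n mn; exact/lefP/nd_nnsfun_approx.
have cv x : (fun n => (f_ n x)%:E) @ \oo --> (f x)%:E.
  by apply: (@cvg_nnsfun_approx _ _ _ _ measurableT (EFin \o f) mEf) => // t _; rewrite /= lee_fin.
have l1 : (fun n => (\int[nu]_x (f_ n x)%:E)%E) @ \oo --> (\int[nu]_x (f x)%:E)%E.
  have := @cvg_monotone_convergence _ _ _ nu setT measurableT (fun n x => (f_ n x)%:E).
  rewrite (_ : (\int[nu]_x (f x)%:E)%E = (\int[nu]_x limn (fun n => (f_ n x)%:E))%E).
    apply.
    - by move=> n; exact/measurable_EFinP/measurable_funP.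
    - by move=> n x _; rewrite lee_fin.
    - by move=> x _ m n mn; rewrite lee_fin nd.
  by apply: eq_integral => x _; apply/esym/cvg_lim => //; exact: cv.
have l2 : (fun n => (\int[mu]_x (f_ n x * r x)%:E)%E) @ \oo --> (\int[mu]_x (f x * r x)%:E)%E.
  have := @cvg_monotone_convergence _ _ _ mu setT measurableT (fun n x => (f_ n x * r x)%:E).
  rewrite (_ : (\int[mu]_x (f x * r x)%:E)%E = (\int[mu]_x limn (fun n => (f_ n x * r x)%:E))%E).
    apply.
    - move=> n; apply/measurable_EFinP; apply: measurable_funM => //.
    - by move=> n x _; rewrite lee_fin mulr_ge0.
    - by move=> x _ m n mn; rewrite lee_fin ler_wpM2r// nd.
  apply: eq_integral => x _; apply/esym/cvg_lim => //; rewrite EFinM.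
  under eq_fun do rewrite EFinM.
  by apply: cvgeZr => //; exact: cv.
rewrite (_ : (fun n => _) = (fun n => (\int[mu]_x (f_ n x * r x)%:E)%E)) in l1; last first.
  by apply/funext => n; exact: integral_density_nnsfun.
exact: (cvg_unique _ l1 l2).
Qed.

Lemma intg_density (f : T -> R) : measurable_fun setT f ->
  intg nu f <-> intg mu (fun x => f x * r x).
Proof.
move=> mf.
have mfr : measurable_fun setT (fun x => f x * r x) by exact: measurable_funM.
have mabs : measurable_fun setT (fun x => `|f x|) by exact: measurableT_comp.
have E := ge0_integral_density mabs (fun x => normr_ge0 (f x)).
have E' : (\int[mu]_x (`|f x| * r x)%:E = \int[mu]_x `|(f x * r x)%:E|)%E.
  by apply: eq_integral => x _ /=; rewrite normrM (ger0_norm (r0 x)).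
rewrite E' in E.
split=> /integrableP[_ h]; apply/integrableP; split; try exact/measurable_EFinP.
  by rewrite -[X in (X < _)%E]E.
by rewrite [X in (X < _)%E]E.
Qed.

Lemma Rintg_density (f : T -> R) : intg nu f ->
  Rintegral nu setT f = Rintegral mu setT (fun x => f x * r x).
Proof.
move=> fi; have mf := intg_measurable fi.
have mabs : measurable_fun setT (fun x => `|f x|) by exact: measurableT_comp.
have fr := (intg_density mf).1 fi.
have ar := (intg_density mabs).1 (intg_abs fi).
(* [f] is the difference of the nonnegative functions [p] and [|f|], to which the nonnegative case
   applies. *)
pose p x := `|f x| + f x.
have p0 x : 0 <= p x by rewrite /p; have := ler_norm (- f x); rewrite normrN; lra.
have ip : intg nu p by apply: intgD => //; exact: intg_abs.
have E1 := ge0_integral_density (intg_measurable ip) p0.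
have E2 := ge0_integral_density mabs (fun x => normr_ge0 (f x)).
have e1 : Rintegral nu setT p = Rintegral mu setT (fun x => p x * r x) by rewrite /Rintegral E1.
have e2 : Rintegral nu setT (fun x => `|f x|) = Rintegral mu setT (fun x => `|f x| * r x).
  by rewrite /Rintegral E2.
have h1 : Rintegral nu setT f = Rintegral nu setT p - Rintegral nu setT (fun x => `|f x|).
  by rewrite -RintgB//; [apply: Rintg_ext => x; rewrite /p; ring|exact: intg_abs].
have ipr : intg mu (fun x => p x * r x).
  by apply: (intg_ext _ (intgD ar fr)) => x; rewrite /p mulrDl.
rewrite h1 e1 e2 -RintgB//; apply: Rintg_ext => x; rewrite /p; ring.
Qed.

End DensityIntegral.

Section DensityMeasure.
Variables (nu : {measure set T -> \bar R}) (p : T -> R).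
Hypothesis ip : intg nu p.
Hypothesis p0 : forall x, 0 <= p x.

Definition density (E : set T) : \bar R := (\int[nu]_(x in E) (p x)%:E)%E.

(** Bundles the density as a finite measure, the form in which measures are compared through their
    characteristic functions. *)
Lemma exists_density_measure : exists m : {finite_measure set T -> \bar R},
  forall E, m E = density E.
Proof.
have d0 : density set0 = 0%E by rewrite /density integral_set0.
have dge0 E : (0 <= density E)%E by apply: integral_ge0 => x _; rewrite lee_fin.
have mp := intg_measurable ip.
have dsig : semi_sigma_additive density.
  move=> F mF tF mUF; rewrite /density ge0_integral_bigcup//.
  - apply: is_cvg_ereal_nneg_natsum_cond => n _ _.
    by apply: integral_ge0 => x _; rewrite lee_fin.
  - by apply/measurable_EFinP; exact: measurable_funTS.
  - by move=> x _; rewrite lee_fin.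
pose M : {measure set T -> \bar R} := HB.pack density (isMeasure.Build _ _ _ density d0 dge0 dsig).
have fin : fin_num_fun M.
  move=> E mE; rewrite ge0_fin_numE//.
  apply: (@le_lt_trans _ _ (\int[nu]_x (p x)%:E)%E).
    rewrite /= /density; apply: ge0_subset_integral => //.
    - exact/measurable_EFinP.
    - by move=> x _; rewrite lee_fin.
  exact: (ge0_intgP nu mp p0).1.
pose F : {finite_measure set T -> \bar R} := HB.pack density (isMeasure.Build _ _ _ density d0 dge0 dsig) (Measure_isFinite.Build _ _ _ M fin).
by exists F.
Qed.

End DensityMeasure.
End Density.

(** * Square integrable functions and their limits *)

Section SquareIntegrable.
Context d (T : measurableType d) (R : realType) (mu : {measure set T -> \bar R}).
Implicit Types X Y : T -> R.

Lemma sqr_intg_mul X Y : measurable_fun setT X -> measurable_fun setT Y ->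
  intg mu (fun x => X x ^+ 2) -> intg mu (fun x => Y x ^+ 2) ->
  intg mu (fun x => X x * Y x).
Proof.
move=> mX mY iX iY.
apply: (intg_dom (g := fun x => X x ^+ 2 + Y x ^+ 2)); [exact: measurable_funM| |exact: intgD].
move=> x; rewrite normrM -(real_normK (num_real (X x))) -(real_normK (num_real (Y x))).
have := sqr_ge0 (`|X x| - `|Y x|); rewrite sqrrB.
have : 0 <= `|X x| * `|Y x| by rewrite mulr_ge0.
lra.
Qed.

Lemma sqr_intgD X Y : measurable_fun setT X -> measurable_fun setT Y ->
  intg mu (fun x => X x ^+ 2) -> intg mu (fun x => Y x ^+ 2) ->
  intg mu (fun x => (X x + Y x) ^+ 2).
Proof.
move=> mX mY iX iY; have i := sqr_intg_mul mX mY iX iY.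
apply: (intg_ext _ (intgD (intgD iX iY) (intgZ 2 i))) => x; ring.
Qed.

(** Convergence to 0 in the extended reals forces some distance to be finite; for such an [n], [X]
    is [Xn n] minus a square integrable function. *)
Lemma L2_lim_intg (Xn : nat -> T -> R) X :
  (forall n, measurable_fun setT (Xn n)) -> measurable_fun setT X ->
  (forall n, intg mu (fun x => Xn n x ^+ 2)) ->
  (fun n => \int[mu]_x ((Xn n x - X x) ^+ 2)%:E)%E @ \oo --> 0%E ->
  [/\ intg mu (fun x => X x ^+ 2), (forall n, intg mu (fun x => (Xn n x - X x) ^+ 2)) &
     (fun n => Rintegral mu setT (fun x => (Xn n x - X x) ^+ 2)) @ \oo --> (0 : R)].
Proof.
move=> mXn mX iXn cv.
have mB n : measurable_fun setT (fun x => (Xn n x - X x) ^+ 2).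
  by apply: measurable_funX; apply: measurable_funB.
have B0 n : (0 <= \int[mu]_x ((Xn n x - X x) ^+ 2)%:E)%E.
  by apply: integral_ge0 => x _; rewrite lee_fin sqr_ge0.
have iX : intg mu (fun x => X x ^+ 2).
  have [/= n hn] : exists n, (\int[mu]_x ((Xn n x - X x) ^+ 2)%:E < +oo)%E.
    have /fine_cvgP[[N _ /(_ N (leqnn N)) hN] _] := cv.
    by exists N; rewrite -ge0_fin_numE.
  have iB : intg mu (fun x => (Xn n x - X x) ^+ 2).
    by apply/ge0_intgP => // x; rewrite sqr_ge0.
  have mD : measurable_fun setT (fun x => Xn n x - X x) by apply: measurable_funB.
  have mN : measurable_fun setT (fun x => - Xn n x) by apply: measurableT_comp.
  have iN : intg mu (fun x => (- Xn n x) ^+ 2).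
    by apply: (intg_ext _ (iXn n)) => x; rewrite sqrrN.
  apply: (intg_ext _ (sqr_intgD mD mN iB iN)) => x.
  by rewrite (_ : Xn n x - X x + - Xn n x = - X x) ?sqrrN//; ring.
have iB n : intg mu (fun x => (Xn n x - X x) ^+ 2).
  have mN : measurable_fun setT (fun x => - X x) by apply: measurableT_comp.
  have iN : intg mu (fun x => (- X x) ^+ 2).
    by apply: (intg_ext _ iX) => x; rewrite sqrrN.
  exact: (sqr_intgD (mXn n) mN (iXn n) iN).
split => //.
by have /fine_cvgP[] := cv.
Qed.

(** Continuity of the inner product, with the weighted inequality [|s t| <= s^2 / dl + dl t^2] in
    the role of Cauchy-Schwarz: first [dl] is chosen small, then [n] large. *)
Lemma L2_lim_prod (Xn Yn : nat -> T -> R) X Y :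
  (forall n, measurable_fun setT (Xn n)) -> measurable_fun setT X ->
  (forall n, intg mu (fun x => Xn n x ^+ 2)) ->
  (fun n => \int[mu]_x ((Xn n x - X x) ^+ 2)%:E)%E @ \oo --> 0%E ->
  (forall n, measurable_fun setT (Yn n)) -> measurable_fun setT Y ->
  (forall n, intg mu (fun x => Yn n x ^+ 2)) ->
  (fun n => \int[mu]_x ((Yn n x - Y x) ^+ 2)%:E)%E @ \oo --> 0%E ->
  (fun n => Rintegral mu setT (fun x => Xn n x * Yn n x)) @ \oo -->
    Rintegral mu setT (fun x => X x * Y x).
Proof.
move=> mXn mX iXn cX mYn mY iYn cY.
have [iX iDX lX] := L2_lim_intg mXn mX iXn cX.
have [iY iDY lY] := L2_lim_intg mYn mY iYn cY.
pose a n := Rintegral mu setT (fun x => (Xn n x - X x) ^+ 2).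
pose b n := Rintegral mu setT (fun x => (Yn n x - Y x) ^+ 2).
pose A := Rintegral mu setT (fun x => X x ^+ 2).
pose B := Rintegral mu setT (fun x => Y x ^+ 2).
have A0 : 0 <= A by apply: Rintegral_ge0 => x _; exact: sqr_ge0.
have B0 : 0 <= B by apply: Rintegral_ge0 => x _; exact: sqr_ge0.
have key n dl : 0 < dl -> `|Rintegral mu setT (fun x => X x * Y x) -
    Rintegral mu setT (fun x => Xn n x * Yn n x)| <=
    (1 + dl^-1) * (a n + b n) + dl * (A + B).
  move=> dl0; have dli : 0 < dl^-1 by rewrite invr_gt0.
  have i1 := sqr_intg_mul mX mY iX iY; have i2 := sqr_intg_mul (mXn n) (mYn n) (iXn n) (iYn n).
  have iS := intgD (intgZ (1 + dl^-1) (intgD (iDX n) (iDY n))) (intgZ dl (intgD iX iY)).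
  have -> : (1 + dl^-1) * (a n + b n) + dl * (A + B) = Rintegral mu setT
      (fun x => (1 + dl^-1) * ((Xn n x - X x) ^+ 2 + (Yn n x - Y x) ^+ 2) + dl * (X x ^+ 2 + Y x ^+ 2)).
    rewrite RintgD; [|by apply: intgZ; exact: intgD|by apply: intgZ; exact: intgD].
    rewrite !RintgZ; [|exact: intgD|exact: intgD].
    by rewrite !RintgD.
  rewrite -RintgB//; apply: Rintg_norm_le; [exact: intg_measurable (intgB i1 i2)|exact: iS|].
  move=> x; set u := Xn n x - X x; set v := Yn n x - Y x.
  have -> : X x * Y x - Xn n x * Yn n x = - (u * v) - u * Y x - v * X x by rewrite /u /v; ring.
  have amgm (s t : R) : `|s * t| <= dl^-1 * s ^+ 2 + dl * t ^+ 2.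
    rewrite normrM -[s ^+ 2]real_normK ?num_real// -[t ^+ 2]real_normK ?num_real//.
    have := sqr_ge0 (`|s| - dl * `|t|); rewrite sqrrB => h.
    have h2 : 0 <= dl^-1 * (`|s| ^+ 2 - `|s| * (dl * `|t|) *+ 2 + (dl * `|t|) ^+ 2).
      by rewrite mulr_ge0// ltW.
    have e2 : dl^-1 * (`|s| ^+ 2 - `|s| * (dl * `|t|) *+ 2 + (dl * `|t|) ^+ 2) =
      dl^-1 * `|s| ^+ 2 - 2 * (`|s| * `|t|) + dl * `|t| ^+ 2 by field; rewrite gt_eqF.
    have : 0 <= `|s| * `|t| by rewrite mulr_ge0.
    lra.
  have h1 := amgm u (Y x); have h2 := amgm v (X x).
  have h3 : `|- (u * v)| <= u ^+ 2 + v ^+ 2.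
    rewrite normrN normrM -[u ^+ 2]real_normK ?num_real// -[v ^+ 2]real_normK ?num_real//.
    have := sqr_ge0 (`|u| - `|v|); rewrite sqrrB.
    have : 0 <= `|u| * `|v| by rewrite mulr_ge0.
    lra.
  apply: (le_trans (ler_normB _ _)); apply: (le_trans (lerD (ler_normB _ _) (lexx _))).
  have -> : (1 + dl^-1) * (u ^+ 2 + v ^+ 2) + dl * (X x ^+ 2 + Y x ^+ 2) =
    (u ^+ 2 + v ^+ 2) + (dl^-1 * u ^+ 2 + dl * Y x ^+ 2) + (dl^-1 * v ^+ 2 + dl * X x ^+ 2) by ring.
  by apply: lerD => //; apply: lerD.
apply/cvgrPdist_le => e e0.
(* Chosen so that [dl * (A + B) <= e / 2]; the added 1 keeps the denominator positive. *)
pose dl := e / (2 * (A + B + 1)).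
have AB : 0 < 2 * (A + B + 1) by lra.
have dl0 : 0 < dl by rewrite divr_gt0.
have dli : 0 < dl^-1 by rewrite invr_gt0.
have lab : (fun n => (1 + dl^-1) * (a n + b n)) @ \oo --> (0 : R).
  rewrite -(mulr0 (1 + dl^-1)); apply: cvgM; first exact: cvg_cst.
  by rewrite -(addr0 0); apply: cvgD.
have e2 : 0 < e / 2 by rewrite divr_gt0.
move/cvgrPdist_le : lab => /(_ _ e2); apply: filterS => n hn.
apply: (le_trans (key n dl dl0)).
have h1 : (1 + dl^-1) * (a n + b n) <= e / 2.
  by apply: le_trans hn; rewrite sub0r normrN ler_norm.
have h2 : dl * (A + B) <= e / 2.
  have -> : e / 2 = dl * (A + B + 1) by rewrite /dl; field; lra.
  by rewrite ler_wpM2l ?(ltW dl0)//; lra.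
lra.
Qed.

End SquareIntegrable.

Section LebesgueBorel.
Variable R : realType.
Local Notation leb := (@lebesgue_measure R).

(* [lebesgue_measure] lives on the measurable type generated by the intervals, whereas
   measures on [R] use the canonical measurable structure of [R]; both have the same
   measurable sets, and [lebR] is the Lebesgue measure for the latter. *)
Definition lebR (A : set R) : \bar R := leb A.

Let lebR0 : lebR set0 = 0%E. Proof. exact: measure0. Qed.
Let lebR_ge0 A : (0 <= lebR A)%E. Proof. exact: measure_ge0. Qed.
Let lebR_sigma : semi_sigma_additive lebR.
Proof. exact: (@measure_semi_sigma_additive _ (measurableTypeR R) R leb). Qed.

HB.instance Definition _ := isMeasure.Build _ R R lebR lebR0 lebR_ge0 lebR_sigma.

Let mid : measurable_fun setT (id : measurableTypeR R -> R).
Proof. by move=> _ Y mY; rewrite setTI. Qed.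

(** [lebR] is the image of Lebesgue measure under the identity between the two structures, so this
    is a change of variables. *)
Lemma ge0_integral_lebR (A : set R) (f : R -> R) : measurable A -> measurable_fun setT f ->
  (forall x, 0 <= f x) -> (\int[lebR]_(x in A) (f x)%:E = \int[leb]_(x in A) (f x)%:E)%E.
Proof.
move=> mA mf f0; apply: (ge0_integral_pushforward mid leb mA).
  by apply/measurable_EFinP; exact: measurable_funTS.
by move=> x _; rewrite lee_fin.
Qed.

Lemma intg_lebR (f : R -> R) : intg leb f -> intg lebR f.
Proof.
move=> fi; have mf : measurable_fun setT f := intg_measurable fi.
have ma : measurable_fun setT (fun x => `|f x|) by mfun.
apply/integrableP; split; first exact/measurable_EFinP.
rewrite [X in (X < _)%E](@ge0_integral_lebR setT (fun x => `|f x|))//.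
by move/integrableP : fi => [].
Qed.

Lemma Rintg_lebR (f : R -> R) : intg leb f ->
  Rintegral lebR setT f = Rintegral leb setT f.
Proof.
move=> fi; have mf : measurable_fun setT (EFin \o f).
  by apply/measurable_EFinP; exact: intg_measurable fi.
rewrite /Rintegral; congr fine.
exact: (integral_pushforward mid mf fi measurableT).
Qed.

End LebesgueBorel.

(** * Isometry of the stochastic integral *)

Section SimpleApproximation.
Variable R : realType.
Variable nu : {measure set R -> \bar R}.
Import HBNNSimple.

Definition sfun_eval (l : seq (set R * R)) (w : R) : R := \sum_(x <- l) x.2 * (\1_(x.1) w : R).

(** [nu] may be infinite, and the random measure is controlled only on sets of finite measure.
    Chebyshev's inequality with [f ^+ 2] shows that the level sets at nonzero values are such
    sets. *)
Lemma ge0_simple_approx (f : R -> R) : measurable_fun setT f -> (forall w, 0 <= f w) ->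
  intg nu (fun w => f w ^+ 2) ->
  exists l : nat -> seq (set R * R),
  [/\ forall n x, x \in l n -> finset_nu nu x.1,
      forall w, sfun_eval (l n) w @[n --> \oo] --> f w &
      forall n w, 0 <= sfun_eval (l n) w <= f w].
Proof.
move=> mf f0 fi.
have mEf : measurable_fun setT (EFin \o f) by exact/measurable_EFinP.
have Ef0 t : setT t -> (0 <= (EFin \o f) t)%E by move=> _; rewrite /= lee_fin.
pose g := nnsfun_approx measurableT mEf.
have cv w : g n w @[n --> \oo] --> f w.
  have h : (fun n => (g n w)%:E) @ \oo --> (f w)%:E.
    exact: (@cvg_nnsfun_approx _ _ _ _ measurableT (EFin \o f) mEf).
  by have /fine_cvgP[] := h.
have gf n w : g n w <= f w.
  have nd : nondecreasing_seq (fun n => g n w) by move=> p q pq; exact/lefP/nd_nnsfun_approx.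
  have cw : cvgn (fun n => g n w) by apply/cvg_ex; exists (f w); exact: cv.
  have := nondecreasing_cvgn_le nd cw n.
  by rewrite (cvg_lim _ (cv w)).
(* The value 0 is dropped: its level set may have infinite measure and contributes nothing to the
   sum. *)
pose l n := [seq (g n @^-1` [set y], y) | y <- finmap.enum_fset (fset_set (range (g n))) & y != 0].
have lE n w : sfun_eval (l n) w = g n w.
  rewrite /sfun_eval big_map big_filter /= [RHS]fimfunE fsbig_finite//=.
  rewrite [RHS](bigID (fun y => y != 0)) /= [X in _ = _ + X]big1 ?addr0//.
  by move=> y /negPn/eqP ->; rewrite mul0r.
exists l; split.
- move=> n x /mapP[y]; rewrite mem_filter => /andP[y0 _] -> /=.
  have mE : measurable (g n @^-1` [set y]) by exact: measurable_sfunP.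
  split => //.
  have y2 : 0 < y ^+ 2 by rewrite exprn_even_gt0.
  have h := (ge0_intgP nu (intg_measurable (intgZ (y ^+ 2)^-1 fi)) _).1 (intgZ (y ^+ 2)^-1 fi).
  apply: le_lt_trans (h _); last first.
    by move=> w; rewrite mulr_ge0 ?invr_ge0 ?sqr_ge0.
  have -> : nu (g n @^-1` [set y]) = (\int[nu]_w (\1_(g n @^-1` [set y]) w)%:E)%E.
    by rewrite integral_indic// setIT.
  apply: ge0_le_integral => //.
  + by apply/measurable_EFinP; exact: measurable_indic.
  + by apply/measurable_EFinP; exact: intg_measurable (intgZ (y ^+ 2)^-1 fi).
  + move=> w _; rewrite lee_fin indicE; case: (boolP (w \in _)) => wE; last first.
      by rewrite mulr_ge0 ?invr_ge0 ?sqr_ge0.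
    move: wE; rewrite inE /= => wE.
    by rewrite mulrC ler_pdivlMr// mul1r -wE lerXn2r ?nnegrE.
- by move=> w; under eq_fun do rewrite lE; exact: cv.
- by move=> n w; rewrite lE gf andbT; exact: fun_ge0.
Qed.

Lemma simple_approx (f : R -> R) : measurable_fun setT f ->
  intg nu (fun w => f w ^+ 2) ->
  exists l : nat -> seq (set R * R),
  [/\ forall n x, x \in l n -> finset_nu nu x.1,
      forall w, sfun_eval (l n) w @[n --> \oo] --> f w &
      forall n w, `|sfun_eval (l n) w| <= `|f w|].
Proof.
move=> mf fi.
pose p w := (`|f w| + f w) / 2; pose q w := (`|f w| - f w) / 2.
have p0 w : 0 <= p w by rewrite /p; have := ler_norm (- f w); rewrite normrN; lra.
have q0 w : 0 <= q w by rewrite /q; have := ler_norm (f w); lra.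
have pq w : p w + q w = `|f w| by rewrite /p /q; field.
have mp : measurable_fun setT p by rewrite /p; mfun.
have mq : measurable_fun setT q by rewrite /q; mfun.
have dom (g : R -> R) : measurable_fun setT g -> (forall w, 0 <= g w <= `|f w|) -> intg nu (fun w => g w ^+ 2).
  move=> mg hg; apply: (intg_dom _ _ fi); first by mfun.
  move=> w; rewrite ger0_norm ?sqr_ge0// -[f w ^+ 2]real_normK ?num_real//.
  by have /andP[g0 gf] := hg w; rewrite lerXn2r ?nnegrE.
have [l1 [f1 c1 b1]] := ge0_simple_approx mp p0 (dom p mp (fun w => ltac:(by rewrite p0 -pq lerDl q0))).
have [l2 [f2 c2 b2]] := ge0_simple_approx mq q0 (dom q mq (fun w => ltac:(by rewrite q0 -pq lerDr p0))).
exists (fun n => l1 n ++ [seq (x.1, - x.2) | x <- l2 n]).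
have E n w : sfun_eval (l1 n ++ [seq (x.1, - x.2) | x <- l2 n]) w =
    sfun_eval (l1 n) w - sfun_eval (l2 n) w.
  rewrite /sfun_eval big_cat big_map /= -sumrN; congr (_ + _).
  by apply: eq_bigr => x _; rewrite mulNr.
split.
- by move=> n x; rewrite mem_cat => /orP[/f1 //|/mapP[y /f2 ? ->]].
- move=> w; under eq_fun do rewrite E.
  rewrite (_ : f w = p w - q w); first exact: cvgB.
  by rewrite /p /q; field.
- move=> n w; rewrite E -pq; have /andP[x0 x1] := b1 n w; have /andP[y0 y1] := b2 n w.
  by apply: (le_trans (ler_normB _ _)); rewrite !ger0_norm// lerD.
Qed.

(** [stoch_int] speaks of all approximating sequences; the existence of one is what gives it
    content. *)
Lemma simple_pair_approx (hr hi : R -> R) : measurable_fun setT hr -> measurable_fun setT hi ->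
  intg nu (fun w => hr w ^+ 2) -> intg nu (fun w => hi w ^+ 2) ->
  exists s : nat -> seq (set R * R * R),
  (forall n x, x \in s n -> finset_nu nu x.1.1) /\
  (fun n => \int[nu]_w (((simple_re (s n) w - hr w) ^+ 2
                          + (simple_im (s n) w - hi w) ^+ 2)%:E))%E @ \oo --> 0%E.
Proof.
move=> mr mi ir ii.
have [l1 [f1 c1 b1]] := simple_approx mr ir; have [l2 [f2 c2 b2]] := simple_approx mi ii.
exists (fun n => [seq (x.1, x.2, 0) | x <- l1 n] ++ [seq (x.1, 0, x.2) | x <- l2 n]).
have ml n (l : nat -> seq (set R * R)) : (forall n x, x \in l n -> finset_nu nu x.1) ->
    measurable_fun setT (sfun_eval (l n)).
  move=> fl; rewrite /sfun_eval.
  (* [measurable_sum] asks for measurability of the term at every [x], whereas only the sets listed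
     in [l n] are known to be measurable. *)
  rewrite (_ : (fun w => _) = (fun w => \sum_(x <- l n) if x \in l n then x.2 * (\1_(x.1) w : R) else 0)).
    apply: (@measurable_sum _ _ _ setT _ (l n) (fun x w => if x \in l n then x.2 * (\1_(x.1) w : R) else 0)) => x.
    case: (boolP (x \in l n)) => [xl|_]; last exact: measurable_cst.
    have [mE _] := fl _ _ xl.
    by apply: measurable_funM => //; exact: measurable_indic.
  by apply/funext => w; rewrite big_seq [RHS]big_seq; apply: eq_bigr => x ->.
have m1 n := ml n l1 f1; have m2 n := ml n l2 f2.
have Er n w : simple_re ([seq (x.1, x.2, 0) | x <- l1 n] ++ [seq (x.1, 0, x.2) | x <- l2 n]) w = sfun_eval (l1 n) w.
  by rewrite /simple_re big_cat !big_map /= [X in _ + X]big1 ?addr0// => x _; rewrite mul0r.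
have Ei n w : simple_im ([seq (x.1, x.2, 0) | x <- l1 n] ++ [seq (x.1, 0, x.2) | x <- l2 n]) w = sfun_eval (l2 n) w.
  by rewrite /simple_im big_cat !big_map /= big1 ?add0r// => x _; rewrite mul0r.
split.
  by move=> n x; rewrite mem_cat => /orP[/mapP[y /f1 ? ->]|/mapP[y /f2 ? ->]].
pose D n w := (sfun_eval (l1 n) w - hr w) ^+ 2 + (sfun_eval (l2 n) w - hi w) ^+ 2.
have sqb (x y : R) : `|x| <= `|y| -> (x - y) ^+ 2 <= 4 * y ^+ 2.
  move=> xy; have x2 : x ^+ 2 <= y ^+ 2.
    by rewrite -[x ^+ 2]real_normK ?num_real// -[y ^+ 2]real_normK ?num_real// lerXn2r ?nnegrE.
  have := sqr_ge0 (x + y); rewrite sqrrB sqrrD; lra.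
have sq0 (u : nat -> R) (c : R) : u @ \oo --> c -> (u n - c) ^+ 2 @[n --> \oo] --> 0.
  move=> hu; have h : u n - c @[n --> \oo] --> 0.
    by rewrite -(subrr c); apply: cvgB => //; exact: cvg_cst.
  by rewrite -(mulr0 0); apply: cvgM.
have mD n : measurable_fun setT (D n) by have := m1 n; have := m2 n => ? ?; rewrite /D; mfun.
have D0 n w : 0 <= D n w by rewrite /D addr_ge0 ?sqr_ge0.
have Db n w : `|D n w| <= 4 * hr w ^+ 2 + 4 * hi w ^+ 2.
  by rewrite ger0_norm//; apply: lerD; apply: sqb.
have iD n : intg nu (D n).
  by apply: (intg_dom (mD n) (Db n)); apply: intgD; apply: intgZ.
have [||||_ lim] := @RDCT _ _ _ nu D (fun=> 0) (fun w => 4 * hr w ^+ 2 + 4 * hi w ^+ 2).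
- exact: mD.
- move=> w; rewrite -[X in _ --> X](addr0 0); apply: cvgD.
    exact: sq0.
  exact: sq0.
- exact: Db.
- by apply: intgD; apply: intgZ.
rewrite Rintg0 in lim.
rewrite (_ : (fun n => _) = (fun n => (Rintegral nu setT (D n))%:E)).
  by apply: cvg_EFin => //; exact: nearW.
apply/funext => n; rewrite Rintg_EFin//.
by apply: eq_integral => w _; rewrite Er Ei.
Qed.

End SimpleApproximation.

Section Isometry.
Context (R : realType) (nu : {measure set R -> \bar R}).
Context d (T : measurableType d) (P : probability T R) (xr xim : set R -> T -> R).
Hypothesis grm : gauss_rand_meas nu P xr xim.

Lemma Rintg_bigsum d' (U : measurableType d') (mu : {measure set U -> \bar R}) (I : eqType)
    (s : seq I) (f : I -> U -> R) : (forall x, x \in s -> intg mu (f x)) ->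
  intg mu (fun w => \sum_(x <- s) f x w) /\
  Rintegral mu setT (fun w => \sum_(x <- s) f x w) = \sum_(x <- s) Rintegral mu setT (f x).
Proof.
elim: s => [|x s IH] hs.
  rewrite big_nil; split.
    by apply: (intg_ext _ (intg0 mu)) => w; rewrite big_nil.
  by apply: Rintg_eq0 => w; rewrite big_nil.
have [i E] := IH (fun y ys => hs y (mem_behead (s := x :: s) ys)).
have ix := hs x (mem_head x s).
have EE : (fun w => \sum_(y <- x :: s) f y w) = (fun w => f x w + \sum_(y <- s) f y w).
  by apply/funext => w; rewrite big_cons.
rewrite EE big_cons -E; split; [exact: intgD|exact: RintgD].
Qed.

Let entry := (set R * R * R)%type.
Implicit Types x y : entry.

Let L2xi x : finset_nu nu x.1.1 ->
  [/\ measurable_fun setT (xr x.1.1), intg P (fun w => xr x.1.1 w ^+ 2),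
      measurable_fun setT (xim x.1.1) & intg P (fun w => xim x.1.1 w ^+ 2)].
Proof. by case: grm => h _ _ /h [[? ?] [? ?]]. Qed.

Let cov x y : finset_nu nu x.1.1 -> finset_nu nu y.1.1 ->
  [/\ intg P (fun w => xr x.1.1 w * xr y.1.1 w + xim x.1.1 w * xim y.1.1 w),
      intg P (fun w => xim x.1.1 w * xr y.1.1 w - xr x.1.1 w * xim y.1.1 w),
      Rintegral P setT (fun w => xr x.1.1 w * xr y.1.1 w + xim x.1.1 w * xim y.1.1 w)
        = fine (nu (x.1.1 `&` y.1.1)) &
      Rintegral P setT (fun w => xim x.1.1 w * xr y.1.1 w - xr x.1.1 w * xim y.1.1 w) = 0].
Proof.
move=> fx fy; have [m1 i1 m2 i2] := L2xi fx; have [m3 i3 m4 i4] := L2xi fy.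
have [_ h _] := grm; have [h1 h2] := h _ _ fx fy.
split => //.
- by apply: intgD; apply: sqr_intg_mul.
- by apply: intgB; apply: sqr_intg_mul.
Qed.

Let indic_cross x y : finset_nu nu x.1.1 -> finset_nu nu y.1.1 ->
  intg nu (fun w => (\1_(x.1.1) w : R) * \1_(y.1.1) w) /\
  Rintegral nu setT (fun w => (\1_(x.1.1) w : R) * \1_(y.1.1) w) = fine (nu (x.1.1 `&` y.1.1)).
Proof.
move=> [mx fx] [my fy].
have E : (fun w => (\1_(x.1.1) w : R) * \1_(y.1.1) w) = \1_(x.1.1 `&` y.1.1).
  by rewrite indicI.
have mI := measurableI _ _ mx my.
rewrite E; split.
  apply/ge0_intgP; [exact: measurable_indic|by move=> w; rewrite indicE|].
  rewrite integral_indic// setIT; apply: le_lt_trans fx.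
  by apply: le_measure; rewrite ?inE//; exact: subIsetl.
by rewrite /Rintegral integral_indic// setIT.
Qed.

(** Both sides are expanded into double sums of c_x conj(c_y) times a covariance. The coefficients
    separate its real part, nu(E_x & E_y), from its imaginary part, which is 0; the zero terms on
    the side of [nu] match the latter. *)
Lemma sint_cross (s s' : seq entry) :
  (forall x, x \in s -> finset_nu nu x.1.1) -> (forall x, x \in s' -> finset_nu nu x.1.1) ->
  Rintegral P setT (fun w => sint_re xr xim s w * sint_re xr xim s' w + sint_im xr xim s w * sint_im xr xim s' w)
  = Rintegral nu setT (fun w => simple_re s w * simple_re s' w + simple_im s w * simple_im s' w) /\
  Rintegral P setT (fun w => sint_im xr xim s w * sint_re xr xim s' w - sint_re xr xim s w * sint_im xr xim s' w)
  = Rintegral nu setT (fun w => simple_im s w * simple_re s' w - simple_re s w * simple_im s' w).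
Proof.
move=> fs fs'.
have dbl d' (U : measurableType d') (mu : {measure set U -> \bar R}) (g : entry -> entry -> U -> R)
   (v : entry -> entry -> R) :
   (forall x y, x \in s -> y \in s' -> intg mu (g x y) /\ Rintegral mu setT (g x y) = v x y) ->
   Rintegral mu setT (fun w => \sum_(x <- s) \sum_(y <- s') g x y w) = \sum_(x <- s) \sum_(y <- s') v x y.
  move=> hg.
  have h1 x : x \in s -> intg mu (fun w => \sum_(y <- s') g x y w) /\
      Rintegral mu setT (fun w => \sum_(y <- s') g x y w) = \sum_(y <- s') v x y.
    move=> xs; have [i E] := Rintg_bigsum (fun y ys => (hg x y xs ys).1).
    split => //; rewrite E big_seq [RHS]big_seq; apply: eq_bigr => y ys.
    by case: (hg x y xs ys).
  have [_ ->] := Rintg_bigsum (fun x xs => (h1 x xs).1).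
  by rewrite big_seq [RHS]big_seq; apply: eq_bigr => x xs; case: (h1 x xs).
have scale d' (U : measurableType d') (mu : {measure set U -> \bar R}) (a b : R) (f g : U -> R) (u v : R) :
   intg mu f -> intg mu g -> Rintegral mu setT f = u -> Rintegral mu setT g = v ->
   intg mu (fun w => a * f w + b * g w) /\ Rintegral mu setT (fun w => a * f w + b * g w) = a * u + b * v.
  move=> fi gi <- <-; split; first by apply: intgD; apply: intgZ.
  by rewrite RintgD; [rewrite !RintgZ|apply: intgZ|apply: intgZ].
have prod_sum (I : Type) (s1 s2 : seq I) (f g : I -> R) :
   (\sum_(x <- s1) f x) * (\sum_(y <- s2) g y) = \sum_(x <- s1) \sum_(y <- s2) f x * g y.
  exact: big_distrlr.
split.
- transitivity (\sum_(x <- s) \sum_(y <- s') ((x.1.2 * y.1.2 + x.2 * y.2) * fine (nu (x.1.1 `&` y.1.1))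
      + (x.1.2 * y.2 - x.2 * y.1.2) * 0)).
    rewrite -(dbl _ _ P (fun x y w => (x.1.2 * y.1.2 + x.2 * y.2) * (xr x.1.1 w * xr y.1.1 w + xim x.1.1 w * xim y.1.1 w)
       + (x.1.2 * y.2 - x.2 * y.1.2) * (xim x.1.1 w * xr y.1.1 w - xr x.1.1 w * xim y.1.1 w))); last first.
      move=> x y xs ys; have [i1 i2 e1 e2] := cov (fs _ xs) (fs' _ ys).
      exact: scale.
    apply: Rintg_ext => w; rewrite /sint_re /sint_im !prod_sum -big_split /=.
    apply: eq_bigr => x _; rewrite -big_split /=; apply: eq_bigr => y _; ring.
  rewrite -(dbl _ _ nu (fun x y w => (x.1.2 * y.1.2 + x.2 * y.2) * ((\1_(x.1.1) w : R) * \1_(y.1.1) w)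
       + (x.1.2 * y.2 - x.2 * y.1.2) * 0)); last first.
    move=> x y xs ys; have [i1 e1] := indic_cross (fs _ xs) (fs' _ ys).
    by apply: scale => //; [exact: intg0|exact: Rintg0].
  apply: Rintg_ext => w; rewrite /simple_re /simple_im !prod_sum -big_split /=.
  apply: eq_bigr => x _; rewrite -big_split /=; apply: eq_bigr => y _; ring.
- transitivity (\sum_(x <- s) \sum_(y <- s') ((x.2 * y.1.2 - x.1.2 * y.2) * fine (nu (x.1.1 `&` y.1.1))
      + (x.1.2 * y.1.2 + x.2 * y.2) * 0)).
    rewrite -(dbl _ _ P (fun x y w => (x.2 * y.1.2 - x.1.2 * y.2) * (xr x.1.1 w * xr y.1.1 w + xim x.1.1 w * xim y.1.1 w)
       + (x.1.2 * y.1.2 + x.2 * y.2) * (xim x.1.1 w * xr y.1.1 w - xr x.1.1 w * xim y.1.1 w))); last first.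
      move=> x y xs ys; have [i1 i2 e1 e2] := cov (fs _ xs) (fs' _ ys).
      exact: scale.
    apply: Rintg_ext => w; rewrite /sint_re /sint_im !prod_sum -sumrB /=.
    apply: eq_bigr => x _; rewrite -sumrB /=; apply: eq_bigr => y _; ring.
  rewrite -(dbl _ _ nu (fun x y w => (x.2 * y.1.2 - x.1.2 * y.2) * ((\1_(x.1.1) w : R) * \1_(y.1.1) w)
       + (x.1.2 * y.1.2 + x.2 * y.2) * 0)); last first.
    move=> x y xs ys; have [i1 e1] := indic_cross (fs _ xs) (fs' _ ys).
    by apply: scale => //; [exact: intg0|exact: Rintg0].
  apply: Rintg_ext => w; rewrite /simple_re /simple_im !prod_sum -sumrB /=.
  apply: eq_bigr => x _; rewrite -sumrB /=; apply: eq_bigr => y _; ring.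
Qed.

Lemma cvge0_components d' (U : measurableType d') (mu : {measure set U -> \bar R}) (F G : nat -> U -> R) :
  (forall n, measurable_fun setT (F n)) -> (forall n, measurable_fun setT (G n)) ->
  (fun n => \int[mu]_w (F n w ^+ 2 + G n w ^+ 2)%:E)%E @ \oo --> 0%E ->
  ((fun n => \int[mu]_w (F n w ^+ 2)%:E)%E @ \oo --> 0%E) /\
  ((fun n => \int[mu]_w (G n w ^+ 2)%:E)%E @ \oo --> 0%E).
Proof.
move=> mF mG cv.
have mF2 n : measurable_fun setT (fun w => F n w ^+ 2) by exact: measurable_funX.
have mG2 n : measurable_fun setT (fun w => G n w ^+ 2) by exact: measurable_funX.
split; apply: (squeeze_cvge _ (cvg_cst 0%E) cv); apply: nearW => n; apply/andP; split.
- by apply: integral_ge0 => w _; rewrite lee_fin sqr_ge0.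
- apply: ge0_le_integral => //.
  + by move=> w _; rewrite lee_fin sqr_ge0.
  + exact/measurable_EFinP.
  + by apply/measurable_EFinP; exact: measurable_funD.
  + by move=> w _; rewrite lee_fin lerDl sqr_ge0.
- by apply: integral_ge0 => w _; rewrite lee_fin sqr_ge0.
- apply: ge0_le_integral => //.
  + by move=> w _; rewrite lee_fin sqr_ge0.
  + exact/measurable_EFinP.
  + by apply/measurable_EFinP; exact: measurable_funD.
  + by move=> w _; rewrite lee_fin lerDr sqr_ge0.
Qed.

Let simple_sqr (s : seq entry) : (forall x, x \in s -> finset_nu nu x.1.1) ->
  [/\ measurable_fun setT (simple_re s), measurable_fun setT (simple_im s),
      intg nu (fun w => simple_re s w ^+ 2) & intg nu (fun w => simple_im s w ^+ 2)].
Proof.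
elim: s => [|x s IH] fs.
  have e1 : simple_re [::] = (fun _ : R => 0 : R) by apply/funext => w; rewrite /simple_re big_nil.
  have e2 : simple_im [::] = (fun _ : R => 0 : R) by apply/funext => w; rewrite /simple_im big_nil.
  rewrite e1 e2; split => //; by apply: (intg_ext _ (intg0 nu)) => w; rewrite expr0n.
have [m1 m2 i1 i2] := IH (fun y ys => fs y (mem_behead (s := x :: s) ys)).
have fx := fs x (mem_head x s); have [ix _] := indic_cross fx fx; have [mx _] := fx.
have e1 : simple_re (x :: s) = (fun w => x.1.2 * \1_(x.1.1) w + simple_re s w).
  by apply/funext => w; rewrite /simple_re big_cons.
have e2 : simple_im (x :: s) = (fun w => x.2 * \1_(x.1.1) w + simple_im s w).
  by apply/funext => w; rewrite /simple_im big_cons.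
have mi c : measurable_fun setT (fun w => c * (\1_(x.1.1) w : R)).
  by apply: measurable_funM => //; exact: measurable_indic.
have ii c : intg nu (fun w => (c * (\1_(x.1.1) w : R)) ^+ 2).
  by apply: (intg_ext _ (intgZ (c ^+ 2) ix)) => w; ring.
rewrite e1 e2; split.
- exact: measurable_funD.
- exact: measurable_funD.
- exact: sqr_intgD.
- exact: sqr_intgD.
Qed.

Let sint_sqr (s : seq entry) : (forall x, x \in s -> finset_nu nu x.1.1) ->
  [/\ measurable_fun setT (sint_re xr xim s), measurable_fun setT (sint_im xr xim s),
      intg P (fun w => sint_re xr xim s w ^+ 2) & intg P (fun w => sint_im xr xim s w ^+ 2)].
Proof.
elim: s => [|x s IH] fs.
  have e1 : sint_re xr xim [::] = (fun _ => 0) by apply/funext => w; rewrite /sint_re big_nil.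
  have e2 : sint_im xr xim [::] = (fun _ => 0) by apply/funext => w; rewrite /sint_im big_nil.
  rewrite e1 e2; split => //; by apply: (intg_ext _ (intg0 P)) => w; rewrite expr0n.
have [m1 m2 i1 i2] := IH (fun y ys => fs y (mem_behead (s := x :: s) ys)).
have [ma ia mb ib] := L2xi (fs x (mem_head x s)).
have e1 : sint_re xr xim (x :: s) = (fun w => (x.1.2 * xr x.1.1 w + - x.2 * xim x.1.1 w) + sint_re xr xim s w).
  by apply/funext => w; rewrite /sint_re big_cons mulNr.
have e2 : sint_im xr xim (x :: s) = (fun w => (x.1.2 * xim x.1.1 w + x.2 * xr x.1.1 w) + sint_im xr xim s w).
  by apply/funext => w; rewrite /sint_im big_cons.
have mZ c (f : T -> R) : measurable_fun setT f -> measurable_fun setT (fun w => c * f w).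
  by move=> mf; exact: measurable_funM.
have iZ c (f : T -> R) : intg P (fun w => f w ^+ 2) -> intg P (fun w => (c * f w) ^+ 2).
  by move=> fi; apply: (intg_ext _ (intgZ (c ^+ 2) fi)) => w; rewrite exprMn.
have mA := measurable_funD (mZ x.1.2 _ ma) (mZ (- x.2) _ mb).
have mB := measurable_funD (mZ x.1.2 _ mb) (mZ x.2 _ ma).
have iA := sqr_intgD (mZ x.1.2 _ ma) (mZ (- x.2) _ mb) (iZ _ _ ia) (iZ _ _ ib).
have iB := sqr_intgD (mZ x.1.2 _ mb) (mZ x.2 _ ma) (iZ _ _ ib) (iZ _ _ ia).
rewrite e1 e2; split.
- exact: measurable_funD.
- exact: measurable_funD.
- exact: (sqr_intgD mA m1 iA i1).
- exact: (sqr_intgD mB m2 iB i2).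
Qed.

(** The identity for simple functions passes to the limit on both sides, since each of the four
    products of real and imaginary parts converges by [L2_lim_prod]. *)
Lemma stoch_int_isometry (hr hi gr gi : R -> R) (Ir Ii Jr Ji : T -> R) :
  measurable_fun setT hr -> measurable_fun setT hi ->
  intg nu (fun w => hr w ^+ 2) -> intg nu (fun w => hi w ^+ 2) ->
  measurable_fun setT gr -> measurable_fun setT gi ->
  intg nu (fun w => gr w ^+ 2) -> intg nu (fun w => gi w ^+ 2) ->
  stoch_int nu P xr xim hr hi Ir Ii -> stoch_int nu P xr xim gr gi Jr Ji ->
  expect P (fun w => Ir w * Jr w + Ii w * Ji w) =
    Rintegral nu setT (fun w => hr w * gr w + hi w * gi w) /\
  expect P (fun w => Ii w * Jr w - Ir w * Ji w) =
    Rintegral nu setT (fun w => hi w * gr w - hr w * gi w).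
Proof.
move=> mhr mhi ihr ihi mgr mgi igr igi [mIr [mIi sI]] [mJr [mJi sJ]].
have [s [fs cs]] := simple_pair_approx mhr mhi ihr ihi.
have [t [ft ct]] := simple_pair_approx mgr mgi igr igi.
have cI := sI s fs cs; have cJ := sJ t ft ct.
have As n := simple_sqr (fs n); have At n := simple_sqr (ft n).
have Bs n := sint_sqr (fs n); have Bt n := sint_sqr (ft n).
have msr n : measurable_fun setT (simple_re (s n)) by case: (As n).
have msi n : measurable_fun setT (simple_im (s n)) by case: (As n).
have isr n : intg nu (fun w => simple_re (s n) w ^+ 2) by case: (As n).
have isi n : intg nu (fun w => simple_im (s n) w ^+ 2) by case: (As n).
have mtr n : measurable_fun setT (simple_re (t n)) by case: (At n).
have mti n : measurable_fun setT (simple_im (t n)) by case: (At n).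
have itr n : intg nu (fun w => simple_re (t n) w ^+ 2) by case: (At n).
have iti n : intg nu (fun w => simple_im (t n) w ^+ 2) by case: (At n).
have nsr n : measurable_fun setT (sint_re xr xim (s n)) by case: (Bs n).
have nsi n : measurable_fun setT (sint_im xr xim (s n)) by case: (Bs n).
have jsr n : intg P (fun w => sint_re xr xim (s n) w ^+ 2) by case: (Bs n).
have jsi n : intg P (fun w => sint_im xr xim (s n) w ^+ 2) by case: (Bs n).
have ntr n : measurable_fun setT (sint_re xr xim (t n)) by case: (Bt n).
have nti n : measurable_fun setT (sint_im xr xim (t n)) by case: (Bt n).
have jtr n : intg P (fun w => sint_re xr xim (t n) w ^+ 2) by case: (Bt n).
have jti n : intg P (fun w => sint_im xr xim (t n) w ^+ 2) by case: (Bt n).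
have [csr csi] := cvge0_components (fun n => measurable_funB (msr n) mhr) (fun n => measurable_funB (msi n) mhi) cs.
have [ctr cti] := cvge0_components (fun n => measurable_funB (mtr n) mgr) (fun n => measurable_funB (mti n) mgi) ct.
have [dsr dsi] := cvge0_components (fun n => measurable_funB (nsr n) mIr) (fun n => measurable_funB (nsi n) mIi) cI.
have [dtr dti] := cvge0_components (fun n => measurable_funB (ntr n) mJr) (fun n => measurable_funB (nti n) mJi) cJ.
have [iIr _ _] := L2_lim_intg nsr mIr jsr dsr; have [iIi _ _] := L2_lim_intg nsi mIi jsi dsi.
have [iJr _ _] := L2_lim_intg ntr mJr jtr dtr; have [iJi _ _] := L2_lim_intg nti mJi jti dti.
have l1 := L2_lim_prod nsr mIr jsr dsr ntr mJr jtr dtr.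
have l2 := L2_lim_prod nsi mIi jsi dsi nti mJi jti dti.
have l3 := L2_lim_prod nsi mIi jsi dsi ntr mJr jtr dtr.
have l4 := L2_lim_prod nsr mIr jsr dsr nti mJi jti dti.
have k1 := L2_lim_prod msr mhr isr csr mtr mgr itr ctr.
have k2 := L2_lim_prod msi mhi isi csi mti mgi iti cti.
have k3 := L2_lim_prod msi mhi isi csi mtr mgr itr ctr.
have k4 := L2_lim_prod msr mhr isr csr mti mgi iti cti.
have E1 n : Rintegral P setT (fun w => sint_re xr xim (s n) w * sint_re xr xim (t n) w) +
   Rintegral P setT (fun w => sint_im xr xim (s n) w * sint_im xr xim (t n) w) =
   Rintegral nu setT (fun w => simple_re (s n) w * simple_re (t n) w) +
   Rintegral nu setT (fun w => simple_im (s n) w * simple_im (t n) w).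
  rewrite -RintgD; [|exact: sqr_intg_mul|exact: sqr_intg_mul].
  rewrite -RintgD; [|exact: sqr_intg_mul|exact: sqr_intg_mul].
  exact: (sint_cross (fs n) (ft n)).1.
have E2 n : Rintegral P setT (fun w => sint_im xr xim (s n) w * sint_re xr xim (t n) w) -
   Rintegral P setT (fun w => sint_re xr xim (s n) w * sint_im xr xim (t n) w) =
   Rintegral nu setT (fun w => simple_im (s n) w * simple_re (t n) w) -
   Rintegral nu setT (fun w => simple_re (s n) w * simple_im (t n) w).
  rewrite -RintgB; [|exact: sqr_intg_mul|exact: sqr_intg_mul].
  rewrite -RintgB; [|exact: sqr_intg_mul|exact: sqr_intg_mul].
  exact: (sint_cross (fs n) (ft n)).2.
pose F1 n := Rintegral P setT (fun w => sint_re xr xim (s n) w * sint_re xr xim (t n) w) +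
   Rintegral P setT (fun w => sint_im xr xim (s n) w * sint_im xr xim (t n) w).
pose F2 n := Rintegral P setT (fun w => sint_im xr xim (s n) w * sint_re xr xim (t n) w) -
   Rintegral P setT (fun w => sint_re xr xim (s n) w * sint_im xr xim (t n) w).
split; rewrite /expect.
- rewrite RintgD; [|exact: sqr_intg_mul|exact: sqr_intg_mul].
  rewrite RintgD; [|exact: sqr_intg_mul|exact: sqr_intg_mul].
  have a : F1 n @[n --> \oo] --> (Rintegral P setT (fun w => Ir w * Jr w) +
      Rintegral P setT (fun w => Ii w * Ji w)) by exact: (cvgD l1 l2).
  have b : F1 n @[n --> \oo] --> (Rintegral nu setT (fun w => hr w * gr w) +
      Rintegral nu setT (fun w => hi w * gi w)).
    rewrite (_ : F1 = (fun n =>    Rintegral nu setT (fun w => simple_re (s n) w * simple_re (t n) w) +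
   Rintegral nu setT (fun w => simple_im (s n) w * simple_im (t n) w))); first exact: (cvgD k1 k2).
    by apply/funext => n; exact: E1.
  exact: (cvg_unique _ a b).
- rewrite RintgB; [|exact: sqr_intg_mul|exact: sqr_intg_mul].
  rewrite RintgB; [|exact: sqr_intg_mul|exact: sqr_intg_mul].
  have a : F2 n @[n --> \oo] --> (Rintegral P setT (fun w => Ii w * Jr w) -
      Rintegral P setT (fun w => Ir w * Ji w)) by exact: (cvgB l3 l4).
  have b : F2 n @[n --> \oo] --> (Rintegral nu setT (fun w => hi w * gr w) -
      Rintegral nu setT (fun w => hr w * gi w)).
    rewrite (_ : F2 = (fun n =>    Rintegral nu setT (fun w => simple_im (s n) w * simple_re (t n) w) -
   Rintegral nu setT (fun w => simple_re (s n) w * simple_im (t n) w))); first exact: (cvgB k3 k4).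
    by apply/funext => n; exact: E2.
  exact: (cvg_unique _ a b).
Qed.

End Isometry.

(** * Uniqueness of the characteristic function *)

Section CharacteristicFunction.
Variable R : realType.
Local Notation leb := (@lebesgue_measure R).
Implicit Types m : {finite_measure set R -> \bar R}.

Lemma finite_intg m (f : R -> R) (C : R) : measurable_fun setT f -> (forall w, `|f w| <= C) ->
  intg m f.
Proof.
move=> mf fC; apply: (intg_dom mf fC).
by apply: finite_measure_integrable_cst.
Qed.

Lemma lebFubini_finite m (f : R -> R -> R) (g : R -> R) (C : R) :
  measurable_fun setT (fun z : R * R => f z.1 z.2) ->
  (forall a w, `|f a w| <= g a * C) -> intg leb g ->
  Rintegral leb setT (fun a => Rintegral m setT (f a)) =
  Rintegral m setT (fun w => Rintegral leb setT (f^~ w)).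
Proof.
move=> mf fg ig.
have iC : intg m (fun=> C) by apply: finite_measure_integrable_cst.
by have [_ _ E] := @RFubini_curry _ _ (measurableTypeR R) _ R leb m f g (fun=> C) mf fg ig iC.
Qed.

Variables m1 m2 : {finite_measure set R -> \bar R}.
Hypothesis eq_cos : forall a, Rintegral m1 setT (fun w => cos (a * w)) = Rintegral m2 setT (fun w => cos (a * w)).
Hypothesis eq_sin : forall a, Rintegral m1 setT (fun w => sin (a * w)) = Rintegral m2 setT (fun w => sin (a * w)).

Let P (e x : R) : R := 2 * e / (e ^+ 2 + x ^+ 2).

(* By Fubini, the convolution of a finite measure with a Poisson kernel depends only on
   its characteristic function; letting [e] tend to 0 recovers the mass of intervals. *)
Lemma eq_Poisson (e x : R) : 0 < e ->
  Rintegral m1 setT (fun w => P e (x - w)) = Rintegral m2 setT (fun w => P e (x - w)).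
Proof.
move=> e0.
have key m : Rintegral m setT (fun w => P e (x - w)) = Rintegral leb setT (fun a =>
    expR (- (e * `|a|)) * (cos (a * x) * Rintegral m setT (fun w => cos (a * w))
                         + sin (a * x) * Rintegral m setT (fun w => sin (a * w)))).
  have ic a : intg m (fun w => cos (a * w)).
    by apply: (@finite_intg _ _ 1); [mfun|move=> w; exact: cos_max].
  have is_ a : intg m (fun w => sin (a * w)).
    by apply: (@finite_intg _ _ 1); [mfun|move=> w; exact: sin_max].
  transitivity (Rintegral m setT (fun w => Rintegral leb setT (fun a => expR (- (e * `|a|)) * cos (a * (x - w))))).
    by apply: Rintg_ext => w; rewrite Rintg_exp_abs_cos.
  rewrite -(@lebFubini_finite _ (fun a w => expR (- (e * `|a|)) * cos (a * (x - w)))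
    (fun a => expR (- (e * `|a|))) 1).
  - apply: Rintg_ext => a.
    rewrite -(RintgZ _ (ic a)) -(RintgZ _ (is_ a)) -(RintgD (intgZ _ (ic a)) (intgZ _ (is_ a))).
    rewrite -(RintgZ _ (intgD (intgZ _ (ic a)) (intgZ _ (is_ a)))).
    by apply: Rintg_ext => w; rewrite mulrBr cosB.
  - by mfun.
  - move=> a w; rewrite normrM (ger0_norm (expR_ge0 _)).
    by apply: ler_wpM2l; [exact: expR_ge0|exact: cos_max].
  - exact: intg_exp_abs.
by rewrite !key; apply: Rintg_ext => a; rewrite eq_cos eq_sin.
Qed.

(** The Poisson kernel integrated over [x] in [c, d]: the difference of arctangents is a smoothed 2
    pi times the indicator of the interval. *)
Lemma eq_atan (e c d : R) : 0 < e -> c <= d ->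
  Rintegral m1 setT (fun w => 2 * atan ((d - w) / e) - 2 * atan ((c - w) / e)) =
  Rintegral m2 setT (fun w => 2 * atan ((d - w) / e) - 2 * atan ((c - w) / e)).
Proof.
move=> e0 cd; have d0 (x : R) : 0 < e ^+ 2 + x ^+ 2.
  by rewrite ltr_wpDr ?sqr_ge0 ?exprn_gt0.
have d1 x : e ^+ 2 + x ^+ 2 != 0 by rewrite gt_eqF.
have P0 x : 0 <= P e x by rewrite /P divr_ge0 ?(ltW (d0 _))// mulr_ge0// ltW.
have Pb x : P e x <= 2 / e.
  rewrite /P ler_pdivrMr// mulrAC ler_pdivlMr// mulrDr.
  have : 0 <= 2 * x ^+ 2 by rewrite mulr_ge0 ?sqr_ge0.
  lra.
have mP : measurable_fun setT (P e).
  by have [/intg_measurable] := @Rintg_Poisson R e e0.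
have key m : Rintegral m setT (fun w => 2 * atan ((d - w) / e) - 2 * atan ((c - w) / e)) =
    Rintegral leb setT (fun x => Rintegral m setT (fun w => P e (x - w) * ((c <= x) && (x <= d))%:R)).
  rewrite (@lebFubini_finite _ (fun x w => P e (x - w) * ((c <= x) && (x <= d))%:R)
    (fun x => ((c <= x) && (x <= d))%:R) (2 / e)).
  - apply: Rintg_ext => w.
    have dF (x : R) : is_derive x 1 (fun x => 2 * atan ((x - w) / e)) (P e (x - w)).
      rewrite /P; apply: is_derive_eq; rewrite /GRing.scale /=; field.
      by rewrite d1 gt_eqF.
    rewrite (Rintg_FTC cd _ dF)// => x.
    apply: cvgM; first exact: cvg_cst.
    apply: cvgV; first exact: d1.
    apply: cvgD; first exact: cvg_cst.
    apply: (@continuous_comp _ _ _ (fun x => x - w) (fun y => y ^+ 2)); last exact: exprn_continuous.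
    by apply: cvgB; [exact: cvg_id|exact: cvg_cst].
  - by mfun.
  - move=> x w; rewrite normrM normr_nat mulrC ger0_norm//.
    by apply: ler_wpM2l; [exact: ler0n|exact: Pb].
  - exact: intg_itv.
have iP m x : intg m (fun w => P e (x - w)).
  by apply: (@finite_intg _ _ (2 / e)); [mfun|move=> w; rewrite ger0_norm].
rewrite !key; apply: Rintg_ext => x.
by rewrite (RintgZr _ (iP m1 x)) (RintgZr _ (iP m2 x)) eq_Poisson.
Qed.

(** The step is shifted by 1/(n+1) and scaled by (n+1)^2: at [w = t] the argument is n+1, so the
    limit there is pi/2 rather than 0. Differences of such limits are indicators of half-open
    intervals []c, d]]. *)
Lemma atan_step_cvg (t w : R) :
  atan ((t + n.+1%:R^-1 - w) * n.+1%:R ^+ 2) @[n --> \oo] --> (if w <= t then pi / 2 else - (pi / 2) : R).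
Proof.
have E n : (t + n.+1%:R^-1 - w) * n.+1%:R ^+ 2 = n.+1%:R * (1 + (t - w) * n.+1%:R) :> R.
  have k0 : (n.+1%:R : R) != 0 by rewrite pnatr_eq0.
  by move: k0; set k := n.+1%:R => k0; field.
under eq_fun do rewrite E.
have ny : (n.+1%:R : R) @[n --> \oo] --> +oo.
  by apply/cvgryPge => A; near=> n; rewrite (@le_trans _ _ n%:R)// ?ler_nat//; near: n; exact: nbhs_infty_ger.
case: (lerP w t) => wt.
  apply: (cvg_comp _ _ _ (@cvgy_atan R)).
  apply/cvgryPge => A; move/cvgryPge : ny => /(_ A); apply: filterS => n An.
  apply: (le_trans An); rewrite ler_peMr// lerDl mulr_ge0// subr_ge0//.
have h : - atan (n.+1%:R * ((w - t) * n.+1%:R - 1)) @[n --> \oo] --> - (pi / 2 : R).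
  apply: cvgN; apply: (cvg_comp _ _ _ (@cvgy_atan R)).
  apply/cvgryPge => A; have wt0 : 0 < w - t by rewrite subr_gt0.
  have ny' := ny; move/cvgryPge : ny' => /(_ `|A|) h2A; move/cvgryPge : ny => /(_ (2 / (w - t))) h1A.
  apply: filterS2 h1A h2A => n h1 h2; apply: (le_trans (ler_norm A)); apply: (le_trans h2).
  rewrite ler_peMr//; move: h1; rewrite ler_pdivrMr// mulrC; lra.
apply: cvg_trans h; apply: near_eq_cvg; apply: nearW => n.
by rewrite -atanN; congr atan; ring.
Unshelve. all: by end_near. Qed.

Lemma eq_itv (c d : R) : c <= d -> m1 `]c, d]%classic = m2 `]c, d]%classic.
Proof.
move=> cd.
have cv m : (fun n => Rintegral m setT (fun w => 2 * atan ((d + n.+1%:R^-1 - w) / (n.+1%:R ^- 2))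
     - 2 * atan ((c + n.+1%:R^-1 - w) / (n.+1%:R ^- 2)))) @ \oo -->
   Rintegral m setT (fun w => 2 * pi * (\1_(`]c, d]%classic) w : R)).
  have [||||_] := @RDCT _ _ _ m (fun n w => 2 * atan ((d + n.+1%:R^-1 - w) / (n.+1%:R ^- 2))
     - 2 * atan ((c + n.+1%:R^-1 - w) / (n.+1%:R ^- 2))) (fun w => 2 * pi * (\1_(`]c, d]%classic) w : R))
     (fun=> 2 * pi); last by [].
  - by move=> n; mfun.
  - move=> w; rewrite (_ : 2 * pi * _ = 2 * (if w <= d then pi / 2 else - (pi / 2)) -
        2 * (if w <= c then pi / 2 else - (pi / 2))).
      under eq_fun do rewrite !invrK.
      by apply: cvgB; apply: cvgM; try exact: cvg_cst; exact: atan_step_cvg.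
    rewrite indicE mem_setE /= in_itv /=; case: (lerP w c) => wc /=.
      by rewrite (le_trans wc cd) mulr0 subrr.
    by case: (w <= d) => /=; [rewrite mulr1|rewrite mulr0]; field.
  - move=> n w; set a := atan _; set b := atan _.
    have ha : - (pi / 2) < a < pi / 2 by rewrite atan_gtNpi2 atan_ltpi2.
    have hb : - (pi / 2) < b < pi / 2 by rewrite atan_gtNpi2 atan_ltpi2.
    rewrite ler_norml; lra.
  - by apply: finite_measure_integrable_cst.
have E : (fun n => Rintegral m1 setT (fun w => 2 * atan ((d + n.+1%:R^-1 - w) / (n.+1%:R ^- 2))
     - 2 * atan ((c + n.+1%:R^-1 - w) / (n.+1%:R ^- 2)))) =
   (fun n => Rintegral m2 setT (fun w => 2 * atan ((d + n.+1%:R^-1 - w) / (n.+1%:R ^- 2))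
     - 2 * atan ((c + n.+1%:R^-1 - w) / (n.+1%:R ^- 2)))).
  apply/funext => n; apply: eq_atan; last by rewrite lerD2r.
  by rewrite invr_gt0 exprn_gt0.
have c1 := cv m1; have c2 := cv m2; rewrite E in c1.
have L : Rintegral m1 setT (fun w => 2 * pi * (\1_(`]c, d]%classic) w : R)) =
  Rintegral m2 setT (fun w => 2 * pi * (\1_(`]c, d]%classic) w : R)).
  exact: (cvg_unique _ c1 c2).
have fE m : Rintegral m setT (fun w => 2 * pi * (\1_(`]c, d]%classic) w : R)) = 2 * pi * fine (m `]c, d]%classic).
  rewrite RintgZ; first by rewrite /Rintegral integral_indic ?setIT.
  by apply: (@finite_intg _ _ 1); [exact: measurable_indic|move=> w; rewrite indicE normr_nat lern1; case: (_ \in _)].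
have h2pi : 2 * pi != 0 :> R by rewrite mulf_neq0// gt_eqF// pi_gt0.
move: L; rewrite !fE => /(mulfI h2pi) h.
have fm m : m `]c, d]%classic \is a fin_num by apply: fin_num_measure.
by rewrite -(fineK (fm m1)) -(fineK (fm m2)) h.
Qed.

Lemma eq_finite_measure (A : set R) : measurable A -> m1 A = m2 A.
Proof.
apply: (@measure_unique _ R _ (@ocitv R) (fun n => `]- n%:R, n%:R]%classic)).
- by [].
- exact: ocitvI.
- by move=> n; exact: is_ocitv.
- apply/seteqP; split => // x _.
  have [n hn] : exists n : nat, `|x| < n%:R.
    by exists (Num.truncn `|x|).+1; exact: truncnS_gt.
  exists n => //=; rewrite in_itv /=; move: hn; rewrite ltr_norml => /andP[-> /ltW ->].
  by [].
- move=> _ [[c d] _ <-] /=; case: (lerP c d) => cd; first exact: eq_itv.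
  by rewrite set_itv_ge ?measure0// bnd_simp -leNgt ltW.
- by move=> n; rewrite -ge0_fin_numE//; apply: fin_num_measure.
Qed.

End CharacteristicFunction.

(** * Gaussian test functions *)

Section Gaussian.
Variable R : realType.
Local Notation leb := (@lebesgue_measure R).

Definition gaussian (c a t : R) : R := expR (- (c * (t - a) ^+ 2)).

Lemma gaussian_gt0 c a t : 0 < gaussian c a t. Proof. exact: expR_gt0. Qed.

(** Polynomials times a fixed Gaussian are closed under differentiation, so it suffices to bound
    functions of this form. *)
Let gpoly (c a : R) (p : {poly R}) (t : R) : R := p.[t - a] * gaussian c a t.

Let gpoly_is_derive c a (p : {poly R}) (x : R) :
  is_derive x 1 (gpoly c a p) (gpoly c a (p^`() - (2 * c)%:P * ('X * p)) x).
Proof.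
have h1 : is_derive x 1 (fun t => p.[t - a]) p^`().[x - a].
  have hs : is_derive x 1 (fun t => t - a) (1 : R) by apply: is_derive_eq; rewrite ?subr0.
  by have := @is_derive1_comp R (horner p) (fun t => t - a) x _ _ (is_derive_poly p (x - a)) hs; rewrite mulr1.
have h2 : is_derive x 1 (gaussian c a) (- (2 * c * (x - a)) * gaussian c a x).
  rewrite /gaussian; apply: is_derive_eq; rewrite /GRing.scale /=; ring.
rewrite /gpoly; apply: is_derive_eq; rewrite /GRing.scale /= hornerD hornerN !hornerM hornerC hornerX; ring.
Qed.

Let gpoly_derive c a (p : {poly R}) : derive1 (gpoly c a p) =
  gpoly c a (p^`() - (2 * c)%:P * ('X * p)).
Proof. by apply/funext => x; rewrite derive1E; apply: derive_val; exact: gpoly_is_derive. Qed.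

Let gpoly_derivable c a (p : {poly R}) (x : R) : derivable (gpoly c a p) x 1.
Proof. by apply: ex_derive; exact: gpoly_is_derive. Qed.

Let gpoly_derive1n c a n : forall p : {poly R},
  exists q : {poly R}, derive1n n (gpoly c a p) = gpoly c a q.
Proof.
elim: n => [|n IH] p; first by exists p.
by have [q hq] := IH p; rewrite derive1nS hq gpoly_derive; exists (q^`() - (2 * c)%:P * ('X * q)).
Qed.

Let monomial_bounded c (n : nat) : 0 < c -> exists C, forall y : R, `|y ^+ n * expR (- (c * y ^+ 2))| <= C.
Proof.
(* From [|y| ^+ n <= 1 + y ^+ (2 * n.+1)] and the term of degree [n.+1] in the exponential series of
   [c * y ^+ 2]. *)
move=> c0; exists (1 + (n.+1)`!%:R / c ^+ n.+1) => y.
have cy : 0 <= c * y ^+ 2 by rewrite mulr_ge0 ?sqr_ge0// ltW.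
have cn : 0 < c ^+ n.+1 by rewrite exprn_gt0.
have f0 : 0 < (n.+1)`!%:R :> R by rewrite ltr0n fact_gt0.
have yn : 0 <= y ^+ 2 ^+ n.+1 by rewrite exprn_ge0 ?sqr_ge0.
have h1 : y ^+ 2 ^+ n.+1 <= (n.+1)`!%:R / c ^+ n.+1 * expR (c * y ^+ 2).
  have := expR_ge1Dxn n cy; rewrite exprMn => h.
  rewrite mulrAC ler_pdivlMr// -ler_pdivrMl// mulrC; apply: le_trans h.
  by rewrite [y ^+ 2 ^+ _ * _]mulrC lerDr.
have h2 : `|y| ^+ n <= 1 + y ^+ 2 ^+ n.+1.
  case: (lerP `|y| 1) => y1; first by rewrite (le_trans (exprn_ile1 _ _ y1))// lerDl.
  rewrite -exprM -[X in _ <= _ + X]ger0_norm ?exprM// -exprM normrX.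
  apply: (@le_trans _ _ (`|y| ^+ (2 * n.+1))); last by rewrite lerDr.
  by apply: ler_weXn2l; [exact: ltW|rewrite mul2n -addnn -addSnnS leq_addl].
have e1 : 1 <= expR (c * y ^+ 2) by apply: le_trans (expR_ge1Dx _); rewrite lerDl.
rewrite normrM normrX (gtr0_norm (expR_gt0 _)) expRN ler_pdivrMr ?expR_gt0// mulrDl mul1r.
by apply: (le_trans h2); apply: lerD.
Qed.

Let poly_bounded c (p : {poly R}) : 0 < c -> exists C, forall y : R, `|p.[y] * expR (- (c * y ^+ 2))| <= C.
Proof.
(* A power [y ^+ j] is carried along so that in the induction on [p * 'X + k] the new factor joins
   it. *)
move=> c0; suff h j : exists C, forall y : R, `|y ^+ j * p.[y] * expR (- (c * y ^+ 2))| <= C.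
  by have [C hC] := h 0%N; exists C => y; have := hC y; rewrite expr0 mul1r.
elim/poly_ind: p j => [|p k IH] j.
  by exists 0 => y; rewrite horner0 mulr0 mul0r normr0.
have [C1 h1] := IH j.+1; have [C2 h2] := @monomial_bounded c j c0.
exists (C1 + `|k| * C2) => y; rewrite hornerMXaddC.
rewrite (_ : _ * _ * _ = y ^+ j.+1 * p.[y] * expR (- (c * y ^+ 2)) + k * (y ^+ j * expR (- (c * y ^+ 2)))).
  by apply: (le_trans (ler_normD _ _)); apply: lerD; [exact: h1|rewrite normrM ler_wpM2l].
rewrite [y ^+ j.+1]exprS; ring.
Qed.

Lemma schwartz_gaussian c a : 0 < c -> schwartz (gaussian c a).
Proof.
move=> c0; have -> : gaussian c a = gpoly c a 1.
  by apply/funext => t; rewrite /gpoly hornerC mul1r.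
split=> [n x|k n]; have [q ->] := @gpoly_derive1n c a n 1; first exact: gpoly_derivable.
(* In the variable [x - a] of the Gaussian, the weight [x ^+ k] is the polynomial
   [('X + a) ^+ k]. *)
have [C hC] := @poly_bounded c (('X + a%:P) ^+ k * q) c0.
exists C => x; have := hC (x - a).
by rewrite hornerM horner_exp hornerD hornerX hornerC subrK -mulrA /gpoly /gaussian.
Qed.

Lemma gaussian_shift c a t : gaussian c a (t + a) = gaussian c 0 t.
Proof. by rewrite /gaussian addrK subr0. Qed.

Let intg_gaussian c a : 0 < c -> intg leb (gaussian c a).
Proof. by move=> c0; apply: schwartz_intg; exact: schwartz_gaussian. Qed.

Lemma gaussian_sin0 c w : 0 < c -> Rintegral leb setT (fun t => gaussian c 0 t * sin (t * w)) = 0.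
Proof.
move=> c0; have mg := intg_measurable (intg_gaussian 0 c0).
have ig : intg leb (fun t => gaussian c 0 t * sin (t * w)).
  apply: (intg_dom _ _ (intg_gaussian 0 c0)); first by mfun.
  by move=> t; rewrite normrM (gtr0_norm (gaussian_gt0 _ _ _)) ler_piMr// ?sin_max// ltW ?gaussian_gt0.
have := Rintg_reflect ig.
rewrite (_ : Rintegral _ _ _ = - Rintegral leb setT (fun t => gaussian c 0 t * sin (t * w))).
  by lra.
by rewrite -RintgN//; apply: Rintg_ext => t; rewrite mulNr sinN mulrN /gaussian !subr0 sqrrN.
Qed.

Lemma ft_gaussian_shift c a w : 0 < c ->
  ft_re (gaussian c a) w = cos (a * w) * ft_re (gaussian c 0) w /\
  ft_im (gaussian c a) w = - (sin (a * w) * ft_re (gaussian c 0) w).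
Proof.
move=> c0; have ia := intg_gaussian a c0; have i0 := intg_gaussian 0 c0.
have m0 := intg_measurable i0; have ma := intg_measurable ia.
have ic b : intg leb (fun t => gaussian c b t * cos (t * w)).
  apply: (intg_dom _ _ (intg_gaussian b c0)); first by have mb := intg_measurable (intg_gaussian b c0); mfun.
  by move=> t; rewrite normrM (gtr0_norm (gaussian_gt0 _ _ _)) ler_piMr// ?cos_max// ltW ?gaussian_gt0.
have is_ b : intg leb (fun t => gaussian c b t * sin (t * w)).
  apply: (intg_dom _ _ (intg_gaussian b c0)); first by have mb := intg_measurable (intg_gaussian b c0); mfun.
  by move=> t; rewrite normrM (gtr0_norm (gaussian_gt0 _ _ _)) ler_piMr// ?sin_max// ltW ?gaussian_gt0.
have Z := gaussian_sin0 w c0.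
split; rewrite /ft_re /ft_im.
- rewrite -(Rintg_shift a (ic a)).
  rewrite (_ : Rintegral _ _ _ = Rintegral leb setT (fun t => cos (a * w) * (gaussian c 0 t * cos (t * w))
     - sin (a * w) * (gaussian c 0 t * sin (t * w)))).
    by rewrite (RintgB (intgZ _ (ic 0)) (intgZ _ (is_ 0))) (RintgZ _ (ic 0)) (RintgZ _ (is_ 0)) Z mulr0 subr0.
  by apply: Rintg_ext => t; rewrite gaussian_shift mulrDl cosD; ring.
- rewrite -(Rintg_shift a (is_ a)); congr (- _).
  rewrite (_ : Rintegral _ _ _ = Rintegral leb setT (fun t => sin (a * w) * (gaussian c 0 t * cos (t * w))
     + cos (a * w) * (gaussian c 0 t * sin (t * w)))).
    by rewrite (RintgD (intgZ _ (ic 0)) (intgZ _ (is_ 0))) (RintgZ _ (ic 0)) (RintgZ _ (is_ 0)) Z mulr0 addr0.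
  by apply: Rintg_ext => t; rewrite gaussian_shift mulrDl sinD; ring.
Qed.

Lemma ft_im_gaussian c w : 0 < c -> ft_im (gaussian c 0) w = 0.
Proof. by move=> c0; have [_ ->] := ft_gaussian_shift 0 w c0; rewrite mul0r sin0 mul0r oppr0. Qed.

Lemma normr_sin_le (x : R) : `|sin x| <= `|x|.
Proof.
wlog x0 : x / 0 <= x.
  move=> h; case: (lerP 0 x) => [|/ltW] x0; first exact: h.
  by rewrite -normrN -sinN -[X in _ <= X]normrN h// oppr_ge0.
have d (z : R) : is_derive z 1 sin (cos z) by exact: is_derive_sin.
have [z _ E] := @MVT_segment R sin cos 0 x x0 (fun z _ => d z)
  (continuous_subspaceT (@continuous_sin R)).
by move: E; rewrite sin0 !subr0 => ->; rewrite normrM ler_piMl// cos_max.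
Qed.

Lemma one_sub_cos_le (x : R) : 1 - cos x <= x ^+ 2 / 2.
Proof.
have -> : x = (x / 2) *+ 2 by rewrite mulr2n; field.
rewrite cos_mulr2n; have := cos2Dsin2 (x / 2).
have : sin (x / 2) ^+ 2 <= (x / 2) ^+ 2.
  by rewrite -(real_normK (num_real (sin _))) -[X in _ <= X](real_normK (num_real _)) lerXn2r ?nnegrE// normr_sin_le.
rewrite !mulr2n; set y := x / 2.
have -> : (y + y) ^+ 2 / 2 = 2 * y ^+ 2 by field.
lra.
Qed.

(** A lower bound in place of the explicit transform: [1 - cos x <= x ^+ 2 / 2], and the second
    moment of the Gaussian is its mass divided by [2 * c], so the transform is at least (1 - w^2 /
    (4 c)) times the mass. *)
Lemma ft_gaussian_gt0 c w : w ^+ 2 < 4 * c -> 0 < ft_re (gaussian c 0) w.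
Proof.
move=> wc; have c0 : 0 < c by have := sqr_ge0 w; lra.
have sg := schwartz_gaussian 0 c0.
have i0 := intg_gaussian 0 c0; have m0 := intg_measurable i0.
have [C C0 hC] := schwartz_decay 2 sg.
have i2 : intg leb (fun t => t ^+ 2 * gaussian c 0 t).
  apply: (intg_dom _ _ (intgZ C (@intg_wt R))); first by mfun.
  move=> t; rewrite normrM normrX real_normK ?num_real//.
  apply: (@le_trans _ _ (t ^+ 2 * (C * wt t ^+ 2))); first by rewrite ler_wpM2l ?sqr_ge0.
  rewrite mulrCA ler_wpM2l// expr2 mulrA ler_piMl ?wt_ge0//.
  by rewrite /wt ler_pdivrMr ?wt_denom_gt0// mul1r lerDr.
have ic : intg leb (fun t => gaussian c 0 t * cos (t * w)).
  apply: (intg_dom _ _ i0); first by mfun.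
  by move=> t; rewrite normrM (gtr0_norm (gaussian_gt0 _ _ _)) ler_piMr// ?cos_max// ltW ?gaussian_gt0.
(* The integrand is the derivative of [t * gaussian c 0 t], which vanishes at both ends; this gives
   the second moment. *)
have E : Rintegral leb setT (fun t => gaussian c 0 t - 2 * c * (t ^+ 2 * gaussian c 0 t)) = 0.
  have dF (t : R) : is_derive t 1 (fun t => t * gaussian c 0 t) (gaussian c 0 t - 2 * c * (t ^+ 2 * gaussian c 0 t)).
    rewrite /gaussian; apply: is_derive_eq; rewrite /GRing.scale /=; ring.
  have cg := schwartz_continuous sg.
  have tw (t : R) : `|t * gaussian c 0 t| <= C * wt t.
    rewrite normrM; apply: (@le_trans _ _ (`|t| * (C * wt t ^+ 2))); first by rewrite ler_wpM2l.
    rewrite mulrCA ler_wpM2l// expr2 mulrA ler_piMl ?wt_ge0//.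
    rewrite /wt ler_pdivrMr ?wt_denom_gt0// mul1r.
    have := sqr_ge0 (`|t| - 1); rewrite -(real_normK (num_real t)); have := normr_ge0 t; nra.
  have [wp wm] := @wt_cvg0 R.
  have cvp (F : set_system R) (FF : ProperFilter F) : wt x @[x --> F] --> 0 -> (fun t => t * gaussian c 0 t) x @[x --> F] --> (0 : R).
    move=> h; apply/norm_cvg0P; apply: (@squeeze_cvgr _ _ _ _ (cst 0) (fun t => C * wt t)).
    - by apply: nearW => t; rewrite normr_ge0 tw.
    - exact: cvg_cst.
    - by rewrite -[X in _ --> X](mulr0 C); apply: cvgM => //; exact: cvg_cst.
  rewrite (Rintg_FTC_line _ _ dF (l := 0) (m := 0)) ?subrr//.
  - move=> t; apply: cvgB; first exact: cg.
    apply: cvgM; first exact: cvg_cst.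
    by apply: cvgM; [exact: exprn_continuous|exact: cg].
  - by apply: intgB => //; exact: intgZ.
  - exact: cvp.
  - exact: cvp.
move: E; rewrite (RintgB i0 (intgZ _ i2)) (RintgZ _ i2) => E.
have le1 : Rintegral leb setT (gaussian c 0) - w ^+ 2 / 2 * Rintegral leb setT (fun t => t ^+ 2 * gaussian c 0 t)
   <= ft_re (gaussian c 0) w.
  rewrite -(RintgZ _ i2) -(RintgB i0 (intgZ _ i2)); apply: Rintg_le => //.
    by apply: intgB => //; exact: intgZ.
  move=> t; have := one_sub_cos_le (t * w); have := gaussian_gt0 c 0 t; rewrite exprMn.
  set g := gaussian _ _ _; move=> g0 h.
  have : g * (1 - cos (t * w)) <= g * (t ^+ 2 * w ^+ 2 / 2) by rewrite ler_wpM2l// ltW.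
  lra.
have pos : 0 < Rintegral leb setT (gaussian c 0).
  have : Rintegral leb setT (fun t => expR (- c) * ((0 <= t) && (t <= 1))%:R) <= Rintegral leb setT (gaussian c 0).
    apply: Rintg_le => //; first by apply: intgZ; exact: intg_itv.
    move=> t; case: (boolP (_ && _)) => [/andP[t0 t1]|_]; last by rewrite mulr0 ltW ?gaussian_gt0.
    by rewrite mulr1 /gaussian subr0 ler_expR lerN2 ler_piMr ?(ltW c0)// exprn_ile1.
  rewrite (RintgZ _ (intg_itv 0 1)) Rintg_itv// subr0 mulr1; apply: lt_le_trans; exact: expR_gt0.
apply: lt_le_trans le1; set I := Rintegral _ _ _ in E pos *; set J := Rintegral _ _ _ in E *.
have hI : I = 2 * c * J by lra.
have J0 : 0 < J by move: pos; rewrite hI pmulr_rgt0// mulr_gt0.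
have : 0 < (4 * c - w ^+ 2) / 2 * J by rewrite mulr_gt0// divr_gt0// subr_gt0.
by rewrite hI; lra.
Qed.

End Gaussian.

(** * The memory kernel *)

Section SingularFrequency.
Variable R : realType.
Local Notation leb := (@lebesgue_measure R).
Variable kappa : R -> R.
Hypothesis kk : decreasing_kernel kappa.

(* The Gauss means of the convolution at frequency 0 control the integral of [kappa]
   over any bounded window, so their convergence forces [kappa] to be integrable. *)
Lemma gauss_ft_re0_intg phi (k : R) : schwartz phi -> 0 < k -> (forall u, 0 <= phi u) ->
  (forall u, 0 <= u <= 1 -> k <= phi u) ->
  cvg (gauss_ft_re (kconv kappa 1 phi) 0 @ at_right 0) -> intg leb kappa.
Proof.
move=> sp k_gt0 p0 pk /cvg_ex[l hl].
have mk := kernel_measurable kk; have k0 := kernel_ge0 kk.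
have mp := schwartz_measurable sp.
have /cvgrPdist_le /(_ 1 ltr01) [e0 /= e0_gt0 near0] := hl.
have hsg : (1 : R) = 1 \/ (1 : R) = -1 by left.
have main (N : nat) : Rintegral leb setT (fun s => kappa s * window N s) <= k^-1 * expR 1 * (l + 1).
  (* Below [e0], the Gauss mean is within 1 of its limit [l]; below [(1 + N)^-2], the damping is at
     least exp(-1) when [0 <= u <= 1] and [0 < s <= N]. *)
  pose e := Num.min (e0 / 2) ((1 + N%:R) ^- 2).
  have N1 : 0 < (1 + N%:R : R) by rewrite ltr_wpDr.
  have e_gt0 : 0 < e by rewrite /e lt_min divr_gt0//= invr_gt0 exprn_gt0.
  have ee0 : e < e0 by rewrite /e gt_min ltr_pdivrMr// ltr_pMr// ltr1n.
  pose h t := expR (- (e * t ^+ 2)).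
  have mh : measurable_fun setT h by rewrite /h; mfun.
  have h0 t : 0 <= h t by exact: expR_ge0.
  have [c c0 hc] : exists2 c, 0 <= c & forall t, `|h t| <= c ^+ 2 * wt t ^+ 2.
    have e2 : 0 < e / 2 by rewrite divr_gt0.
    have [c c0 hc] := gauss_wt e2; exists c => // t.
    rewrite ger0_norm// -exprMn /h (_ : - (e * t ^+ 2) = - (e / 2 * t ^+ 2) * 2%:R); last by field.
    by rewrite expRM_natr lerXn2r ?nnegrE ?expR_ge0 ?mulr_ge0 ?wt_ge0.
  have [_ i2 E] := kconv_Fubini kk hsg sp mh hc.
  have lim_le : Rintegral leb setT (fun t => kconv kappa 1 phi t * h t) <= l + 1.
    have := near0 e; rewrite /= sub0r normrN (gtr0_norm e_gt0) => /(_ ee0 e_gt0).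
    rewrite /gauss_ft_re (_ : Rintegral _ _ _ = Rintegral leb setT (fun t => kconv kappa 1 phi t * h t)).
      by rewrite ler_norml => /andP[+ _]; lra.
    by apply: Rintg_ext => t; rewrite mulr0 cos0 mulr1.
  rewrite E in lim_le.
  apply: le_trans (ler_wpM2l _ lim_le); last by rewrite mulr_ge0 ?invr_ge0 ?expR_ge0// ltW.
  have iphi := schwartz_intg sp.
  have h1 t : h t <= 1 by exact: gauss_le1 (ltW e_gt0).
  have iph s : intg leb (fun u => phi u * h (u + 1 * s)).
    apply: (intg_dom _ _ iphi); first by mfun.
    by move=> u; rewrite normrM !ger0_norm// ler_piMr.
  rewrite -(RintgZ _ i2); apply: Rintg_le; last first.
  - move=> s; rewrite /window; case: (boolP (_ && _)) => [/andP[_ sN]|_]; last first.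
      rewrite mulr0 mulr_ge0// ?mulr_ge0 ?invr_ge0 ?expR_ge0 ?(ltW k_gt0)//.
      by rewrite -[X in X <= _](Rintg0 leb); apply: Rintg_le; [exact: intg0|exact: iph|move=> u; exact: mulr_ge0].
    case: (lerP s 0) => [s0|s_gt0]; first by rewrite (kernel_le0 kk s0) !mul0r mulr0.
    rewrite mulr1 mulrCA ler_peMr//.
    have low : k * expR (-1) <= Rintegral leb setT (fun u => phi u * h (u + 1 * s)).
      rewrite -[X in X <= _]mulr1 -[X in _ * X](subr0 1) -Rintg_itv//.
      rewrite -(RintgZ _ (intg_itv 0 1)); apply: Rintg_le; [by apply: intgZ; exact: intg_itv|exact: iph|].
      move=> u; case: (boolP (_ && _)) => [u01|_]; last by rewrite mulr0 mulr_ge0.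
      rewrite mulr1; apply: ler_pM; rewrite ?expR_ge0 ?pk// ?(ltW k_gt0)//.
      rewrite /h ler_expR lerN2 mul1r.
      have /andP[u0 u1] := u01.
      apply: (@le_trans _ _ (e * (1 + N%:R) ^+ 2)).
        by rewrite ler_wpM2l ?(ltW e_gt0)// lerXn2r ?nnegrE ?addr_ge0// ?(ltW s_gt0)// lerD.
      by rewrite -ler_pdivlMr ?exprn_gt0// mul1r /e ge_min lexx orbT.
    rewrite -mulrA ler_pdivlMl// mulr1.
    have := ler_wpM2l (expR_ge0 1) low; rewrite mulrCA -expRD subrr expR0 mulr1.
    by [].
  - exact: intgZ.
  - apply: (intg_ext _ (kernel_window_intg kk N%:R)) => s; rewrite /window.
    case: (lerP 0 s) => s0; last by rewrite (kernel_le0 kk (ltW s0)) !mul0r.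
    by rewrite (_ : - N%:R <= s) //; apply: le_trans s0; rewrite oppr_le0.
apply: (ge0_intg_exhaust mk k0 _ main) => N.
apply: (intg_ext _ (kernel_window_intg kk N%:R)) => s; rewrite /window.
case: (lerP 0 s) => s0; last by rewrite (kernel_le0 kk (ltW s0)) !mul0r.
by rewrite (_ : - N%:R <= s) //; apply: le_trans s0; rewrite oppr_le0.
Qed.

(** By monotonicity [kappa] is at least [kappa 1] on [1/2, 1], an interval that avoids the origin;
    the integral is thus at least [kappa 1 / 2]. *)
Lemma Kc0_gt0 : intg leb kappa -> 0 < kappa 1 -> 0 < Kc kappa 0.
Proof.
move=> ik k1; have mk := kernel_measurable kk; have k0 := kernel_ge0 kk.
have c : Kpart kappa 0 0 x @[x --> +oo] --> Kph kappa 0 0.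
  by apply: Kpart_cvg => //; exact: nonsingular_intg.
rewrite -(Kph0 kappa 0).
apply: (@lt_le_trans _ _ (kappa 1 / 2)); first by rewrite divr_gt0.
apply: (cvgr_to_ge c); exists 1; split; first exact: num_real.
move=> T /ltW T1; rewrite /Kpart.
have -> : kappa 1 / 2 = kappa 1 * (1 - 2^-1) by field.
rewrite -Rintg_itv; last by lra.
rewrite -RintgZ; last exact: intg_itv.
apply: Rintg_le.
- by apply: intgZ; exact: intg_itv.
- by apply: (intg_ext _ (kernel_window_intg kk T)) => s; rewrite mulr0 addr0 cos0 mulr1.
- move=> s; rewrite mulr0 addr0 cos0 mulr1; case: (boolP (_ && _)) => [/andP[s1 s2]|_].
    have s0 : 0 < s by apply: lt_le_trans s1; lra.
    by rewrite (ltW s0) (le_trans s2 T1) !mulr1 (kernel_decr kk).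
  by rewrite mulr0 mulr_ge0.
Qed.

End SingularFrequency.

Section PowerTail.
Variable R : realType.
Local Notation leb := (@lebesgue_measure R).

(** Integrability of s^(-1-a) at infinity. The function a x (1 + x^2)^(-a/2-1) has the bounded
    primitive -(1 + x^2)^(-a/2), smooth on the whole line, and is comparable to that power for
    [1 <= s]. *)
Lemma intg_power_tail (a : R) : 0 < a ->
  exists2 f : R -> R, intg leb f /\ (forall s, 0 <= f s) &
    exists2 D : R, 0 < D & forall s, 1 <= s -> D * (s `^ a)^-1 * s^-1 <= f s.
Proof.
move=> a0; pose E (b x : R) := expR (- (b * ln (1 + x ^+ 2))).
pose f0 (x : R) := a * x * E (a / 2 + 1) x.
have d0 (x : R) : 0 < 1 + x ^+ 2 := wt_denom_gt0 x.
have dE b (x : R) : is_derive x 1 (E b) (- (b * (2 * x / (1 + x ^+ 2))) * E b x).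
  have hs : is_derive x 1 (fun t : R => 1 + t ^+ 2) (2 * x).
    by apply: is_derive_eq; rewrite /GRing.scale /=; ring.
  have hl := @is_derive1_comp R (@ln R) (fun t => 1 + t ^+ 2) x _ _ (is_derive1_ln (d0 x)) hs.
  rewrite /comp in hl; rewrite /E; apply: is_derive_eq; rewrite /GRing.scale /=.
  by field; rewrite gt_eqF.
have cE b : continuous (E b).
  by move=> x; apply: differentiable_continuous; apply/derivable1_diffP; exact: ex_derive.
have cf0 : continuous f0.
  move=> x; apply: cvgM; last exact: cE.
  by apply: cvgM; [exact: cvg_cst|exact: cvg_id].
have dF (x : R) : is_derive x 1 (fun x => - E (a / 2) x) (f0 x).
  have EE : E (a / 2 + 1) x = E (a / 2) x / (1 + x ^+ 2).
    by rewrite /E mulrDl mul1r opprD expRD [expR (- ln _)]expRN lnK ?posrE.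
  have h := dE (a / 2) x; apply: is_derive_eq; rewrite /f0 EE.
  by field; rewrite gt_eqF.
have mf0 : measurable_fun setT f0 by exact: continuous_measurable_fun.
pose f s := f0 s * (0 <= s)%R%:R.
have f_ge0 s : 0 <= f s.
  rewrite /f; case: (lerP 0 s) => s0; last by rewrite mulr0.
  by rewrite mulr1 !mulr_ge0 ?expR_ge0// ltW.
have fw (n : nat) : (fun x => f x * window n x) = (fun x => f0 x * ((0 <= x) && (x <= n%:R))%:R).
  apply/funext => s; rewrite /f /window; case: (lerP 0 s) => s0; last by rewrite !mulr0 mul0r.
  by rewrite mulr1 (_ : - n%:R <= s) //; apply: le_trans s0; rewrite oppr_le0.
exists f.
  split => //; apply: (@ge0_intg_exhaust _ _ 1).
  - by rewrite /f; mfun.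
  - exact: f_ge0.
  - by move=> n; rewrite fw; exact: continuous_intg_itv.
  - move=> n; rewrite fw (Rintg_FTC (ler0n _ n) cf0 dF).
    rewrite /E expr0n /= addr0 ln1 mulr0 oppr0 expR0 opprK.
    by rewrite gerDr oppr_le0 expR_ge0.
(* The factor 2^(-a/2-1) comes from [1 + s ^+ 2 <= 2 * s ^+ 2]. *)
exists (a * expR (- ((a / 2 + 1) * ln 2))); first by rewrite mulr_gt0// expR_gt0.
move=> s s1; have s0 : 0 < s by apply: lt_le_trans s1.
rewrite /f (ltW s0) mulr1 /f0 /E.
have hl : ln (1 + s ^+ 2) <= ln 2 + 2 * ln s.
  have -> : 2 * ln s = ln (s ^+ 2) by rewrite lnXn// mulr_natl.
  rewrite -lnM ?posrE ?exprn_gt0// ler_ln ?posrE ?mulr_gt0 ?exprn_gt0//.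
  by have := exprn_ege1 2 s1; lra.
rewrite -!mulrA ler_wpM2l ?(ltW a0)//.
rewrite /powR gt_eqF// -expRN.
have -> : s^-1 = s * expR (- (2 * ln s)).
  by rewrite mulr_natl -lnXn// expRN lnK ?posrE ?exprn_gt0//; field; rewrite gt_eqF.
rewrite [X in X <= _](_ : _ = s * (expR (- ((a / 2 + 1) * ln 2)) * expR (- (a * ln s)) * expR (- (2 * ln s)))); last by ring.
rewrite ler_wpM2l ?(ltW s0)// -!expRD ler_expR.
have : (a / 2 + 1) * ln (1 + s ^+ 2) <= (a / 2 + 1) * (ln 2 + 2 * ln s) by rewrite ler_wpM2l// addr_ge0// divr_ge0 ?(ltW a0).
lra.
Qed.

End PowerTail.

(** * From the conditions on K to a decreasing kernel *)

Section HalfKernel.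
Variable R : realType.
Local Notation leb := (@lebesgue_measure R).
Variable K : R -> \bar R.

Definition half_kernel (s : R) : R := Kr K s * (0 < s)%R%:R.

Lemma half_kernel_gt0E s : 0 < s -> half_kernel s = Kr K s.
Proof. by move=> s0; rewrite /half_kernel s0 mulr1. Qed.

Lemma half_kernel_le0 s : s <= 0 -> half_kernel s = 0.
Proof. by move=> s0; rewrite /half_kernel ltNge s0 mulr0. Qed.

Hypothesis cI : condI K.
Hypothesis cIV : condIV K.

Lemma Kr_ge0 t : 0 <= Kr K t.
Proof.
have [[_ [K0 Kp]] _ _ _] := cI; apply: fine_ge0.
by have [->//|t0] := eqVneq t 0; apply/ltW; exact: (Kp t t0).1.
Qed.

Lemma Kr_gt0 t : t != 0 -> 0 < Kr K t.
Proof.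
have [[_ [_ Kp]] _ _ _] := cI => t0; have [h1 h2] := Kp t t0.
by apply: fine_gt0; rewrite h1 h2.
Qed.

Lemma KrE t : t != 0 -> K t = (Kr K t)%:E.
Proof.
have [[_ [_ Kp]] _ _ _] := cI => t0; have [h1 h2] := Kp t t0.
by rewrite /Kr fineK// ge0_fin_numE// ltW.
Qed.

Lemma KrN t : Kr K (- t) = Kr K t.
Proof. by have [[KN _] _ _ _] := cI; rewrite /Kr KN. Qed.

Lemma Kr_half t : t != 0 -> Kr K t = half_kernel t + half_kernel (- t).
Proof.
case: (ltgtP t 0) => // t0 _.
  by rewrite half_kernel_le0 ?(ltW t0)// add0r half_kernel_gt0E ?KrN// oppr_gt0.
by rewrite half_kernel_gt0E// half_kernel_le0 ?addr0// oppr_le0 ltW.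
Qed.

Lemma measurable_kernel : measurable_fun setT K.
Proof.
have [_ _ Kint _] := cI.
have -> : [set: R] = \bigcup_(n : nat) [set x : R | - n%:R <= x <= n%:R].
  apply/seteqP; split => // x _.
  have [n hn] : exists n : nat, `|x| < n%:R by exists (Num.truncn `|x|).+1; exact: truncnS_gt.
  by exists n => //=; rewrite -ler_norml ltW.
have E (a b : R) : [set x : R | a <= x <= b] = `[a, b]%classic.
  by apply/seteqP; split => x /=; rewrite in_itv.
apply/measurable_fun_bigcup => n; first by rewrite E.
exact: (measurable_int leb (Kint _ _)).
Qed.

Lemma measurable_Kr : measurable_fun setT (Kr K).
Proof. by apply: (measurableT_comp (fine_measurable measurableT)); exact: measurable_kernel. Qed.

Lemma measurable_half_kernel : measurable_fun setT half_kernel.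
Proof. by have mK := measurable_Kr; rewrite /half_kernel; mfun. Qed.

Lemma half_kernel_ge0 s : 0 <= half_kernel s.
Proof. by rewrite mulr_ge0// Kr_ge0. Qed.

(* If a convex function increased from [x] to [y], it would stay above its value at [y]
   from there on, which contradicts the limit [0] at infinity. *)
Lemma half_kernel_decr x y : 0 < x -> x <= y -> half_kernel y <= half_kernel x.
Proof.
move=> x0; rewrite le_eqVlt => /orP[/eqP->//|xy].
have y0 : 0 < y := lt_trans x0 xy.
rewrite !half_kernel_gt0E//; apply: contrapT => /negP; rewrite -ltNge => Kxy.
have [_ [cv _] _ _] := cI; have [_ convK _] := cIV.
suff : Kr K y <= 0 by rewrite leNgt (le_lt_trans (Kr_ge0 x) Kxy).
apply: (cvgr_to_ge cv); exists y; split; first exact: num_real.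
move=> z yz; have z0 : 0 < z := lt_trans y0 yz.
have xz := lt_trans xy yz; have zx : 0 < z - x by rewrite subr_gt0.
(* The weight for which [y = t * x + (1 - t) * z]. *)
pose t := (z - y) / (z - x).
have t0 : 0 <= t by rewrite divr_ge0// ?subr_ge0 ?(ltW yz)// ltW.
have t1 : t < 1 by rewrite /t ltr_pdivrMr// mul1r; lra.
have := convK x z t x0 z0 t0 (ltW t1).
have -> : t * x + (1 - t) * z = y by rewrite /t; field; rewrite gt_eqF.
move=> h; have : t * Kr K x <= t * Kr K y by rewrite ler_wpM2l// ltW.
move=> h2; have : (1 - t) * Kr K y <= (1 - t) * Kr K z by lra.
by rewrite ler_pM2l// subr_gt0.
Qed.

Lemma half_kernel_window_intg (T : R) : intg leb (fun s => half_kernel s * ((0 <= s) && (s <= T))%:R).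
Proof.
have [_ _ Kint _] := cI.
have m : measurable [set x : R | 0 <= x <= T].
  by rewrite (_ : [set x : R | 0 <= x <= T] = `[0, T]%classic)//; apply/seteqP; split => x /=; rewrite in_itv.
have h : leb.-integrable [set x : R | 0 <= x <= T] (EFin \o half_kernel).
  apply: (@le_integrable _ _ _ leb _ m _ _ _ _ (Kint 0 T)).
    by apply/measurable_EFinP; apply: measurable_funTS; exact: measurable_half_kernel.
  move=> x /= /andP[x0 _]; rewrite (ger0_norm (half_kernel_ge0 _)).
  have [->|xn] := eqVneq x 0; first by rewrite half_kernel_le0// abse_ge0.
  by rewrite KrE//= (ger0_norm (Kr_ge0 _)) half_kernel_gt0E// lt_def xn.
exact: ((intg_mkcond leb (p := fun s => (0 <= s) && (s <= T)) half_kernel m (fun x => iff_refl _)).1 h).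
Qed.

Lemma half_kernel_intg : leb.-integrable setT K -> intg leb half_kernel.
Proof.
move=> h; apply: (le_integrable measurableT _ _ h).
  by apply/measurable_EFinP; exact: measurable_half_kernel.
move=> x _ /=; rewrite (ger0_norm (half_kernel_ge0 _)).
have [->|x0] := eqVneq x 0; first by rewrite half_kernel_le0// abse_ge0.
rewrite KrE//= (ger0_norm (Kr_ge0 _)) lee_fin /half_kernel.
by case: (0 < x); rewrite ?mulr1 ?mulr0 ?Kr_ge0.
Qed.

Hypothesis cII_III : condII K \/ condIII K.

(** Under (III) the kernel is eventually at most (c+1) s^(-a), so the weight 1/(1+s) brings the tail
    down to the integrable s^(-1-a); bounded intervals are covered by local integrability. *)
Lemma half_kernel_weight_intg : intg leb (fun s => half_kernel s * (1 + `|s|)^-1).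
Proof.
have mk := measurable_half_kernel; have k0 := half_kernel_ge0.
have m1 : measurable_fun setT (fun s : R => (1 + `|s|)^-1).
  apply: continuous_measurable_fun => s; apply: cvgV; first by rewrite gt_eqF// ltr_wpDr.
  by apply: cvgD; [exact: cvg_cst|exact: norm_continuous].
have m : measurable_fun setT (fun s => half_kernel s * (1 + `|s|)^-1) by exact: measurable_funM.
have inv1 (s : R) : 0 <= (1 + `|s|)^-1 <= 1.
  by rewrite invr_ge0 addr_ge0//= invf_le1 ?lerDl// ltr_wpDr.
have norm_e (s : R) : `|half_kernel s * (1 + `|s|)^-1| = half_kernel s * (1 + `|s|)^-1.
  by have /andP[h _] := inv1 s; rewrite ger0_norm// mulr_ge0.
case: cII_III => [cII|[_ [a [c [a0 _ c0 lim]]]]].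
  apply: (intg_dom _ _ (half_kernel_intg cII)); first exact: m.
  move=> s.
  by have /andP[_ h] := inv1 s; rewrite norm_e ler_piMr.
have [f [fi f0] [D D0 hD]] := intg_power_tail a0.
have [M [_ hM]] : \forall t \near +oo, t `^ a * Kr K t <= c + 1.
  by apply: (cvgr_le _ lim); rewrite ltrDl.
(* The eventual bound holds only strictly beyond [M], hence the 1 added. *)
pose N := Num.max 1 (M + 1).
have N1 : 1 <= N by rewrite /N le_max lexx.
have NM : M < N by rewrite /N lt_max ltrDl ltr01 orbT.
apply: (intg_dom _ _ (intgD (half_kernel_window_intg N) (intgZ ((c + 1) / D) fi))); first exact: m.
move=> s.
rewrite norm_e; have /andP[i0 i1] := inv1 s.
have f' : 0 <= (c + 1) / D * f s by rewrite mulr_ge0// divr_ge0 ?addr_ge0// ltW.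
case: (lerP s 0) => [s0|s0].
  by rewrite half_kernel_le0// !mul0r add0r.
case: (lerP s N) => [sN|/ltW Ns].
  by rewrite (ltW s0) /= mulr1 -[X in X <= _]addr0 lerD// ler_piMr.
rewrite andbF mulr0 add0r.
have s1 := le_trans N1 Ns.
have h1 := hM s (lt_le_trans NM Ns).
have h2 := hD s s1.
have p0 : 0 < s `^ a by rewrite powR_gt0.
rewrite half_kernel_gt0E//.
apply: (@le_trans _ _ ((c + 1) * (s `^ a)^-1 * s^-1)).
  apply: ler_pM => //; first exact: Kr_ge0.
    by rewrite ler_pdivlMr// mulrC.
  by rewrite lef_pV2 ?posrE// ?ltr_wpDr// (gtr0_norm s0) lerDr.
rewrite -mulrA -[X in _ <= X]mulrA ler_wpM2l ?addr_ge0 ?(ltW c0)//.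
by rewrite ler_pdivlMl// mulrA.
Qed.

Lemma half_kernel_decreasing : decreasing_kernel half_kernel.
Proof.
split.
- exact: measurable_half_kernel.
- exact: half_kernel_ge0.
- exact: half_kernel_le0.
- exact: half_kernel_decr.
- have [_ [cv _] _ _] := cI; apply: cvg_trans cv; apply: near_eq_cvg.
  by exists 0; split; [exact: num_real|move=> x x0; rewrite half_kernel_gt0E].
- exact: half_kernel_weight_intg.
Qed.

Lemma Kplus_conv_kconv phi : schwartz phi ->
  Kplus_conv K phi = (fun t => 1 * kconv half_kernel 1 phi t).
Proof.
move=> sp; apply/funext => t; have mp := schwartz_measurable sp.
have mK := measurable_Kr; have mk := measurable_half_kernel.
rewrite mul1r /Kplus_conv (Rintg_mkcond _ (p := fun s => 0 <= s))//.
apply: Rintg_off0; [by mfun|by mfun|].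
move=> s s0; rewrite mul1r /half_kernel lt_def s0 /=; ring.
Qed.

Lemma Lop00_kconv beta phi : schwartz phi ->
  Lop00 beta K phi = (fun t => beta * kconv half_kernel (-1) phi t).
Proof.
move=> sp; apply/funext => t; have mp := schwartz_measurable sp.
have mK := measurable_Kr; have mk := measurable_half_kernel.
rewrite /Lop00 /Kplus_conv (Rintg_mkcond _ (p := fun s => 0 <= s))//; congr (_ * _).
apply: Rintg_off0; [by mfun|by mfun|].
move=> s s0; rewrite opprB opprK mulN1r opprK /half_kernel lt_def s0 /= [s + t]addrC; ring.
Qed.

Lemma Kcos_Kc w : Kcos K w = Kc half_kernel w.
Proof.
rewrite /Kcos /Kc (_ : Kcos_partial K w = Kpart half_kernel 0 w)//; apply/funext => T.
have mK := measurable_Kr; have mk := measurable_half_kernel.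
rewrite /Kcos_partial (Rintg_mkcond _ (p := fun t => (0 <= t) && (t <= T)))//.
apply: Rintg_off0; [by mfun|by mfun|].
move=> s s0; rewrite addr0 /half_kernel.
case: (ltgtP s 0) s0 => // s0 _; first by rewrite !mulr0 !mul0r.
by rewrite mulr1 mulrAC.
Qed.

Lemma Ksin_Ks w : Ksin K w = Ks half_kernel w.
Proof.
rewrite /Ksin /Ks (_ : Ksin_partial K w = Kpart half_kernel (- (pi / 2)) w)//; apply/funext => T.
have mK := measurable_Kr; have mk := measurable_half_kernel.
rewrite /Ksin_partial (Rintg_mkcond _ (p := fun t => (0 <= t) && (t <= T)))//.
apply: Rintg_off0; [by mfun|by mfun|].
move=> s s0; rewrite cosBpihalf /half_kernel.
case: (ltgtP s 0) s0 => // s0 _; first by rewrite !mulr0 !mul0r.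
by rewrite mulr1 mulrAC.
Qed.

Lemma Kc_half_gt0 w : w != 0 -> 0 < Kc half_kernel w.
Proof. by move=> w0; rewrite -Kcos_Kc; have [_ _ _ h] := cI; exact: (h w w0).2. Qed.

Lemma Rintg_Kr_even f : measurable_fun setT f ->
  intg leb (fun s => half_kernel s * f s) -> intg leb (fun s => half_kernel s * f (- s)) ->
  Rintegral leb setT (fun t => Kr K t * f t) =
  Rintegral leb setT (fun s => half_kernel s * (f s + f (- s))).
Proof.
move=> mf i1 i2; have mK := measurable_Kr; have mk := measurable_half_kernel.
transitivity (Rintegral leb setT (fun t => half_kernel t * f t + half_kernel (- t) * f t)).
  apply: Rintg_off0; [by mfun|by mfun|].
  by move=> t t0; rewrite Kr_half// mulrDl.
have i2' : intg leb (fun t => half_kernel (- t) * f t).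
  by apply: (intg_ext _ (intg_reflect i2)) => t; rewrite opprK.
rewrite (RintgD i1 i2') -(Rintg_reflect i2').
rewrite (_ : Rintegral leb setT (fun x => half_kernel (- - x) * f (- x)) =
  Rintegral leb setT (fun x => half_kernel x * f (- x))); last by apply: Rintg_ext => x; rewrite opprK.
by rewrite -(RintgD i1 i2); apply: Rintg_ext => x; rewrite mulrDr.
Qed.

End HalfKernel.

(** * The spectral density *)

Section AeIntegrals.
Context d (T : measurableType d) (R : realType) (mu : {measure set T -> \bar R}).

Lemma intg_ae (f g : T -> R) : measurable_fun setT g ->
  {ae mu, forall x, f x = g x} -> intg mu f ->
  intg mu g /\ Rintegral mu setT f = Rintegral mu setT g.
Proof.
move=> mg fg fi; have mf := intg_measurable fi; split.
  apply/integrableP; split; first exact/measurable_EFinP.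
  move/integrableP : fi => [_]; apply: le_lt_trans.
  rewrite le_eqVlt; apply/orP; left; apply/eqP; apply: ae_eq_integral => //.
  - by apply: measurableT_comp => //; exact/measurable_EFinP.
  - by apply: measurableT_comp => //; exact/measurable_EFinP.
  - by apply: filterS fg => x h _; rewrite /= h.
rewrite /Rintegral; congr fine; apply: ae_eq_integral => //.
- exact/measurable_EFinP.
- exact/measurable_EFinP.
- by apply: filterS fg => x -> _.
Qed.

End AeIntegrals.

(** Off 0 the inverse is [x / x ^+ 2], with [1 / x ^+ 2] written through [ln] and [expR], which are
    measurable. *)
Lemma measurable_invR (R : realType) : measurable_fun setT (fun x : R => x^-1).
Proof.
apply: (@measurable_off0 _ _ (fun x => x * expR (- ln (x ^+ 2)))).
  have ml := @measurable_ln R; mfun.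
move=> x x0; have x2 : 0 < x ^+ 2 by rewrite lt_def sqrf_eq0 x0 sqr_ge0.
by rewrite expRN lnK ?posrE//; field.
Qed.

Section SpectralDensity.
Variable R : realType.
Local Notation leb := (@lebesgue_measure R).
Variables (kappa : R -> R) (beta : R).
Hypothesis kk : decreasing_kernel kappa.
Hypothesis beta0 : 0 < beta.
Hypothesis Kc0 : forall w, w != 0 -> 0 < Kc kappa w.

Definition Kabs2 (w : R) : R := Kc kappa w ^+ 2 + Ks kappa w ^+ 2.

(** The value at 0 is fixed because [Kc kappa 0] may be the [lim] of a divergent integral. The
    density becomes nonnegative everywhere and is altered only on a null set. *)
Definition spectral_density (w : R) : R :=
  if w == 0 then 0 else Kc kappa w / (pi * beta * Kabs2 w).

Let mKc : measurable_fun setT (Kc kappa) := measurable_Kc kk.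
Let mKs : measurable_fun setT (Ks kappa) := measurable_Ks kk.

Lemma Kabs2_ge0 w : 0 <= Kabs2 w.
Proof. by rewrite addr_ge0 ?sqr_ge0. Qed.

Lemma Kabs2_gt0 w : 0 < Kc kappa w -> 0 < Kabs2 w.
Proof. by move=> h; rewrite ltr_wpDr ?sqr_ge0// exprn_gt0. Qed.

Lemma measurable_Kabs2 : measurable_fun setT Kabs2.
Proof. by rewrite /Kabs2; mfun. Qed.

Lemma spectral_density_ge0 w : 0 <= spectral_density w.
Proof.
rewrite /spectral_density; case: ifPn => // w0.
have pb : 0 <= pi * beta by rewrite mulr_ge0 ?(ltW beta0)// ltW// pi_gt0.
by rewrite divr_ge0 ?(ltW (Kc0 w0))// mulr_ge0// Kabs2_ge0.
Qed.

Lemma measurable_spectral_density : measurable_fun setT spectral_density.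
Proof.
have mQ := measurable_Kabs2; have mi := @measurable_invR R.
apply: (@measurable_off0 _ _ (fun w => Kc kappa w * (pi * beta * Kabs2 w)^-1)); first by mfun.
by move=> w w0; rewrite /spectral_density (negbTE w0).
Qed.

Lemma Kabs2_density w : w != 0 -> beta ^+ 2 * Kabs2 w * spectral_density w = beta / pi * Kc kappa w.
Proof.
move=> w0; rewrite /spectral_density (negbTE w0).
have h : Kabs2 w != 0 by rewrite gt_eqF// Kabs2_gt0// Kc0.
have hp : pi != 0 :> R by rewrite gt_eqF// pi_gt0.
move: (pi) (Kabs2 w) hp h => P k hp h.
by field; rewrite hp h gt_eqF.
Qed.

Lemma Kc_even w : Kc kappa (- w) = Kc kappa w.
Proof.
rewrite /Kc (_ : Kpart kappa 0 (- w) = Kpart kappa 0 w)//; apply/funext => T.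
by apply: Rintg_ext => s; rewrite !addr0 mulrN cosN.
Qed.

Lemma ft_re_even phi (w : R) : ft_re phi (- w) = ft_re phi w.
Proof. by apply: Rintg_ext => t; rewrite mulrN cosN. Qed.

Lemma ft_im_odd phi (w : R) : schwartz phi -> ft_im phi (- w) = - ft_im phi w.
Proof.
move=> sp; have i : intg leb (fun t => phi t * sin (t * w)).
  apply: (intg_ext _ (intg_cos w (- (pi / 2)) (schwartz_intg sp))) => t.
  by rewrite cosBpihalf.
rewrite /ft_im -(RintgN i); congr (- _).
by apply: Rintg_ext => t; rewrite mulrN sinN mulrN.
Qed.

(** The test functions are real, so their transforms are Hermitian and [cross_im] is odd, while [Kc]
    is even. *)
Lemma cross_im_Kc phi psi : schwartz phi -> schwartz psi ->
  Rintegral leb setT (fun w => cross_im phi psi w * Kc kappa w) = 0.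
Proof.
move=> sp sq; have [_ i] := Kc_cross_intg kk sp sq.
have E := Rintg_reflect i.
have : Rintegral leb setT (fun w => cross_im phi psi (- w) * Kc kappa (- w)) =
  - Rintegral leb setT (fun w => cross_im phi psi w * Kc kappa w).
  rewrite -(RintgN i); apply: Rintg_ext => w.
  rewrite /cross_im !ft_re_even (ft_im_odd w sp) (ft_im_odd w sq) Kc_even.
  by clear i E; ring.
by rewrite E => {i E}; lra.
Qed.

Section Covariance.
Variable nu : {measure set R -> \bar R}.
Hypothesis good : {ae nu, forall w, nonsingular kappa w}.

Let Lker (phi : R -> R) : R -> R := fun t => beta * kconv kappa (-1) phi t.

Let hsg : (-1 : R) = 1 \/ (-1 : R) = -1. Proof. by right. Qed.

Let sqr_fin (f g : R -> R) : measurable_fun setT f -> measurable_fun setT g ->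
  (\int[nu]_w (f w ^+ 2 + g w ^+ 2)%:E < +oo)%E ->
  intg nu (fun w => f w ^+ 2) /\ intg nu (fun w => g w ^+ 2).
Proof.
move=> mf mg h.
have ms : measurable_fun setT (fun w => f w ^+ 2 + g w ^+ 2) by mfun.
have i : intg nu (fun w => f w ^+ 2 + g w ^+ 2).
  by apply/(ge0_intgP nu ms) => // w; rewrite addr_ge0 ?sqr_ge0.
split; apply: (intg_dom _ _ i); try by mfun.
  by move=> w; rewrite ger0_norm ?sqr_ge0// lerDl sqr_ge0.
by move=> w; rewrite ger0_norm ?sqr_ge0// lerDr sqr_ge0.
Qed.

(** Isometry for the conjugated transforms; the common factor beta (Kc + i Ks) enters through its
    squared modulus. [nu]-almost every frequency has to be nonsingular because [nu] may charge 0. *)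
Lemma Lker_covariance d (T : measurableType d) (P : probability T R)
    (xr xim : set R -> T -> R) (phi psi : R -> R) (Ir Ii Jr Ji : T -> R) :
  gauss_rand_meas nu P xr xim -> schwartz phi -> schwartz psi ->
  inDom nu (Lker phi) -> inDom nu (Lker psi) ->
  stoch_int nu P xr xim (Fre (Lker phi)) (fun w => - Fim (Lker phi) w) Ir Ii ->
  stoch_int nu P xr xim (Fre (Lker psi)) (fun w => - Fim (Lker psi) w) Jr Ji ->
  [/\ intg nu (fun w => beta ^+ 2 * Kabs2 w * cross_re phi psi w),
      intg nu (fun w => beta ^+ 2 * Kabs2 w * cross_im phi psi w),
      expect P (fun x => Ir x * Jr x + Ii x * Ji x) =
        Rintegral nu setT (fun w => beta ^+ 2 * Kabs2 w * cross_re phi psi w) &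
      expect P (fun x => Ii x * Jr x - Ir x * Ji x) =
        Rintegral nu setT (fun w => beta ^+ 2 * Kabs2 w * cross_im phi psi w)].
Proof.
move=> grm sp sq df dg sI sJ.
have mre : measurable_fun setT (fun w => beta ^+ 2 * Kabs2 w * cross_re phi psi w).
  by have mQ := measurable_Kabs2; have m := measurable_cross_re sp sq; mfun.
have mim : measurable_fun setT (fun w => beta ^+ 2 * Kabs2 w * cross_im phi psi w).
  by have mQ := measurable_Kabs2; have m := measurable_cross_im sp sq; mfun.
have Ef w : nonsingular kappa w -> Fre (Lker phi) w = beta * Hre kappa (-1) phi w /\
    Fim (Lker phi) w = beta * Him kappa (-1) phi w.
  by move=> gw; split; [exact: Fre_kconv|exact: Fim_kconv].
have Eg w : nonsingular kappa w -> Fre (Lker psi) w = beta * Hre kappa (-1) psi w /\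
    Fim (Lker psi) w = beta * Him kappa (-1) psi w.
  by move=> gw; split; [exact: Fre_kconv|exact: Fim_kconv].
case: df => _ _; case: dg => _ _; move: Ef Eg sI sJ.
move: (Fre (Lker phi)) (Fim (Lker phi)) (Fre (Lker psi)) (Fim (Lker psi)) => fr fi gr gi.
move=> Ef Eg sI sJ mgr mgi fin_g mfr mfi fin_f.
have [ifr ifi] := sqr_fin mfr mfi fin_f; have [igr igi] := sqr_fin mgr mgi fin_g.
have mfi' : measurable_fun setT (fun w => - fi w) by exact: measurable_funN.
have mgi' : measurable_fun setT (fun w => - gi w) by exact: measurable_funN.
have ifi' : intg nu (fun w => (- fi w) ^+ 2).
  by apply: (intg_ext _ ifi) => w; rewrite sqrrN.
have igi' : intg nu (fun w => (- gi w) ^+ 2).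
  by apply: (intg_ext _ igi) => w; rewrite sqrrN.
have [-> ->] := stoch_int_isometry grm mfr mfi' ifr ifi' mgr mgi' igr igi' sI sJ.
have i1 := intgD (sqr_intg_mul mfr mgr ifr igr) (sqr_intg_mul mfi' mgi' ifi' igi').
have i2 := intgB (sqr_intg_mul mfi' mgr ifi' igr) (sqr_intg_mul mfr mgi' ifr igi').
have a1 : {ae nu, forall w, fr w * gr w + - fi w * - gi w = beta ^+ 2 * Kabs2 w * cross_re phi psi w}.
  apply: filterS good => w gw; have [-> ->] := Ef w gw; have [-> ->] := Eg w gw.
  rewrite /Hre /Him /cross_re /Kabs2; ring.
have a2 : {ae nu, forall w, - fi w * gr w - fr w * - gi w = beta ^+ 2 * Kabs2 w * cross_im phi psi w}.
  apply: filterS good => w gw; have [-> ->] := Ef w gw; have [-> ->] := Eg w gw.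
  rewrite /Hre /Him /cross_im /Kabs2; ring.
have [r1 e1] := intg_ae mre a1 i1.
have [r2 e2] := intg_ae mim a2 i2.
by split; [exact: r1|exact: r2|exact: e1|exact: e2].
Qed.

End Covariance.

(** * Integrals against the spectral measure *)

Section Sufficiency.
Variable nu : {measure set R -> \bar R}.
Hypothesis nuE : forall E, measurable E -> nu E = (\int[leb]_(x in E) (spectral_density x)%:E)%E.

Lemma spectral_nonsingular : {ae nu, forall w, nonsingular kappa w}.
Proof.
exists [set 0]; split => //.
  by rewrite nuE// integral_set1.
by move=> w /= nw; apply: contrapT => w0; apply: nw; apply: nonsingular_neq0 => //; exact/eqP.
Qed.

Let nuE' E : measurable E -> nu E = (\int[@lebR R]_(x in E) (spectral_density x)%:E)%E.
Proof.
move=> mE; rewrite nuE//; apply/esym/ge0_integral_lebR => //.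
  exact: measurable_spectral_density.
exact: spectral_density_ge0.
Qed.

Let densityE (f : R -> R) : measurable_fun setT f -> intg leb (fun w => f w * spectral_density w) ->
  intg nu f /\ Rintegral nu setT f = Rintegral leb setT (fun w => f w * spectral_density w).
Proof.
move=> mf fi; have i : intg nu f.
  by apply/(intg_density measurable_spectral_density spectral_density_ge0 nuE' mf); exact: intg_lebR.
split; first exact: i.
rewrite (Rintg_density measurable_spectral_density spectral_density_ge0 nuE' i).
exact: Rintg_lebR.
Qed.

Let Kabs2_cross (f : R -> R) : measurable_fun setT f -> intg leb (fun w => f w * Kc kappa w) ->
  intg nu (fun w => beta ^+ 2 * Kabs2 w * f w) /\
  Rintegral nu setT (fun w => beta ^+ 2 * Kabs2 w * f w) =
  beta * Rintegral leb setT (fun w => pi^-1 * (f w * Kc kappa w)).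
Proof.
move=> mf fi; have mQ := measurable_Kabs2; have ms := measurable_spectral_density.
have m1 : measurable_fun setT (fun w => beta ^+ 2 * Kabs2 w * f w) by mfun.
have E w : w != 0 -> beta * (pi^-1 * (f w * Kc kappa w)) = beta ^+ 2 * Kabs2 w * f w * spectral_density w.
  by move=> w0; rewrite [RHS]mulrAC Kabs2_density//; ring.
have m2 : measurable_fun setT (fun w => beta ^+ 2 * Kabs2 w * f w * spectral_density w) by mfun.
have ib := intgZ beta (intgZ pi^-1 fi).
have i2 : intg leb (fun w => beta ^+ 2 * Kabs2 w * f w * spectral_density w).
  by apply: (intg_off0 m2 ib) => w w0; rewrite E.
have [i3 ->] := densityE m1 i2; split => //.
rewrite -(RintgZ _ (intgZ pi^-1 fi)); apply: Rintg_off0; [exact: m2|exact: intg_measurable ib|].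
by move=> w w0; rewrite E.
Qed.

Lemma spectral_inDom sg (c : R) phi : sg = 1 \/ sg = -1 -> schwartz phi ->
  inDom nu (fun t => c * kconv kappa sg phi t).
Proof.
move=> hsg sp; apply: inDom_kconv => //; first exact: spectral_nonsingular.
have [i _] := Kc_cross_intg kk sp sp.
have [h _] := Kabs2_cross (measurable_cross_re sp sp) i.
have b2 : beta ^+ 2 != 0 by rewrite expf_neq0// gt_eqF.
have {}h : intg nu (fun w => c ^+ 2 * (Kabs2 w * (ft_re phi w ^+ 2 + ft_im phi w ^+ 2))).
  apply: (intg_ext _ (intgZ (c ^+ 2 / beta ^+ 2) h)) => w.
  by rewrite /cross_re -!expr2; move: b2; set b := beta ^+ 2; move=> b2; field.
apply: (ge0_intgP nu (intg_measurable h) _).1 h => w.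
by rewrite mulr_ge0 ?sqr_ge0// mulr_ge0 ?Kabs2_ge0// addr_ge0 ?sqr_ge0.
Qed.

Lemma spectral_cross phi psi : schwartz phi -> schwartz psi ->
  Rintegral nu setT (fun w => beta ^+ 2 * Kabs2 w * cross_re phi psi w) =
    beta * Rintegral leb setT (fun w => pi^-1 * (cross_re phi psi w * Kc kappa w)) /\
  Rintegral nu setT (fun w => beta ^+ 2 * Kabs2 w * cross_im phi psi w) = 0.
Proof.
move=> sp sq; have [i1 i2] := Kc_cross_intg kk sp sq.
have [_ ->] := Kabs2_cross (measurable_cross_re sp sq) i1.
have [_ ->] := Kabs2_cross (measurable_cross_im sp sq) i2.
by rewrite (RintgZ _ i2) cross_im_Kc// !mulr0.
Qed.

End Sufficiency.

(** * The covariance identities determine the spectral measure *)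

Section Necessity.
Variable nu : {measure set R -> \bar R}.
(** At frequency 0 either there is no mass, or the factor [Kabs2] is positive and can be divided
    out. *)
Hypothesis nu0 : nu [set 0] = 0%E \/ 0 < Kc kappa 0.
Hypothesis crossE : forall phi psi, schwartz phi -> schwartz psi ->
  [/\ intg nu (fun w => beta ^+ 2 * Kabs2 w * cross_re phi psi w),
      intg nu (fun w => beta ^+ 2 * Kabs2 w * cross_im phi psi w),
      Rintegral nu setT (fun w => beta ^+ 2 * Kabs2 w * cross_re phi psi w) =
        beta * Rintegral leb setT (fun w => pi^-1 * (cross_re phi psi w * Kc kappa w)) &
      Rintegral nu setT (fun w => beta ^+ 2 * Kabs2 w * cross_im phi psi w) = 0].

(** [p c] and [q c] are the densities, with respect to [nu] and to Lebesgue measure, of the two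
    finite measures to be identified. *)
Let g (c w : R) : R := ft_re (gaussian c 0) w ^+ 2.
Let p (c w : R) : R := beta ^+ 2 * Kabs2 w * g c w.
Let q (c w : R) : R := p c w * spectral_density w.

Let crossG c a w : 0 < c -> cross_re (gaussian c a) (gaussian c 0) w = cos (a * w) * g c w /\
  cross_im (gaussian c a) (gaussian c 0) w = sin (a * w) * g c w.
Proof.
move=> c0; rewrite /cross_re /cross_im ft_im_gaussian//.
by have [-> ->] := ft_gaussian_shift a w c0; rewrite /g; split; ring.
Qed.

Let mg c : 0 < c -> measurable_fun setT (g c).
Proof.
move=> c0; have m := measurable_ft_re (schwartz_measurable (schwartz_gaussian 0 c0)).
by rewrite /g; mfun.
Qed.

Let p0 c w : 0 <= p c w.
Proof. by apply: mulr_ge0; [apply: mulr_ge0; [exact: sqr_ge0|exact: Kabs2_ge0]|exact: sqr_ge0]. Qed.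

Let ip c : 0 < c -> intg nu (p c).
Proof.
move=> c0; have sg := schwartz_gaussian 0 c0; have [i _ _ _] := crossE sg sg.
by apply: (intg_ext _ i) => w; have [-> _] := crossG 0 w c0; rewrite mul0r cos0 mul1r.
Qed.

Let q0 c w : 0 <= q c w.
Proof. by apply: mulr_ge0; [exact: p0|exact: spectral_density_ge0]. Qed.

Let mp c : 0 < c -> measurable_fun setT (p c).
Proof. by move=> c0; have m := mg c0; have mQ := measurable_Kabs2; rewrite /p; mfun. Qed.

Let mq c : 0 < c -> measurable_fun setT (q c).
Proof. by move=> c0; have m := mp c0; have ms := measurable_spectral_density; rewrite /q; mfun. Qed.

Let qE c (f : R -> R) : 0 < c -> measurable_fun setT f -> intg leb (fun w => f w * g c w * Kc kappa w) ->
  intg leb (fun w => f w * q c w) /\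
  Rintegral leb setT (fun w => f w * q c w) =
    beta * Rintegral leb setT (fun w => pi^-1 * (f w * g c w * Kc kappa w)).
Proof.
move=> c0 mf i; have m := mq c0.
have mfq : measurable_fun setT (fun w => f w * q c w) by mfun.
have ib := intgZ beta (intgZ pi^-1 i).
have E w : w != 0 -> beta * (pi^-1 * (f w * g c w * Kc kappa w)) = f w * q c w.
  move=> w0; rewrite /q /p [beta ^+ 2 * Kabs2 w * g c w * _]mulrAC Kabs2_density//; ring.
split; first by apply: (intg_off0 mfq ib) => w w0; rewrite E.
rewrite -(RintgZ _ (intgZ pi^-1 i)); apply: Rintg_off0; [exact: mfq|exact: intg_measurable ib|].
by move=> w w0; rewrite E.
Qed.

(** For the Gaussian translated by [a] and the centred one, [cross_re] and [cross_im] are cos(a w)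
    and sin(a w) times [g c w], so the covariance identities are equalities of characteristic
    functions at [a]. *)
Let eq_density c (A : set R) : 0 < c -> measurable A ->
  (\int[nu]_(w in A) (p c w)%:E = \int[leb]_(w in A) (q c w)%:E)%E.
Proof.
move=> c0 mA; have sg a := schwartz_gaussian a c0.
have mgc := mg c0; have mpc := mp c0; have mqc := mq c0.
have mcos a : measurable_fun setT (fun w : R => cos (a * w)) by mfun.
have msin a : measurable_fun setT (fun w : R => sin (a * w)) by mfun.
have icos a : intg leb (fun w => cos (a * w) * g c w * Kc kappa w).
  have [i _] := Kc_cross_intg kk (sg a) (sg 0).
  by apply: (intg_ext _ i) => w; have [-> _] := crossG a w c0.
have isin a : intg leb (fun w => sin (a * w) * g c w * Kc kappa w).
  have [_ i] := Kc_cross_intg kk (sg a) (sg 0).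
  by apply: (intg_ext _ i) => w; have [_ ->] := crossG a w c0.
have iq : intg leb (q c).
  have [i _] := qE c0 (mcos 0) (icos 0).
  by apply: (intg_ext _ i) => w; rewrite mul0r cos0 mul1r.
have [m1 hm1] := exists_density_measure (ip c0) (p0 c).
have [m2 hm2] : exists m : {finite_measure set R -> \bar R}, forall E, m E = density (@lebR R) (q c) E.
  exact: (exists_density_measure (intg_lebR iq) (q0 c)).
have fin m (f : R -> R) : measurable_fun setT f -> (forall w, `|f w| <= 1) -> intg (m : {finite_measure set R -> \bar R}) f.
  by move=> mf f1; exact: (@finite_intg _ m f 1).
have D1 (f : R -> R) : measurable_fun setT f -> (forall w, `|f w| <= 1) ->
  Rintegral m1 setT f = Rintegral nu setT (fun w => f w * p c w).
  by move=> mf f1; apply: (Rintg_density mpc (p0 c) (fun E _ => hm1 E)); exact: fin.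
have D2 (f : R -> R) : measurable_fun setT f -> (forall w, `|f w| <= 1) ->
  intg leb (fun w => f w * q c w) ->
  Rintegral m2 setT f = Rintegral leb setT (fun w => f w * q c w).
  move=> mf f1 i; rewrite (Rintg_density mqc (q0 c) (fun E _ => hm2 E) (fin m2 f mf f1)).
  exact: Rintg_lebR.
have eqm : m1 A = m2 A.
  apply: eq_finite_measure => // a.
  - rewrite D1//; last by move=> w; exact: cos_max.
    have [iqa Eq] := qE c0 (mcos a) (icos a).
    rewrite D2//; last by move=> w; exact: cos_max.
    rewrite Eq.
    have [_ _ E _] := crossE (sg a) (sg 0).
    rewrite (_ : Rintegral nu _ _ = Rintegral nu setT (fun w => beta ^+ 2 * Kabs2 w * cross_re (gaussian c a) (gaussian c 0) w)).
      by rewrite E; congr (_ * _); apply: Rintg_ext => w; have [-> _] := crossG a w c0.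
    by apply: Rintg_ext => w; have [-> _] := crossG a w c0; rewrite /p; ring.
  - rewrite D1//; last by move=> w; exact: sin_max.
    have [iqa Eq] := qE c0 (msin a) (isin a).
    rewrite D2//; last by move=> w; exact: sin_max.
    rewrite Eq.
    have [_ _ _ E] := crossE (sg a) (sg 0).
    have E2 := cross_im_Kc (sg a) (sg 0).
    rewrite (_ : Rintegral nu _ _ = Rintegral nu setT (fun w => beta ^+ 2 * Kabs2 w * cross_im (gaussian c a) (gaussian c 0) w)); last first.
      by apply: Rintg_ext => w; have [_ ->] := crossG a w c0; rewrite /p; ring.
    rewrite E (RintgZ _ (isin a)).
    rewrite (_ : Rintegral leb _ _ = Rintegral leb setT (fun w => cross_im (gaussian c a) (gaussian c 0) w * Kc kappa w)).
      by rewrite E2 !mulr0.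
    by apply: Rintg_ext => w; have [_ ->] := crossG a w c0.
move: eqm; rewrite hm1 hm2 /density => ->; exact: ge0_integral_lebR.
Qed.

(** On {0} the Lebesgue side of [eq_density] vanishes, whereas the other side is [p 1 0 * nu
    [set 0]] with [p 1 0 > 0]. *)
Let nu_set0 : nu [set 0] = 0%E.
Proof.
case: nu0 => // k0; have c0 : 0 < (1 : R) by [].
have := @eq_density 1 [set 0] c0 (measurable_set1 _).
rewrite integral_set1.
rewrite (_ : (\int[nu]_(w in [set 0%R]) (p 1 w)%:E = (p 1 0)%:E * nu [set 0%R])%E).
  move/eqP; rewrite mule_eq0 => /orP[|/eqP//].
  rewrite eqe gt_eqF//; apply: mulr_gt0; last by apply: exprn_gt0; apply: ft_gaussian_gt0; rewrite expr0n mulr_gt0.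
  by apply: mulr_gt0; [exact: exprn_gt0|exact: Kabs2_gt0].
rewrite -integral_cst//.
by apply: eq_integral => x; rewrite inE /= => ->.
Qed.

(** The window on which [ft_gaussian_gt0] applies to the Gaussian with parameter [n.+1]; these
    windows exhaust the line. *)
Let U (n : nat) : set R := [set w : R | w ^+ 2 < 4 * n.+1%:R].

Let mU n : measurable (U n).
Proof.
have m : measurable_fun setT (fun w : R => w ^+ 2) by mfun.
rewrite (_ : U n = setT `&` (fun w : R => w ^+ 2) @^-1` `]-oo, 4 * n.+1%:R[%classic).
  by apply: m => //.
by rewrite setTI; apply/seteqP; split => w /=; rewrite in_itv.
Qed.

(** The function [1 / p c], restricted to [E] and the window, is integrated against the measure [m],
    which has density [p c] for [nu] and [q c] for Lebesgue measure; comparing the results divides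
    out the common factor. *)
Let eq_window n (E : set R) : measurable E ->
  nu (E `&` U n) = (\int[leb]_(w in E `&` U n) (spectral_density w)%:E)%E.
Proof.
move=> mE; pose c : R := n.+1%:R; have c0 : 0 < c by [].
have mgc := mg c0; have mpc := mp c0; have mqc := mq c0; have ms := measurable_spectral_density.
have mA : measurable (E `&` U n) by exact: measurableI.
pose f w : R := \1_(E `&` U n) w * (p c w)^-1.
have mi := @measurable_invR R.
have m1 : measurable_fun setT (\1_(E `&` U n) : R -> R) by exact: measurable_indic.
have mf : measurable_fun setT f by rewrite /f; mfun.
have f0 w : 0 <= f w by apply: mulr_ge0; [rewrite indicE|rewrite invr_ge0; exact: p0].
have pgt0 w : w != 0 -> U n w -> 0 < p c w.
  move=> w0 Uw; apply: mulr_gt0; last by apply: exprn_gt0; exact: ft_gaussian_gt0.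
  by apply: mulr_gt0; [exact: exprn_gt0|apply: Kabs2_gt0; exact: Kc0].
have fp w : w != 0 -> f w * p c w = \1_(E `&` U n) w.
  move=> w0; rewrite /f; have [|nA] := boolP (w \in E `&` U n); last by rewrite indicE (negbTE nA) !mul0r.
  by move=> /[!inE] -[Ew Uw]; rewrite mulfVK// gt_eqF// pgt0.
have iqc : intg leb (q c).
  apply/(ge0_intgP leb mqc (q0 c)).
  rewrite -(eq_density c0 measurableT); exact: ((ge0_intgP nu mpc (p0 c)).1 (ip c0)).
have [m hm] := exists_density_measure (ip c0) (p0 c).
have J1 := ge0_integral_density mpc (p0 c) (fun E _ => hm E) mf f0.
have hm' A : measurable A -> m A = (\int[@lebR R]_(w in A) (q c w)%:E)%E.
  by move=> mA'; rewrite hm ge0_integral_lebR// -(eq_density c0 mA').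
have J2 := ge0_integral_density mqc (q0 c) hm' mf f0.
have K1 : (\int[nu]_w (f w * p c w)%:E = nu (E `&` U n))%E.
  rewrite -[in RHS](setIT (E `&` U n)) -integral_indic//.
  apply: ae_eq_integral => //.
  - by apply/measurable_EFinP; mfun.
  - exact/measurable_EFinP.
  - exists [set 0]; split; [by []|exact: nu_set0|].
    move=> w /= h; apply: contrapT => /eqP w0; apply: h => _; by rewrite fp.
have K2 : (\int[@lebR R]_w (f w * q c w)%:E = \int[leb]_(w in E `&` U n) (spectral_density w)%:E)%E.
  have mfq : measurable_fun setT (fun w => f w * q c w) by mfun.
  rewrite ge0_integral_lebR//; last by move=> w; exact: mulr_ge0.
  rewrite [RHS]integral_mkcond; apply: ae_eq_integral => //.
  - by apply/measurable_EFinP; mfun.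
  - apply/(measurable_restrictT _ _).1 => //; apply: measurable_funTS; exact/measurable_EFinP.
  - apply: ae_off0 => w w0 _; rewrite /q mulrA fp// patchE indicE.
    by case: ifPn; rewrite ?mul1r ?mul0r.
by rewrite -K1 -K2 -J1 -J2.
Qed.

Lemma spectral_uniqueness (E : set R) : measurable E ->
  nu E = (\int[leb]_(w in E) (spectral_density w)%:E)%E.
Proof.
move=> mE; have mEU n : measurable (E `&` U n) by exact: measurableI.
have EU : E = \bigcup_n (E `&` U n).
  rewrite -setI_bigcupr; apply/seteqP; split => [w Ew|w []//]; split => //.
  have [n hn] : exists n : nat, w ^+ 2 < n%:R.
    by exists (Num.truncn (w ^+ 2)).+1; exact: truncnS_gt.
  exists n => //; rewrite /U /=; apply: (lt_le_trans hn).
  by rewrite -natrM ler_nat (leq_trans (leqnSn n))// leq_pmull.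
have ndU : {homo (fun n => E `&` U n) : n m / (n <= m)%N >-> (n <= m)%O}.
  move=> n m nm; apply/subsetPset => w [Ew Uw]; split => //.
  by apply: (lt_le_trans Uw); rewrite ler_pM2l// ler_nat.
have l1 : (fun n => nu (E `&` U n)) @ \oo --> nu E.
  rewrite [X in _ --> nu X]EU; apply: nondecreasing_cvg_mu => //.
  by rewrite -EU.
have l2 : (fun n => (\int[leb]_(w in E `&` U n) (spectral_density w)%:E)%E) @ \oo -->
    (\int[leb]_(w in E) (spectral_density w)%:E)%E.
  rewrite [X in _ --> (\int[leb]_(w in X) _)%E]EU.
  apply: (@ge0_nondecreasing_set_cvg_integral _ (measurableTypeR R) R (fun n => E `&` U n)) => //.
  - move=> n; apply: measurable_funTS; apply/measurable_EFinP; exact: measurable_spectral_density.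
  - by move=> n w _; rewrite lee_fin spectral_density_ge0.
rewrite (_ : (fun n => nu _) = (fun n => (\int[leb]_(w in E `&` U n) (spectral_density w)%:E)%E)) in l1; last first.
  by apply/funext => n; exact: eq_window.
exact: (cvg_unique _ l1 l2).
Qed.

End Necessity.
End SpectralDensity.

(** * Both implications for the kernel K *)

Section Assembly.
Variables (R : realType) (K : R -> \bar R) (beta : R).
Local Notation leb := (@lebesgue_measure R).
Hypothesis beta0 : 0 < beta.
Hypothesis cI : condI K.
Hypothesis cII_III : condII K \/ condIII K.
Hypothesis cIV : condIV K.
Variable nu : {measure set R -> \bar R}.

Let kappa := half_kernel K.
Let kk : decreasing_kernel kappa := half_kernel_decreasing cI cIV cII_III.
Let Kc0 (w : R) : w != 0 -> 0 < Kc kappa w := @Kc_half_gt0 _ _ cI w.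

Lemma integral_rhat (E : set R) : measurable E ->
  (\int[leb]_(w in E) (rhat beta K w)%:E = \int[leb]_(w in E) (spectral_density kappa beta w)%:E)%E.
Proof.
have EQ (w : R) : w != 0 -> rhat beta K w = spectral_density kappa beta w.
  move=> w0; rewrite /rhat /Khat /Kplus_hat_abs2 /spectral_density (negbTE w0) Kcos_Kc// Ksin_Ks//.
  have h : Kabs2 kappa w != 0 by rewrite gt_eqF// Kabs2_gt0// Kc0.
  have hp : pi != 0 :> R by rewrite gt_eqF// pi_gt0.
  have hb : beta != 0 by rewrite gt_eqF.
  rewrite -/(Kabs2 kappa w); move: (Kabs2 kappa w) (Kc kappa w) (pi) h hp hb => Q c P h hp hb.
  by field; rewrite hb h hp.
have ms := measurable_spectral_density beta kk.
have mr := measurable_off0 ms EQ.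
move=> mE; apply: ae_eq_integral => //.
- by apply: measurable_funTS; exact/measurable_EFinP.
- by apply: measurable_funTS; exact/measurable_EFinP.
- by apply: ae_off0 => w w0 _; rewrite EQ.
Qed.

Lemma Rintg_Kr_conv_refl phi psi : schwartz phi -> schwartz psi ->
  Rintegral leb setT (fun t => Kr K t * conv_refl phi psi t) =
  Rintegral leb setT (fun w => pi^-1 * (cross_re phi psi w * Kc kappa w)).
Proof.
move=> sp sq; have [i1 i2] := kernel_conv_intg kk sp sq.
by rewrite (Rintg_Kr_even cI (measurable_conv_refl sp sq) i1 i2) kernel_Parseval.
Qed.

Section Operator.
Variables (d : measure_display) (T : measurableType d) (P : probability T R).
Variables (xr xim : set R -> T -> R) (Vr Vi : (R -> R) -> T -> R).
Hypothesis grm : gauss_rand_meas nu P xr xim.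
Hypothesis assoc : assoc_operator nu P xr xim Vr Vi.

Lemma spectral_weak_solution :
  (forall E : set R, measurable E ->
     nu E = (\int[leb]_(w in E) (spectral_density kappa beta w)%:E)%E) ->
  weak_solution00 beta K nu P Vr Vi.
Proof.
move=> nuE; have good := spectral_nonsingular kk nuE.
have dom sg c phi : sg = 1 \/ sg = -1 -> schwartz phi -> inDom nu (fun t => c * kconv kappa sg phi t).
  by move=> hsg sp; exact: (spectral_inDom kk beta0 Kc0 nuE c hsg sp).
split=> [phi sp|phi psi sp sq].
  by rewrite (Kplus_conv_kconv cI sp); apply: dom => //; left.
rewrite (Lop00_kconv cI beta sp) (Lop00_kconv cI beta sq) (Rintg_Kr_conv_refl sp sq).
have dp : inDom nu (fun t => beta * kconv kappa (-1) phi t) by apply: dom => //; right.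
have dq : inDom nu (fun t => beta * kconv kappa (-1) psi t) by apply: dom => //; right.
have [_ _ e1 e2] := Lker_covariance kk good grm sp sq dp dq (assoc dp) (assoc dq).
have [s1 s2] := spectral_cross kk beta0 Kc0 nuE sp sq.
split; [exact: dp|exact: dq| |].
- exact: (etrans e1 s1).
- exact: (etrans e2 s2).
Qed.

(** One Gaussian test function suffices: membership of its convolution in [Dom(V)] makes the Gauss
    means converge [nu]-almost everywhere, and at 0 this forces integrability, as the Gaussian is at
    least exp(-1) on [0, 1]. *)
Lemma weak_solution_nonsingular : weak_solution00 beta K nu P Vr Vi ->
  {ae nu, forall w, (w = 0 -> intg leb kappa) /\ nonsingular kappa w}.
Proof.
move=> [dom _]; have sg := @schwartz_gaussian R 1 0 ltr01.
have [good _ _ _ _] := dom _ sg.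
apply: filterS good => w [cv _].
have ik : w = 0 -> intg leb kappa.
  move=> w0; move: cv; rewrite w0 (Kplus_conv_kconv cI sg).
  under eq_fun do rewrite mul1r.
  apply: (gauss_ft_re0_intg kk sg (expR_gt0 (-1))) => [u|u /andP[u0 u1]].
    exact: ltW (gaussian_gt0 _ _ _).
  by rewrite /gaussian subr0 mul1r ler_expR lerN2 exprn_ile1.
split => //; have [w0|w0] := eqVneq w 0; first exact: nonsingular_intg (ik w0).
exact: nonsingular_neq0.
Qed.

Lemma weak_solution_spectral (E : set R) : weak_solution00 beta K nu P Vr Vi ->
  measurable E -> nu E = (\int[leb]_(w in E) (spectral_density kappa beta w)%:E)%E.
Proof.
move=> ws; have good := weak_solution_nonsingular ws.
apply: (spectral_uniqueness kk beta0 Kc0).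
- have [ik|nik] := pselect (intg leb kappa).
    right; apply: Kc0_gt0 => //.
    by rewrite /kappa half_kernel_gt0E// Kr_gt0// oner_neq0.
  (* If [kappa] is not integrable, the property fails at 0, so {0} lies in the null set [N]. *)
  left; have [N [mN N0 sN]] := good.
  apply/eqP; rewrite -measure_le0 -N0; apply: le_measure; rewrite ?inE//.
  by move=> w /= ->; apply: sN => /= -[/(_ erefl)].
- move=> phi psi sp sq; have [_ cov] := ws; have := cov phi psi sp sq.
  rewrite (Lop00_kconv cI beta sp) (Lop00_kconv cI beta sq) (Rintg_Kr_conv_refl sp sq).
  move=> [dp dq c1 c2].
  have good' : {ae nu, forall w, nonsingular kappa w} by apply: filterS good => w [].
  have [i1 i2 e1 e2] := Lker_covariance kk good' grm sp sq dp dq (assoc dp) (assoc dq).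
  split; [exact: i1|exact: i2| |].
  + exact: (etrans (esym e1) c1).
  + exact: (etrans (esym e2) c2).
Qed.

End Operator.
End Assembly.

Theorem theorem4p9 (R : realType) (K : R -> \bar R) (beta : R) :
  0 < beta ->
  condI K -> (condII K \/ condIII K) -> assumption2 K ->
  forall nu : {measure set R -> \bar R},
  (exists k : nat,
     (\int[nu]_w (((1 + w ^+ 2) ^- k)%:E) < +oo)%E) ->
  forall (d : measure_display) (T : measurableType d) (P : probability T R)
         (xr xim : set R -> T -> R) (Vr Vi : (R -> R) -> T -> R),
  gauss_rand_meas nu P xr xim ->
  assoc_operator nu P xr xim Vr Vi ->
  (weak_solution00 beta K nu P Vr Vi <->
   forall E : set R, measurable E ->
     nu E = (\int[@lebesgue_measure R]_(w in E) (rhat beta K w)%:E)%E).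
Proof.
move=> beta0 cI cII_III [cIV _] nu _ d T P xr xim Vr Vi grm assoc; split=> [ws E mE|nuE].
  rewrite (integral_rhat beta0 cI cII_III cIV mE).
  exact: (weak_solution_spectral beta0 cI cII_III cIV grm assoc ws mE).
apply: (spectral_weak_solution beta0 cI cII_III cIV grm assoc) => E mE.
by rewrite nuE// (integral_rhat beta0 cI cII_III cIV mE).
Qed.
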